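(* Let $A = \langle\Sigma, Q_A, \to_A, Q_A^\circ\rangle$ and $B = \langle\Sigma, Q_B, \to_B, Q_B^\circ\rangle$ be finite-state automata. The worst-case time complexity to determine whether $A \lesssim_{\mathrm{conf}} B$ ($A$ is less conflicting than $B$) using less conflicting pairs, i.e. by the procedure described in the context, is $$O\bigl(|\Sigma| \cdot |Q_B|^2 \cdot 4^{|Q_A|}\cdot 4^{|Q_B|}\bigr)=O\bigl(|\Sigma| \cdot |Q_B|^2 \cdot 2^{2|Q_A| + 2|Q_B|}\bigr).$$ Thus the conflict preorder can be tested in linear exponential time.
   Context: **Automata.** $\Sigma$ is a finite alphabet, and $\tau,\omega$ are two special events (silent event, termination event) not belonging to any alphabet. An automaton is $A=\langle\Sigma,Q,\to,Q^\circ\rangle$ with state set $Q$, transition relation $\to\subseteq Q\times(\Sigma\cup\{\tau,\omega\})\times Q$, initial states $Q^\circ\subseteq Q$, such that whenever $x\to^{\omega}y$, there is no outgoing transition from $y$. It is finite-state if $Q$ is finite. The relation $\to$ extends to finite traces as usual. For $s\in(\Sigma\cup\{\omega\})^*$, $x\Rightarrow^{s}y$ means $x\to^{t}y$ for some $t\in(\Sigma\cup\{\omega,\tau\})^*$ from which $s$ is obtained by deleting all $\tau$. For a state set $X$, $X\Rightarrow^{s}y$ means $x\Rightarrow^{s}y$ for some $x\in X$; $A\Rightarrow^{s}y$ means $Q^\circ\Rightarrow^{s}y$; $x\Rightarrow^{s}$ means $x\Rightarrow^{s}y$ for some $y$ (similarly for state sets and automata). $A\Rightarrow y$ means $Q^\circ\Rightarrow^{s}y$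 for some $s\in\Sigma^*$. The marked language is $\mathcal L^\omega(x)=\{s\omega\mid s\in\Sigma^*,\ x\Rightarrow^{s\omega}\}$. $r\sqsubseteq s$ means that $r$ is a prefix of $s$. **Synchronous composition.** For automata $A,B$ with alphabets $\Sigma_A,\Sigma_B$, $A\parallel B=\langle\Sigma_A\cup\Sigma_B,Q_A\times Q_B,\to,Q_A^\circ\times Q_B^\circ\rangle$, where $(x_A,x_B)\to^{\sigma}(y_A,y_B)$ if $\sigma\in(\Sigma_A\cap\Sigma_B)\cup\{\omega\}$, $x_A\to^{\sigma}_Ay_A$ and $x_B\to^{\sigma}_By_B$; $(x_A,x_B)\to^{\sigma}(y_A,x_B)$ if $\sigma\in(\Sigma_A\setminus\Sigma_B)\cup\{\tau\}$ and $x_A\to^{\sigma}_Ay_A$; $(x_A,x_B)\to^{\sigma}(x_A,y_B)$ if $\sigma\in(\Sigma_B\setminus\Sigma_A)\cup\{\tau\}$ and $x_B\to^{\sigma}_By_B$. **Conflict preorder.** $A$ is nonblocking if $A\Rightarrow x$ implies $\mathcal L^\omega(x)\neq\emptyset$ for every state $x$; otherwise it is blocking. $A\lesssim_{\mathrm{conf}}B$ means: for every automaton $T$, if $B\parallel T$ is nonblocking then $A\parallel T$ is nonblocking. The set of certain conflicts of $B$ is $\mathrm{Conf}(B)=\{s\in\Sigma^*\mid$ for every automaton $T$ such that $T\Rightarrow^{s}$, $B\parallel T$ is blocking$\}$. **Deterministic transition function.** $Q_A^{\det}=2^{Q_A}\cup\{\omega\}$, where $\omega$ is an extra symbol, regarded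 as having no elements. For $X\subseteq Q_A$: $\delta_A(X,\omega)=\omega$ if $X\Rightarrow^{\omega}$, and $\delta_A(X,\omega)=\emptyset$ otherwise; $\delta_A(X,\sigma)=\{y\in Q_A\mid X\Rightarrow^{\sigma}y\}$ for $\sigma\in\Sigma$; and $\delta_A(\omega,\sigma)=\emptyset$. It is extended to traces in $\Sigma^*\cup\Sigma^*\omega$ in the standard way ($\delta_A(X,\varepsilon)=X$, $\delta_A(X,s\sigma)=\delta_A(\delta_A(X,s),\sigma)$). Put $\delta_{A,B}(X_A,X_B,s)=(\delta_A(X_A,s),\delta_B(X_B,s))$. **Less conflicting pairs.** $\mathrm{LC}(A,B)=\bigcup_{n\ge0}\mathrm{LC}^n(A,B)\subseteq Q_A^{\det}\times Q_B^{\det}$, where - $\mathrm{LC}^0(A,B)=\{\omega\}\times Q_B^{\det}\ \cup\ \{(X_A,X_B)\mid X_B\subseteq Q_B$ and there is $x_B\in X_B$ with $\mathcal L^\omega(x_B)=\emptyset\}$; - $\mathrm{LC}^{n+1}(A,B)=\{(X_A,X_B)\mid$ there exists $x_B\in X_B$ such that for all $t\in\Sigma^*$, if $x_B\Rightarrow^{t\omega}$ then there exists $r\sqsubseteq t\omega$ such that $\delta_{A,B}(X_A,X_B,r)\in\mathrm{LC}^i(A,B)$ for some $i\le n\}$. **More conflicting triples.** $\mathrm{MC}^n(A,B)=\bigcup_{m\ge0}\mathrm{MC}^n_m(A,B)\subseteq Q_A^{\det}\times Q_B^{\det}\times Q_B$, where - $\mathrm{MC}^n_0(A,B)=\{(\emptyset,\omega,x_B)\mid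 x_B\in Q_B\}$; - $\mathrm{MC}^n_{m+1}(A,B)=\{(X_A,X_B,x_B)\mid (X_A,X_B)\notin\mathrm{LC}^n(A,B)$ and $x_B\in X_B$ and there exist $(Y_A,Y_B,y_B)\in\mathrm{MC}^n_m(A,B)$ and $\sigma\in\Sigma\cup\{\omega\}$ such that $\delta_{A,B}(X_A,X_B,\sigma)=(Y_A,Y_B)$ and $x_B\Rightarrow^{\sigma}y_B\}$. **The procedure.** First the set of certain conflicts of $B$ is determined. Then all state-set pairs for $A$ and $B$ are found that are reachable (via $\delta_{A,B}$) from a pair $(\{x_A\},X_B)$ with $A\Rightarrow^{s}x_A$ and $X_B=\delta_B(Q_B^\circ,s)$ for some trace $s\in\Sigma^*\setminus\mathrm{Conf}(B)$. The less conflicting pairs are computed in a nested iteration: once $\mathrm{LC}^n(A,B)$ is known, $\mathrm{MC}^n(A,B)$ is computed by a backwards search from the triples $(\emptyset,\omega,x_B)$ in the graph whose arrows $(X_A,X_B,x_B)\to^{\sigma}(Y_A,Y_B,y_B)$ indicate that $\delta_{A,B}(X_A,X_B,\sigma)=(Y_A,Y_B)$ and $x_B\Rightarrow^{\sigma}y_B$; then a pair $(X_A,X_B)$ is added in $\mathrm{LC}^{n+1}(A,B)$ if $(X_A,X_B,x_B)\notin\mathrm{MC}^n(A,B)$ for some $x_B\in X_B$. The iteration stops when no further pairs are added. The answer is that $A\lesssim_{\mathrm{conf}}B$ if and only if all the pairs $(\{x_A\},X_B)$ above belong to $\mathrm{LC}(A,B)$. The complexity of each iteration is determined by the number of arrows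 in this graph, bounded by $|\Sigma|\cdot|Q_B|^2\cdot2^{|Q_A|}\cdot2^{|Q_B|}$; each iteration except the last adds at least one less conflicting pair, so the number of iterations is bounded by $2^{|Q_A|}\cdot2^{|Q_B|}$; this loop dominates all other tasks of the computation.
   Formalization: The sets X_B are computed from the silent closure of Q_B° instead of Q_B° itself, which matters only for the empty trace; with the literal δ_B(Q_B°,ε)=Q_B° the criterion ''A less conflicting than B iff all pairs are in LC'' fails when B has an initial silent transition. *)

(* Defs.v *)
(* MathComp, with finmap for alphabets and boolp for the sets [set y | `[< P y >]]. *)
From Stdlib Require Import String.
From HB Require Import structures.
From mathcomp Require Import all_boot.
From mathcomp Require Import finmap.
From mathcomp Require Import boolp.

Set Implicit Arguments.
Unset Strict Implicit.
Unset Printing Implicit Defensive.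

(** Events of Sigma \cup {omega}.  Transitions are labelled by
    [option (event E)], where [None] is the silent event tau. *)
Inductive event (E : Type) := Ev of E | Term.
Arguments Term {E}.

(** All alphabets are finite subsets of one arbitrary universe [E] of events,
    so that automata with different alphabets can be composed. *)
Record automaton (E : choiceType) (S : {fset E}) := Automaton {
  state : Type;
  trans : state -> option (event E) -> state -> Prop;
  init : state -> Prop;
  trans_alphabet : forall x e y, trans x (Some (Ev e)) y -> e \in S;
  trans_term : forall x y l z, trans x (Some Term) y -> ~ trans y l z }.

Record fin_automaton (E : choiceType) (S : {fset E}) := FinAutomaton {
  fstate : finType;
  ftrans : fstate -> option (event E) -> fstate -> bool;
  finit : {set fstate};
  ftrans_alphabet : forall x e y, ftrans x (Some (Ev e)) y -> e \in S;
  ftrans_term : forall x y l z, ftrans x (Some Term) y -> ~ ftrans y l z }.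

Definition automaton_of_fin (E : choiceType) (S : {fset E})
    (A : fin_automaton S) : automaton S :=
  @Automaton E S (fstate A) (fun x l y => ftrans x l y) (fun x => x \in finit A)
    (@ftrans_alphabet E S A) (@ftrans_term E S A).
Coercion automaton_of_fin : fin_automaton >-> automaton.

Section Behaviour.
Variables (E : choiceType) (S : {fset E}) (A : automaton S).

Fixpoint run (x : state A) (t : seq (option (event E))) (y : state A) : Prop :=
  if t is l :: t' then exists z, trans x l z /\ run z t' y else x = y.

(** [weak x s y] is x =>^s y; [pmap id] deletes all silent events. *)
Definition weak (x : state A) (s : seq (event E)) (y : state A) : Prop :=
  exists t, run x t y /\ pmap id t = s.

Definition weak_init (s : seq (event E)) (y : state A) : Prop :=
  exists x, init x /\ weak x s y.

Definition events (s : seq E) : seq (event E) := [seq Ev e | e <- s].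
Definition events_term (s : seq E) : seq (event E) := rcons (events s) Term.

Definition reachable (y : state A) : Prop := exists s, weak_init (events s) y.

(** [marks x s] says that s omega belongs to the marked language of x. *)
Definition marks (x : state A) (s : seq E) : Prop :=
  exists y, weak x (events_term s) y.

Definition nonblocking : Prop :=
  forall x, reachable x -> exists s, marks x s.

End Behaviour.

Section Synchronous.
Variables (E : choiceType) (S1 S2 : {fset E}).
Variables (A : automaton S1) (B : automaton S2).
Local Open Scope fset_scope.

Definition sync_trans (x : state A * state B) (l : option (event E))
    (y : state A * state B) : Prop :=
  let both := trans x.1 l y.1 /\ trans x.2 l y.2 in
  let left := trans x.1 l y.1 /\ x.2 = y.2 in
  let right := x.1 = y.1 /\ trans x.2 l y.2 in
  match l with
  | Some Term => both
  | None => left \/ right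
  | Some (Ev e) => [\/ (e \in S1) && (e \in S2) /\ both,
                       (e \in S1) && (e \notin S2) /\ left |
                       (e \in S2) && (e \notin S1) /\ right]
  end.

Definition sync_init (x : state A * state B) : Prop := init x.1 /\ init x.2.

Lemma sync_alphabet x e y :
  sync_trans x (Some (Ev e)) y -> e \in S1 `|` S2.
Proof. by rewrite in_fsetU; case=> -[/andP [-> _] _] //; rewrite orbT. Qed.

Lemma sync_term x y l z :
  sync_trans x (Some Term) y -> ~ sync_trans y l z.
Proof.
case=> /trans_term n1 /trans_term n2; case: l => [[e|]|] /=.
- by case=> -[_ []] => [/n1|/n1|_ /n2].
- by case=> /n1.
- by case=> -[] => [/n1|_ /n2].
Qed.

Definition sync : automaton (S1 `|` S2) :=
  @Automaton E _ _ sync_trans sync_init sync_alphabet sync_term.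

End Synchronous.

Section Conflicts.
Variables (E : choiceType) (S : {fset E}).

Definition less_conflicting (A B : automaton S) : Prop :=
  forall (S' : {fset E}) (T : automaton S'),
    nonblocking (sync B T) -> nonblocking (sync A T).

Definition certain_conflict (B : automaton S) (s : seq E) : Prop :=
  {subset s <= S} /\
  forall (S' : {fset E}) (T : automaton S'),
    (exists y : state T, weak_init (events s) y) -> ~ nonblocking (sync B T).

End Conflicts.

(** Q^det; [None] is the extra symbol omega. *)
Definition det (Q : finType) := option {set Q}.

Section Pairs.
Variables (E : choiceType) (S : {fset E}).

Section Delta.
Variable A : fin_automaton S.

Definition delta (X : det (fstate A)) (v : event E) : det (fstate A) :=
  match X, v with
  | Some X, Ev _ =>
      Some [set y | `[< exists x : state A, x \in X /\ weak x [:: v] y >]]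
  | Some X, Term =>
      if `[< exists x y : state A, x \in X /\ weak x [:: v] y >]
      then None else Some set0
  | None, _ => Some set0
  end.

Definition deltas (X : det (fstate A)) (s : seq (event E)) : det (fstate A) :=
  foldl delta X s.

Definition blocked (x : fstate A) : Prop :=
  ~ exists s, marks (A := A) x s.

(** The closure of the initial states under silent transitions.  For s <> [::],
    [deltas (Some start_set) s = deltas (Some (finit A)) s].  Only for s = [::]
    does the closure matter: the criterion for [less_conflicting] by less
    conflicting pairs needs all states reached on the empty trace. *)
Definition start_set : {set fstate A} :=
  [set y | `[< weak_init (A := A) [::] y >]].

End Delta.

Variables A B : fin_automaton S.

Definition det_pair := (det (fstate A) * det (fstate B))%type.

Definition delta2 (p : det_pair) (s : seq (event E)) : det_pair :=
  (deltas p.1 s, deltas p.2 s).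

Definition LC0 (p : det_pair) : Prop :=
  p.1 = None \/
  exists (X : {set fstate B}) x, [/\ p.2 = Some X, x \in X & blocked x].

Definition LCstep (P : det_pair -> Prop) (p : det_pair) : Prop :=
  exists (X : {set fstate B}) (x : fstate B),
    [/\ p.2 = Some X, x \in X &
     forall t, marks (A := B) x t ->
     exists r u, r ++ u = events_term t /\ P (delta2 p r)].

(** [LCupto n] is the union of LC^i for i <= n, cf. [LCuptoP]. *)
Fixpoint LCupto (n : nat) (p : det_pair) : Prop :=
  if n is n'.+1 then LCupto n' p \/ LCstep (LCupto n') p else LC0 p.

Definition LCn (n : nat) (p : det_pair) : Prop :=
  if n is n'.+1 then LCstep (LCupto n') p else LC0 p.

Lemma LCuptoP n p : LCupto n p <-> exists2 i, i <= n & LCn i p.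
Proof.
elim: n p => [|n IH] p /=.
  by split=> [?|[[|i] // _]] //; exists 0.
split=> [[/IH [i lein h]|h]|[i]]; first by exists i => //; apply: leqW.
  by exists n.+1.
by rewrite leq_eqVlt => /orP [/eqP -> h|lein h]; [right|left; apply/IH; exists i].
Qed.

Definition LC (p : det_pair) : Prop := exists n, LCn n p.

Fixpoint MCnm (n m : nat) (p : det_pair) (x : fstate B) : Prop :=
  if m is m'.+1 then
    [/\ ~ LCn n p, exists2 X, p.2 = Some X & x \in X &
     exists (v : event E) (y : fstate B),
       MCnm n m' (delta2 p [:: v]) y /\ weak (A := B) x [:: v] y]
  else p = (Some set0, None).

Definition MCn (n : nat) (p : det_pair) (x : fstate B) : Prop :=
  exists m, MCnm n m p x.

(** The pairs on which the answer depends, and the pairs reachable from them. *)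
Definition start_pair (p : det_pair) : Prop :=
  exists s x, [/\ {subset s <= S}, ~ certain_conflict B s,
    weak_init (A := A) (events s) x &
    p = (Some [set x], deltas (Some (start_set B)) (events s))].

Definition reachable_pair (p : det_pair) : Prop :=
  exists q s, [/\ start_pair q,
    forall e r u, s = r ++ Ev e :: u -> e \in S & p = delta2 q s].

End Pairs.

(** The memory consists of named arrays of naturals, of any dimension; scalars
    are arrays of dimension 0.  The only arithmetic is addition, so that no
    large numbers can be computed in few steps. *)
Definition memory := string -> seq nat -> nat.

Inductive binop := Add | Eq | Lt | And.

Inductive expr :=
  | Cst of nat
  | Rd of string & seq expr
  | Bin of binop & expr & expr.

Inductive cmd :=
  | Skip
  | Assign of string & seq expr & expr
  | Seq of cmd & cmd
  | If of expr & cmd & cmd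
  | While of expr & cmd.

Definition binop_sem (o : binop) (m n : nat) : nat :=
  match o with
  | Add => m + n
  | Eq => m == n
  | Lt => m < n
  | And => (m != 0) && (n != 0)
  end.

Fixpoint eval (m : memory) (e : expr) : nat :=
  match e with
  | Cst n => n
  | Rd a es => m a (map (eval m) es)
  | Bin o e1 e2 => binop_sem o (eval m e1) (eval m e2)
  end.

Fixpoint cost (e : expr) : nat :=
  match e with
  | Cst _ => 1
  | Rd _ es => (sumn (map cost es)).+1
  | Bin _ e1 e2 => (cost e1 + cost e2).+1
  end.

Definition write (m : memory) (a : string) (i : seq nat) (n : nat) : memory :=
  fun b j => if String.eqb a b && (i == j) then n else m b j.

(** [exec c m m' t]: started in memory [m], the program [c] stops in memory
    [m'] after [t] elementary steps. *)
Inductive exec : cmd -> memory -> memory -> nat -> Prop :=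
  | ExecSkip m : exec Skip m m 1
  | ExecAssign a es e m :
      exec (Assign a es e) m (write m a (map (eval m) es) (eval m e))
        (sumn (map cost es) + cost e).+1
  | ExecSeq c1 c2 m1 m2 m3 t1 t2 :
      exec c1 m1 m2 t1 -> exec c2 m2 m3 t2 -> exec (Seq c1 c2) m1 m3 (t1 + t2)
  | ExecIfT e c1 c2 m m' t :
      eval m e != 0 -> exec c1 m m' t -> exec (If e c1 c2) m m' (cost e + t).+1
  | ExecIfF e c1 c2 m m' t :
      eval m e = 0 -> exec c2 m m' t -> exec (If e c1 c2) m m' (cost e + t).+1
  | ExecWhileT e c m1 m2 m3 t1 t2 :
      eval m1 e != 0 -> exec c m1 m2 t1 -> exec (While e c) m2 m3 t2 ->
      exec (While e c) m1 m3 (cost e + t1 + t2).+1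
  | ExecWhileF e c m :
      eval m e = 0 -> exec (While e c) m m (cost e).+1.

Lemma exec_det c m m1 t1 m2 t2 :
  exec c m m1 t1 -> exec c m m2 t2 -> m1 = m2 /\ t1 = t2.
Proof.
move=> h; elim: h m2 t2 => {c m m1 t1}.
- by move=> m m2 t2 h; inversion h.
- by move=> a es e m m2 t2 h; inversion h.
- move=> c1 c2 m1 m2 m3 t1 t2 _ IH1 _ IH2 m' t' h; inversion h; subst.
  match goal with H : exec c1 _ _ _ |- _ => case: (IH1 _ _ H) => ? ?; subst end.
  by match goal with H : exec c2 _ _ _ |- _ => case: (IH2 _ _ H) => -> -> end.
- move=> e c1 c2 m m' t /eqP ne _ IH m2 t2 h; inversion h; subst => //.
  by match goal with H : exec c1 _ _ _ |- _ => case: (IH _ _ H) => -> -> end.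
- move=> e c1 c2 m m' t eq0 _ IH m2 t2 h; inversion h; subst => //.
    by match goal with H : is_true (_ != _) |- _ => rewrite eq0 in H end.
  by match goal with H : exec c2 _ _ _ |- _ => case: (IH _ _ H) => -> -> end.
- move=> e c m1 m2 m3 t1 t2 /eqP ne _ IH1 _ IH2 m' t' h; inversion h; subst => //.
  match goal with H : exec c _ _ _ |- _ => case: (IH1 _ _ H) => ? ?; subst end.
  by match goal with H : exec (While e c) _ _ _ |- _ =>
    case: (IH2 _ _ H) => -> -> end.
- move=> e c m eq0 m2 t2 h; inversion h; subst => //.
  by match goal with H : is_true (_ != _) |- _ => rewrite eq0 in H end.
Qed.

(** The events of Sigma are numbered from 0, followed by omega and tau. *)
Definition labels (E : choiceType) (S : {fset E}) : seq (option (event E)) :=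
  rcons (rcons [seq Some (Ev e) | e <- enum_fset S] (Some Term)) None.

Section Encoding.
Variables (E : choiceType) (S : {fset E}).

Definition trans_table (A : fin_automaton S) (l x y : nat) : nat :=
  match onth (labels S) l, onth (enum (fstate A)) x, onth (enum (fstate A)) y
  with
  | Some l, Some x, Some y => ftrans x l y
  | _, _, _ => 0
  end.

Definition init_table (A : fin_automaton S) (x : nat) : nat :=
  if onth (enum (fstate A)) x is Some x then x \in finit A else false.

Definition input (A B : fin_automaton S) : memory := fun a i =>
  match a, i with
  | "nE"%string, [::] => #|` S|%fset
  | "nA"%string, [::] => #|fstate A|
  | "nB"%string, [::] => #|fstate B|
  | "initA"%string, [:: x] => init_table A x
  | "initB"%string, [:: x] => init_table B x
  | "transA"%string, [:: l; x; y] => trans_table A l x y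
  | "transB"%string, [:: l; x; y] => trans_table B l x y
  | _, _ => 0
  end.

(** Subsets are numbered as bit vectors, followed by omega. *)
Definition code (Q : finType) (X : det Q) : nat :=
  if X is Some X then \sum_(x in X) 2 ^ enum_rank x else 2 ^ #|Q|.

End Encoding.

Declare Scope ram_scope.
Delimit Scope ram_scope with ram.

Definition Var (a : string) : expr := Rd a [::].
Coercion Cst : nat >-> expr.
Coercion Var : string >-> expr.

Definition assign (l e : expr) : cmd :=
  if l is Rd a es then Assign a es e else Skip.
Definition For (i : string) (n : expr) (c : cmd) : cmd :=
  Seq (Assign i [::] 0)
    (While (Bin Lt i n) (Seq c (Assign i [::] (Bin Add i 1)))).
Definition When (e : expr) (c : cmd) : cmd := If e c Skip.

Notation "a @[ i , .. , j ]" := (Rd a (@cons expr i .. (@cons expr j nil) ..))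
  (at level 2, left associativity, format "a @[ i ,  .. ,  j ]") : ram_scope.
Notation "l <- e" := (assign l e) (at level 75) : ram_scope.
Notation "c1 ;; c2" := (Seq c1 c2)
  (at level 80, right associativity, format "c1 ;; '/' c2") : ram_scope.
Notation "e1 + e2" := (Bin Add e1 e2) : ram_scope.
Notation "e1 == e2" := (Bin Eq e1 e2) : ram_scope.
Notation "e1 < e2" := (Bin Lt e1 e2) : ram_scope.
Notation "e1 && e2" := (Bin And e1 e2) : ram_scope.

Local Open Scope string_scope.
Local Open Scope ram_scope.

Section Prepare.

(** [u] is the suffix "A" or "B" of the automaton being processed. *)
Variable u : string.
Let n := Var ("n" ++ u).
Let N := "N" ++ u.
Let tr := "trans" ++ u.
Let cl := "closure" ++ u.
Let step := "step" ++ u.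
Let pow := "pow" ++ u.
Let mem := "mem" ++ u.
Let dlt := "delta" ++ u.

(** [step@[e, x, y]] is x =>^e y, where e = nE is omega. *)
Definition weak_steps : cmd :=
  For "x" n (cl@["x", "x"] <- 1);;
  For "i" n (For "x" n (For "y" n (For "z" n (
    When (cl@["x", "y"] && tr@["nE" + 1, "y", "z"])
      (cl@["x", "z"] <- 1)))));;
  For "e" ("nE" + 1) (For "x" n (For "w" n (For "z" n (For "y" n (
    When (cl@["x", "w"] && (tr@["e", "w", "z"] && cl@["z", "y"]))
      (step@["e", "x", "y"] <- 1)))))).

(** [N] becomes 2^n, [pow@[q]] becomes 2^q, and [mem@[X, x]] is x \in X. *)
Definition subsets : cmd :=
  N <- 1;;
  For "q" n (
    pow@["q"] <- N;;
    For "X" N (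
      For "x" "q" (mem@["X" + N, "x"] <- mem@["X", "x"]);;
      mem@["X" + N, "q"] <- 1);;
    N <- N + N).

Definition subset_construction : cmd :=
  For "X" (N + 1) (
    For "e" "nE" (
      "Y" <- 0;;
      For "y" n (
        "found" <- 0;;
        For "x" n (
          When (mem@["X", "x"] && step@["e", "x", "y"]) ("found" <- 1));;
        When "found" ("Y" <- "Y" + pow@["y"]));;
      dlt@["X", "e"] <- "Y");;
    dlt@["X", "nE"] <- 0;;
    For "x" n (For "y" n (
      When (mem@["X", "x"] && step@["nE", "x", "y"])
        (dlt@["X", "nE"] <- N)))).

Definition prepare : cmd := weak_steps;; subsets;; subset_construction.

End Prepare.

(** [live@[x]] says that the marked language of the state x of B is nonempty. *)
Definition live_states : cmd :=
  For "x" "nB" (For "y" "nB" (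
    When ("stepB"@["nE", "x", "y"]) ("live"@["x"] <- 1)));;
  For "i" "nB" (For "e" "nE" (For "x" "nB" (For "y" "nB" (
    When ("stepB"@["e", "x", "y"] && "live"@["y"]) ("live"@["x"] <- 1))))).

Definition reset : cmd :=
  "tail" <- 0;;
  For "XA" ("NA" + 1) (For "XB" ("NB" + 1) (
    "node"@["XA", "XB"] <- 0;;
    "cnt"@["XA", "XB"] <- 0;;
    "lc"@["XA", "XB"] <- 0)).

Definition add_node (a b : expr) : cmd :=
  When ("node"@[a, b] == 0) (
    "node"@[a, b] <- 1;;
    "nodeA"@["tail"] <- a;;
    "nodeB"@["tail"] <- b;;
    "tail" <- "tail" + 1).

(** Adds all pairs reachable from the nodes, and records the arrows of the
    pair graph in adjacency lists of predecessors. *)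
Definition explore : cmd :=
  "head" <- 0;;
  While ("head" < "tail") (
    "XA" <- "nodeA"@["head"];;
    "XB" <- "nodeB"@["head"];;
    "head" <- "head" + 1;;
    For "e" ("nE" + 1) (
      "YA" <- "deltaA"@["XA", "e"];;
      "YB" <- "deltaB"@["XB", "e"];;
      "k" <- "cnt"@["YA", "YB"];;
      "predA"@["YA", "YB", "k"] <- "XA";;
      "predB"@["YA", "YB", "k"] <- "XB";;
      "predE"@["YA", "YB", "k"] <- "e";;
      "cnt"@["YA", "YB"] <- "k" + 1;;
      add_node "YA" "YB")).

Definition add_triple (a b x : expr) : cmd :=
  "mc"@[a, b, x] <- 1;;
  "queueA"@["qtail"] <- a;;
  "queueB"@["qtail"] <- b;;
  "queuex"@["qtail"] <- x;;
  "qtail" <- "qtail" + 1.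

(** Backwards search for the more conflicting triples, from the triples
    (empty set, omega, x). *)
Definition more_conflicting : cmd :=
  For "h" "tail" (For "x" "nB" (
    "mc"@["nodeA"@["h"], "nodeB"@["h"], "x"] <- 0));;
  "qtail" <- 0;;
  "qhead" <- 0;;
  When ("node"@[0, "NB"]) (For "x" "nB" (add_triple 0 "NB" "x"));;
  While ("qhead" < "qtail") (
    "YA" <- "queueA"@["qhead"];;
    "YB" <- "queueB"@["qhead"];;
    "y" <- "queuex"@["qhead"];;
    "qhead" <- "qhead" + 1;;
    For "k" ("cnt"@["YA", "YB"]) (
      "XA" <- "predA"@["YA", "YB", "k"];;
      "XB" <- "predB"@["YA", "YB", "k"];;
      "e" <- "predE"@["YA", "YB", "k"];;
      When ("lc"@["XA", "XB"] == 0) (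
        For "x" "nB" (
          When (("memB"@["XB", "x"] && "stepB"@["e", "x", "y"]) &&
                ("mc"@["XA", "XB", "x"] == 0))
            (add_triple "XA" "XB" "x"))))).

(** [lc@[XA, XB]] is 0 while the pair has not been added, and i + 1 once it has
    been added in LC^i. *)
Definition less_conflicting_pairs : cmd :=
  For "h" "tail" (
    "XA" <- "nodeA"@["h"];;
    "XB" <- "nodeB"@["h"];;
    When ("XA" == "NA") ("lc"@["XA", "XB"] <- 1);;
    For "x" "nB" (
      When ("memB"@["XB", "x"] && ("live"@["x"] == 0))
        ("lc"@["XA", "XB"] <- 1)));;
  "n" <- 0;;
  "changed" <- 1;;
  While "changed" (
    "changed" <- 0;;
    more_conflicting;;
    For "h" "tail" (
      "XA" <- "nodeA"@["h"];;
      "XB" <- "nodeB"@["h"];;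
      When ("lc"@["XA", "XB"] == 0) (
        For "x" "nB" (
          When ("memB"@["XB", "x"] && ("mc"@["XA", "XB", "x"] == 0)) (
            "lc"@["XA", "XB"] <- "n" + 2;;
            "changed" <- 1))));;
    "n" <- "n" + 1).

(** A trace s is a certain conflict of B iff (empty set, X) is a less
    conflicting pair for the set X of states of B reached by some prefix of s.
    So the nested iteration, run on the pairs (empty set, X), also determines
    the certain conflicts. *)
Definition certain_conflicts : cmd :=
  reset;;
  For "X" ("NB" + 1) (add_node 0 "X");;
  explore;;
  less_conflicting_pairs;;
  For "X" "NB" ("conf"@["X"] <- 0 < "lc"@[0, "X"]).

Definition add_start (a b : expr) : cmd :=
  When ("start"@[a, b] == 0) (
    "start"@[a, b] <- 1;;
    "startA"@["stail"] <- a;;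
    "startB"@["stail"] <- b;;
    "stail" <- "stail" + 1).

(** Finds the states x of A and sets X of B reached by a common trace that is
    not a certain conflict of B. *)
Definition start_pairs : cmd :=
  "stail" <- 0;;
  "X" <- 0;;
  For "y" "nB" (
    "found" <- 0;;
    For "x" "nB" (
      When ("initB"@["x"] && "closureB"@["x", "y"]) ("found" <- 1));;
    When "found" ("X" <- "X" + "powB"@["y"]));;
  When ("conf"@["X"] == 0) (
    For "x" "nA" (For "y" "nA" (
      When ("initA"@["x"] && "closureA"@["x", "y"]) (add_start "y" "X"))));;
  "shead" <- 0;;
  While ("shead" < "stail") (
    "x" <- "startA"@["shead"];;
    "X" <- "startB"@["shead"];;
    "shead" <- "shead" + 1;;
    For "e" "nE" (
      "Y" <- "deltaB"@["X", "e"];;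
      When ("conf"@["Y"] == 0) (
        For "y" "nA" (
          When ("stepA"@["e", "x", "y"]) (add_start "y" "Y"))))).

Definition procedure : cmd :=
  prepare "A";;
  prepare "B";;
  live_states;;
  certain_conflicts;;
  start_pairs;;
  reset;;
  For "h" "stail" (add_node ("powA"@["startA"@["h"]]) ("startB"@["h"]));;
  explore;;
  less_conflicting_pairs;;
  "answer" <- 1;;
  For "h" "stail" (
    When ("lc"@["powA"@["startA"@["h"]], "startB"@["h"]] == 0)
      ("answer" <- 0)).

Definition conf_table (m : memory) (X : nat) : nat := m "conf" [:: X].
Definition lc_table (m : memory) (XA XB : nat) : nat := m "lc" [:: XA; XB].
Definition mc_table (m : memory) (XA XB x : nat) : nat :=
  m "mc" [:: XA; XB; x].
Definition iterations (m : memory) : nat := m "n" [::].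
Definition answer (m : memory) : nat := m "answer" [::].

(* Main.v *)
From Stdlib Require Import String.
Require Import Defs.
From mathcomp Require Import all_boot.
From mathcomp Require Import finmap.
From mathcomp Require Import boolp zify.

Set Implicit Arguments.
Unset Strict Implicit.
Unset Printing Implicit Defensive.
Local Arguments String.append : simpl never.

(** If a pair is not less conflicting, the test that tracks the two state sets
    and refuses every event leading to a less conflicting pair does not
    conflict with B, and it blocks A because A could terminate only in a pair
    (omega, _), which is in LC^0.  Conversely, by induction on the level of a
    less conflicting pair, a test that does not conflict with B can terminate
    together with some state of A in the pair.  A state of B outside the more
    conflicting triples of level n has no marked trace avoiding LC^n, so the
    backwards search computes exactly one step of the iteration.

    A triple enters the queue of the backwards search at most once, so that one
    round costs the number of arrows, i.e. the total length of the adjacency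
    lists; each round but the last adds a pair.  The factors (|Q_A| + 1)^4 and
    (|Q_B| + 1)^4 of the preparation are absorbed by 2^|Q_A| and 2^|Q_B|. *)

(** * Less conflicting pairs *)

(** The levels [LCn] are not increasing: a pair of level 0 whose second component is omega or empty,
    such as [(None, None)], lies in no later [LCn]. The proof therefore works with the cumulative
    [LCupto]; [LCn_LCupto] goes back where the second component has an element, as in every more
    conflicting triple but the final ones.

    A state of B has infinitely many marked traces, each with its own level. That there are finitely
    many pairs gives one level for all ([LC_bounded]); this makes LC a fixed point and yields the
    trace that the permissive test follows.

    The iteration sees only the explored pairs. A round that adds none of them is final because the
    explored pairs are closed under all events and omega ([LC_stable]).

    The constant of the running time must not depend on the automata, so each part of the program is
    given an existential constant that is opened before the automata are introduced. The number of
    pairs enters once through the rounds and once through the arrows, which turns 2 into 4 in the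
    bound. *)

Section Runs.
Variables (E : choiceType) (S : {fset E}) (A : automaton S).
Implicit Types (x y z : state A) (s : seq (event E)).

Lemma run_cat x t1 t2 y :
  run x (t1 ++ t2) y <-> exists2 z, run x t1 z & run z t2 y.
Proof.
elim: t1 x => [|l t1 IH] x /=; first by split=> [|[z ->]] //; exists x.
split=> [[w [xw /IH [z wz zy]]]|[z [w [xw wz]] zy]].
  by exists z => //; exists w.
by exists w; split=> //; apply/IH; exists z.
Qed.

Lemma weak_refl x : weak x [::] x.
Proof. by exists [::]. Qed.

(** With [s1 = [::]] or [s2 = [::]] this absorbs silent steps before or after a weak step, which is
    its main use below. *)
Lemma weak_cat x s1 s2 y :
  weak x (s1 ++ s2) y <-> exists2 z, weak x s1 z & weak z s2 y.
Proof.
split=> [[t [xy ts]]|[z [t1 [xz <-]] [t2 [zy <-]]]]; last first.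
  by exists (t1 ++ t2); rewrite pmap_cat; split=> //; apply/run_cat; exists z.
elim: t x s1 xy ts => [|l t IH] x s1 /=.
  by case: s1 => [->|//] /= <-; exists y; apply: weak_refl.
case=> w [xw wy]; case: l xw => [v|] xw /= ts.
  case: s1 ts => [|v' s1] /= ts.
    by exists x; [apply: weak_refl|exists (Some v :: t); split=> //; exists w].
  case: ts => <- ts; have [z [t1 [wz <-]] zy] := IH _ _ wy ts.
  by exists z => //; exists (Some v :: t1); split=> //; exists w.
have [z [t1 [wz <-]] zy] := IH _ _ wy ts.
by exists z => //; exists (None :: t1); split=> //; exists w.
Qed.

Lemma weak_trans x l y : trans x l y -> weak x (pmap id [:: l]) y.
Proof. by move=> xy; exists [:: l]; split=> //; exists y. Qed.

(** Isolates the only visible transition. Composition synchronises on it, and [weak_steps] computes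
    exactly this product of closure, transition and closure. *)
Lemma weak1P x v y : weak x [:: v] y <->
  exists w z, [/\ weak x [::] w, trans w (Some v) z & weak z [::] y].
Proof.
split=> [[t [xy ts]]|[w [z [xw wz zy]]]]; last first.
  apply/(weak_cat _ [::]); exists w => //.
  by apply/(weak_cat _ [:: v]); exists z => //; apply: weak_trans wz.
elim: t x xy ts => [|[v'|] t IH] x //=.
  move=> [z [xz zy]] [<- ts]; exists x, z; split=> //; last by exists t.
  exact: weak_refl.
move=> [x' [xx' x'y]] /(IH _ x'y) [w [z [x'w wz zy]]]; exists w, z; split=> //.
by apply/(weak_cat _ [::]); exists x' => //; apply: weak_trans xx'.
Qed.


(** Omega counts as a member of every alphabet, since composition always synchronises on it;
    projections therefore keep it. *)
Definition ev_in (U : {fset E}) (v : event E) : bool :=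
  if v is Ev e then e \in U else true.

Lemma weak_alphabet x s y : weak x s y -> all (ev_in S) s.
Proof.
case=> t [xy <-]; elim: t x xy => [|[v|] t IH] x //= [z [xz /IH ->]] //.
by rewrite andbT; case: v xz => // e /trans_alphabet.
Qed.

Lemma all_events (U : {fset E}) t : all (ev_in U) (events t) = all (mem U) t.
Proof. by rewrite /events all_map; apply: eq_all. Qed.

Lemma weak_events_alphabet x (s : seq E) y : weak x (events s) y -> {subset s <= S}.
Proof. by move/weak_alphabet; rewrite all_events => /allP. Qed.

Lemma marks_alphabet x t : marks x t -> {subset t <= S}.
Proof.
case=> y /weak_alphabet; rewrite /events_term all_rcons /= all_events.
by move=> /allP.
Qed.

Lemma marks_cons x e t :
  marks x (e :: t) <-> exists2 y, weak x [:: Ev e] y & marks y t.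
Proof.
split=> [[z /(weak_cat _ [:: Ev e]) [y xy yz]]|[y xy [z yz]]].
  by exists y => //; exists z.
by exists z; apply/(weak_cat _ [:: Ev e]); exists y.
Qed.

Lemma marks_cat x (s t : seq E) :
  marks x (s ++ t) <-> exists2 y, weak x (events s) y & marks y t.
Proof.
rewrite /marks /events_term /events map_cat rcons_cat.
split=> [[z /weak_cat [y xy yz]]|[y xy [z yz]]].
  by exists y => //; exists z.
by exists z; apply/weak_cat; exists y.
Qed.

End Runs.

Lemma events_cat (E : choiceType) (s t : seq E) : events (s ++ t) = events s ++ events t.
Proof. exact: map_cat. Qed.

(** [Term] occurs only at the end, so a prefix that stops earlier consists of events. *)
Lemma events_term_split (E : choiceType) (t : seq E) r w : r ++ w = events_term t ->
  r = events_term t \/ exists t1 t2, t = t1 ++ t2 /\ r = events t1.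
Proof.
rewrite /events_term; elim: t r => [|e t IH] [|v r] /=.
- by right; exists [::], [::].
- by case=> ->; case: r => // _; left.
- by right; exists [::], (e :: t).
case=> -> /IH [->|[t1 [t2 [-> ->]]]]; first by left.
by right; exists (e :: t1), t2.
Qed.

(** Lifts a cut of a projected word to a cut of the word itself, which may contain private events of
    the test. *)
Lemma filter_split (T : Type) (a : pred T) u t1 t2 : filter a u = t1 ++ t2 ->
  exists u1 u2, [/\ u = u1 ++ u2, filter a u1 = t1 & filter a u2 = t2].
Proof.
elim: u t1 => [|e u IH] t1 /=; first by case: t1 t2 => [|//] [|//] _; exists [::], [::].
case: ifP => ae; last first.
  by move=> /IH [u1 [u2 [-> <- <-]]]; exists (e :: u1), u2; rewrite /= ae.
case: t1 => [|e' t1] /=.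
  by move=> <-; exists [::], (e :: u); rewrite /= ae.
by case=> <- /IH [u1 [u2 [-> <- <-]]]; exists (e :: u1), u2; rewrite /= ae.
Qed.

(** * Runs of a synchronous composition and their projections *)

Section SyncRuns.
Variables (E : choiceType) (S1 S2 : {fset E}).
Variables (A : automaton S1) (B : automaton S2).
Local Notation AB := (sync A B).

Definition proj (U : {fset E}) (u : seq (event E)) := filter (ev_in U) u.

Lemma proj_events U s : proj U (events s) = events (filter [in U] s).
Proof. by rewrite /proj /events filter_map. Qed.

Lemma proj_events_term U s :
  proj U (events_term s) = events_term (filter [in U] s).
Proof. by rewrite /proj /events_term filter_rcons /= -/(proj _ _) proj_events. Qed.

Lemma proj_id U u : all (ev_in U) u -> proj U u = u.
Proof. exact/all_filterP. Qed.

Lemma sync_weakE (x x' : state A) (y y' : state B) u :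
  weak (A := AB) (x, y) u (x', y') ->
  weak x (proj S1 u) x' /\ weak y (proj S2 u) y'.
Proof.
case=> t [run_t <-]; elim: t x y run_t => [|l t IH] x y /=.
  by case=> -> ->; split; apply: weak_refl.
case=> -[x1 y1] [step /IH [wx wy]]; rewrite /proj.
have one S (C : automaton S) (c c1 c' : state C) v s :
  trans c (Some v) c1 -> weak c1 s c' -> weak c (v :: s) c'.
  by move=> cc cs; apply/(weak_cat _ [:: v]); exists c1 => //; apply: weak_trans cc.
have one' S (C : automaton S) (c c1 c' : state C) s :
  trans c None c1 -> weak c1 s c' -> weak c s c'.
  by move=> cc cs; apply/(weak_cat _ [::]); exists c1 => //; apply: weak_trans cc.
case: l step => [[e|]|] /=.
- case=> -[/andP [e1 e2] [s1 s2]].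
  + by rewrite e1 e2; split; [apply: one wx|apply: one wy].
  + by rewrite e1 (negbTE e2); move: s2 => /= ->; split=> //; apply: one wx.
  + by rewrite e1 (negbTE e2); move: s1 => /= ->; split=> //; apply: one wy.
- by case=> s1 s2; split; [apply: one wx|apply: one wy].
- by case=> -[/= s1 s2]; [rewrite s2|rewrite s1]; split=> //;
    [apply: one' wx|apply: one' wy].
Qed.

Lemma sync_silent (x x' : state A) (y y' : state B) :
  weak x [::] x' -> weak y [::] y' -> weak (A := AB) (x, y) [::] (x', y').
Proof.
move=> [t [xx tn]] [t2 [yy t2n]]; apply/(weak_cat _ [::]); exists (x', y).
  elim: t x xx tn => [|[v|] t IH] x //=; first by move=> -> _; apply: weak_refl.
  case=> x1 [xx1 /IH h] /h w; apply/(weak_cat _ [::]); exists (x1, y) => //.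
  by exists [:: None]; split=> //; exists (x1, y); split=> //; left.
elim: t2 y yy t2n => [|[v|] t2 IH] y //=; first by move=> -> _; apply: weak_refl.
case=> y1 [yy1 /IH h] /h w; apply/(weak_cat _ [::]); exists (x', y1) => //.
by exists [:: None]; split=> //; exists (x', y1); split=> //; right.
Qed.

(** The condition on [u] excludes events outside both alphabets: both projections erase them, yet
    the composition has no transition for them. *)
Lemma sync_weakI (x x' : state A) (y y' : state B) u :
  all (ev_in (S1 `|` S2)%fset) u ->
  weak x (proj S1 u) x' -> weak y (proj S2 u) y' ->
  weak (A := AB) (x, y) u (x', y').
Proof.
elim: u x y => [|v u IH] x y; first by move=> _; apply: sync_silent.
move=> /= /andP [vS uS] wx wy.
have split_cons S (C : automaton S) (c c' : state C) :
  weak c (proj S (v :: u)) c' -> exists2 d, weak d (proj S u) c' &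
    if ev_in S v then weak c [:: v] d else c = d.
  rewrite /proj /=; case: ifP => _; last by exists c.
  by move=> /(weak_cat _ [:: v]) [d cd dc]; exists d.
have [x1 wx1 sx] := split_cons _ _ _ _ wx.
have [y1 wy1 sy] := split_cons _ _ _ _ wy.
apply/(weak_cat _ [:: v]); exists (x1, y1); last exact: IH.
move: vS sx sy; rewrite /ev_in; case: v {split_cons wx wy} => [e|] /=.
  rewrite in_fsetU; case: ifP => e1; case: ifP => e2 // _.
  - move=> /weak1P [a [a' [xa aa a'x]]] /weak1P [b [b' [yb bb b'y]]].
    apply/weak1P; exists (a, b), (a', b'); split; [exact: sync_silent| |exact: sync_silent].
    by apply: Or31; rewrite e1 e2.
  - move=> /weak1P [a [a' [xa aa a'x]]] yy; subst y1.
    apply/weak1P; exists (a, y), (a', y); split; [| |].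
    + by apply: sync_silent => //; apply: weak_refl.
    + by apply: Or32; rewrite e1 e2.
    + by apply: sync_silent => //; apply: weak_refl.
  - move=> xx /weak1P [b [b' [yb bb b'y]]]; subst x1.
    apply/weak1P; exists (x, b), (x, b'); split; [| |].
    + by apply: sync_silent => //; apply: weak_refl.
    + by apply: Or33; rewrite e1 e2.
    + by apply: sync_silent => //; apply: weak_refl.
move=> _ /weak1P [a [a' [xa aa a'x]]] /weak1P [b [b' [yb bb b'y]]].
by apply/weak1P; exists (a, b), (a', b'); split=> //; apply: sync_silent.
Qed.

Lemma sync_reachable_trans (p q : state AB) u :
  reachable p -> weak p (events u) q -> reachable q.
Proof.
case=> s [i [ini ip]] pq; exists (s ++ u), i; split=> //.
by rewrite events_cat; apply/weak_cat; exists p.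
Qed.

End SyncRuns.

(** * The subset construction and weak transitions *)

Section Deltas.
Variables (E : choiceType) (S : {fset E}) (A : fin_automaton S).
Implicit Types (X Y : {set fstate A}) (s : seq (event E)).

Lemma deltas_cat (X : det (fstate A)) s t : deltas X (s ++ t) = deltas (deltas X s) t.
Proof. exact: foldl_cat. Qed.

Lemma in_delta X e Y x y : delta (Some X) (Ev e) = Some Y ->
  x \in X -> weak (A := A) x [:: Ev e] y -> y \in Y.
Proof. by case=> <- xX xy; rewrite inE; apply/asboolP; exists x. Qed.

Lemma deltas_events X t : exists Y, deltas (Some X) (events t) = Some Y.
Proof. by elim: t X => [|e t IH] X /=; [exists X|apply: IH]. Qed.

Lemma deltas_eventsP X t Y y : deltas (Some X) (events t) = Some Y -> y \in Y ->
  exists2 x, x \in X & weak (A := A) x (events t) y.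
Proof.
elim: t X => [|e t IH] X /=.
  by case=> -> yY; exists y => //; apply: weak_refl.
move=> /IH h /h [z]; rewrite inE => /asboolP [x [xX xz]] zy.
by exists x => //; apply/(weak_cat _ [:: Ev e]); exists z.
Qed.

(** For the empty trace [deltas] returns [X] itself, which need not be closed under silent steps;
    from the first event on, the image contains all silent successors. *)
Lemma in_deltas X t Y x y : deltas (Some X) (events t) = Some Y -> x \in X ->
  weak (A := A) x (events t) y -> t <> [::] -> y \in Y.
Proof.
elim: t X x => [|e t IH] X x //= dY xX /(weak_cat _ [:: Ev e]) [z xz zy] _.
have [t0|tn] := pselect (t = [::]).
  move: zy dY; rewrite t0 => zy [<-]; rewrite inE; apply/asboolP.
  by exists x; split=> //; apply/(weak_cat _ [:: Ev e]); exists z.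
apply: (IH _ z dY) => //; rewrite inE; apply/asboolP; by exists x.
Qed.

Lemma delta_TermP X : delta (Some X) Term = None <->
  exists x y : state A, x \in X /\ weak x [:: Term] y.
Proof. by rewrite /=; case: asboolP. Qed.

Lemma delta_Term_cases (X : det (fstate A)) :
  delta X Term = None \/ delta X Term = Some set0.
Proof. by case: X => [X|] /=; [case: asboolP; [left|right]|right]. Qed.

Lemma deltas_term (X : det (fstate A)) t : deltas X (events_term t) = delta (deltas X (events t)) Term.
Proof. by rewrite /events_term /deltas -cats1 foldl_cat. Qed.

Lemma deltas_termP X t : deltas (Some X) (events_term t) = None ->
  exists2 x, x \in X & marks (A := A) x t.
Proof.
have [Y dY] := deltas_events X t.
rewrite deltas_term dY => /delta_TermP [y [z [yY yz]]].
have [x xX xy] := deltas_eventsP dY yY.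
by exists x => //; exists z; rewrite /events_term -cats1; apply/weak_cat; exists y.
Qed.

Lemma marks_deltas X t x : x \in X -> marks (A := A) x t ->
  deltas (Some X) (events_term t) = None.
Proof.
elim: t X x => [|e t IH] X x xX; first by case=> y xy; apply/delta_TermP; exists x, y.
case/marks_cons => z xz; apply: IH; rewrite inE; apply/asboolP; by exists x.
Qed.

Lemma deltas_empty (v : seq (event E)) : deltas (Some set0) v = Some set0 :> det (fstate A).
Proof.
elim: v => //= v s IH; rewrite -{2}IH; congr (deltas _ s).
case: v => [e|] /=; last by case: asboolP => // -[x [y []]]; rewrite inE.
by congr Some; apply/setP => y; rewrite !inE; apply/asboolP => -[x []]; rewrite inE.
Qed.

(** B may move silently while the test stands still; closure keeps the state of B inside the tracked
    set. *)
Definition tau_closed X :=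
  forall x y, x \in X -> weak (A := A) x [::] y -> y \in X.

Lemma start_set_closed : tau_closed (start_set A).
Proof.
move=> x y; rewrite !inE => /asboolP [i [ini ix]] xy; apply/asboolP.
by exists i; split=> //; apply/(weak_cat _ [::]); exists x.
Qed.

Lemma delta_closed X e Y : delta (Some X) (Ev e) = Some Y -> tau_closed Y.
Proof.
case=> <- x y; rewrite !inE => /asboolP [i [iX ix]] xy; apply/asboolP.
by exists i; split=> //; apply/(weak_cat _ [:: Ev e]); exists x.
Qed.

(** The empty trace is no exception here, unlike in [in_deltas], because [start_set] is already
    closed under silent steps. *)
Lemma deltas_start t Y y : deltas (Some (start_set A)) (events t) = Some Y ->
  y \in Y <-> weak_init (A := A) (events t) y.
Proof.
move=> dY; split=> [yY|[i [ini iy]]].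
  have [x] := deltas_eventsP dY yY; rewrite inE => /asboolP [i [ini ix]] xy.
  by exists i; split=> //; apply/(weak_cat _ [::]); exists x.
have [t0|tn] := pselect (t = [::]).
  by move: dY iy; rewrite t0 => -[<-] iy; rewrite inE; apply/asboolP; exists i.
apply: (in_deltas dY) iy tn; rewrite inE; apply/asboolP; exists i.
by split=> //; apply: weak_refl.
Qed.

End Deltas.

(** * Less conflicting pairs and tests that do not conflict with B *)

Section LessConflicting.
Variables (E : choiceType) (S : {fset E}) (A B : fin_automaton S).
Implicit Types (p : det_pair A B).

Lemma LCupto_mono n m p : n <= m -> LCupto n p -> LCupto m p.
Proof.
move=> nm; rewrite -(subnK nm); elim: (m - n) => //= k IH h.
by left; apply: IH.
Qed.

Lemma LC_LCupto p : LC p <-> exists n, LCupto n p.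
Proof.
split=> [[n h]|[n /LCuptoP [i _ h]]]; last by exists i.
by exists n; apply/LCuptoP; exists n.
Qed.

(** There are finitely many pairs: choose a level for each and take the maximum. *)
Lemma LC_bounded : exists N, forall p, LC p -> LCupto N p.
Proof.
have /choice [f hf] : forall p, exists n, LC p -> LCupto n p.
  move=> p; have [/LC_LCupto [n h]|h] := pselect (LC p); first by exists n.
  by exists 0.
exists (\max_p f p) => p /hf; apply: LCupto_mono; exact: leq_bigmax.
Qed.

(** If every marked trace of [x] had a prefix leading into LC, the common level [N] of [LC_bounded]
    would put [p] itself into level [N.+1]. *)
Lemma not_LC p X x : ~ LC p -> p.2 = Some X -> x \in X ->
  exists2 t, marks (A := B) x t &
    forall r u, r ++ u = events_term t -> ~ LC (delta2 p r).
Proof.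
move=> nLC pX xX; have [N LCN] := LC_bounded.
apply: contrapT => no; apply: nLC; apply/LC_LCupto; exists N.+1; right.
exists X, x; split=> // t mt; apply: contrapT => no2; apply: no.
exists t => // r u ru h; apply: no2; exists r, u; split=> //; exact: LCN.
Qed.

(** Excludes pairs whose second component is omega or empty, unless the first one is omega. *)
Lemma LCupto_snd n p : LCupto n p ->
  p.1 = None \/ exists X x, p.2 = Some X /\ x \in X.
Proof.
elim: n => [|n IH] /=.
  by case=> [->|[X [x [-> xX _]]]]; [left|right; exists X, x].
by case=> // -[X [x [-> xX _]]]; right; exists X, x.
Qed.

Section Tests.
Variables (S' : {fset E}) (T : automaton S').
Hypothesis BT : nonblocking (sync B T).

(* The states of B and the test reach their successors along a common word [u1]
   over both alphabets, of which [r] is the projection to the alphabet of B. *)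
Lemma LC_marks n XA XB (y : state T) : LCupto n (Some XA, Some XB) ->
  (forall x, x \in XB -> reachable (A := sync B T) (x, y)) ->
  exists a u, a \in XA /\ marks (A := sync A T) (a, y) u.
Proof.
elim: n XA XB y => [|n IH] XA XB y /=.
  (* At level 0 the set contains a blocked state of B, but the projection of a marked trace of the
     composition would be marked from that state. *)
  case=> // -[X [x [[<-] xX bl]]] /(_ _ xX) /BT [u [[x' y'] /sync_weakE [wx _]]].
  by case: bl; exists (filter [in S] u), x'; rewrite -proj_events_term.
case=> [h reach|[X [x [[<-] xX LCx]]] reach].
  exact: IH h reach.
have [u [[x' y'] wu]] := BT (reach _ xX).
have [wx wy] := sync_weakE wu.
have uS := weak_alphabet wu.
rewrite proj_events_term in wx.
have [r [w [rw LCr]]] := LCx _ (ex_intro _ x' wx).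
case: (events_term_split rw) => [re|[t1 [t2 [ut re]]]].
  (* If the prefix is the whole marked trace, the B side is omega, so the pair can only be less
     conflicting through omega on the A side. Hence some [a] in [XA] accepts the projection of the
     same word [u]. *)
  have dB : deltas (Some XB) r = None.
    by rewrite re; apply: marks_deltas xX _; exists x'.
  case: (LCupto_snd LCr); last by rewrite /= dB => -[? [? []]].
  rewrite re => /deltas_termP [a aX [a' aa]]; exists a, u; split=> //.
  by exists (a', y'); apply: sync_weakI => //; rewrite proj_events_term.
(* For a proper prefix, [u] is cut where its projection has just completed [t1]. The test is then in
   [y1], every state of [YB] is reachable next to it, and the induction hypothesis applies. *)
have [u1 [u2 [uu u1t u2t]]] := filter_split ut.
move: wu uS wy; rewrite uu /events_term events_cat rcons_cat => wu uS wy.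
move: uS wy; rewrite all_cat /proj filter_cat => /andP [u1S u2S] /weak_cat [y1 yy1 _].
have [YA dA] := deltas_events XA t1; have [YB dB] := deltas_events XB t1.
move: LCr; rewrite /delta2 re /= dA dB => LCr.
have [|a1 [v [a1Y [z a1z]]]] := IH _ _ y1 LCr.
  move=> x1 x1Y; have [x0 x0X x01] := deltas_eventsP dB x1Y.
  apply: sync_reachable_trans (reach _ x0X) _.
  by apply: (sync_weakI u1S) yy1; rewrite proj_events u1t.
have [a aX aa1] := deltas_eventsP dA a1Y.
exists a, (u1 ++ v); split=> //; apply/marks_cat; exists (a1, y1); last by exists z.
by apply: (sync_weakI _ _ yy1) => //; rewrite proj_events u1t.
Qed.

(** Otherwise [LC_marks] would provide a state in the empty set. The word [u] ranges over both
    alphabets, since the test may have events of its own. *)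
Lemma LC_conflict u s (y : state T) r w :
  filter [in S] u = s -> {subset u <= (S `|` S')%fset} ->
  weak_init (A := T) (events (filter [in S'] u)) y ->
  r ++ w = s -> ~ LC ((Some set0, deltas (Some (start_set B)) (events r)) : det_pair A B).
Proof.
move=> us uS [y0 [iniy yy]] rs; have [YB dB] := deltas_events (start_set B) r.
rewrite dB => /LC_LCupto [n LCn].
have [u1 [u2 [uu u1t u2t]]] := filter_split (etrans us (esym rs)).
move: yy; rewrite uu filter_cat events_cat => /weak_cat [y1 yy1 _].
have [|a [v []]] := LC_marks (y := y1) LCn; last by rewrite inE.
move=> x /(deltas_start _ dB) [x0 [ini0 x0x]]; exists u1, (x0, y0); split=> //.
apply: sync_weakI; rewrite ?proj_events ?u1t //.
rewrite all_events; apply/allP => e eu; apply: uS; rewrite uu mem_cat.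
by move: eu => /= ->.
Qed.

End Tests.
End LessConflicting.

(** * The permissive test *)

Section PermissiveTest.
Variables (E : choiceType) (S : {fset E}) (A B : fin_automaton S).
Variable jump : {set fstate A} -> {set fstate B} -> Prop.
Hypothesis jumpP : forall XA XB, jump XA XB -> ~ LC ((Some XA, Some XB) : det_pair A B).

(* The test tracks a pair that is not less conflicting and refuses every event
   that leads to a less conflicting pair; [None] is reached by termination.
   Pairs (empty set, X) only avoid the certain conflicts of B; from these, a
   silent [jump] may start to track some set of states of A as well. *)
Definition test_state := option ({set fstate A} * {set fstate B}).

Definition test_pair (q : {set fstate A} * {set fstate B}) : det_pair A B :=
  (Some q.1, Some q.2).

Definition test_trans (p : test_state) (l : option (event E)) (q : test_state) : Prop :=
  match p, l, q with
  | Some p, Some (Ev e), Some q =>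
      [/\ e \in S, delta2 (test_pair p) [:: Ev e] = test_pair q
        & ~ LC (test_pair q)]
  | Some p, Some Term, None => delta (Some p.1) Term <> None
  | Some p, None, Some q => [/\ p.1 = set0, p.2 = q.2 & jump q.1 q.2]
  | _, _, _ => False
  end.

Definition test_init (p : test_state) : Prop :=
  p = Some (set0, start_set B) /\ ~ LC (test_pair (set0, start_set B)).

Lemma test_alphabet p e q : test_trans p (Some (Ev e)) q -> e \in S.
Proof. by case: p q => [p|] [q|] //= []. Qed.

Lemma test_term p q l r : test_trans p (Some Term) q -> ~ test_trans q l r.
Proof. by case: p q => [p|] [q|] //= _ []. Qed.

Definition test : automaton S :=
  @Automaton E S test_state test_trans test_init test_alphabet test_term.

Lemma test_run p s : all (ev_in S) (events s) ->
  (forall r u, r ++ u = events s -> ~ LC (delta2 (test_pair p) r)) ->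
  exists2 q, delta2 (test_pair p) (events s) = test_pair q &
    weak (A := test) (Some p) (events s) (Some q).
Proof.
elim: s p => [|e s IH] p /=; first by move=> _ _; exists p => //; apply: weak_refl.
move=> /andP [eS sS] nLC.
have [XA dA] := deltas_events p.1 [:: e]; have [XB dB] := deltas_events p.2 [:: e].
have dq : delta2 (test_pair p) [:: Ev e] = test_pair (XA, XB).
  by rewrite /delta2 /= in dA dB *; rewrite dA dB.
have cons r : delta2 (test_pair p) (Ev e :: r) = delta2 (test_pair (XA, XB)) r.
  by rewrite -dq.
have [//|r u ru|q dqs qs] := IH (XA, XB).
  by rewrite -cons; apply: (nLC _ u); rewrite /= ru.
exists q; first by rewrite cons.
apply/(weak_cat _ [:: Ev e]); exists (Some (XA, XB)) => //.
apply: (weak_trans (A := test) (l := Some (Ev e))); split=> //.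
by rewrite -dq; apply: (nLC [:: Ev e] (events s)).
Qed.

(** The trace of [not_LC] is enabled in the test, as no prefix of it leads into LC. Neither does the
    whole trace with omega, so the A side is not omega there and the test may terminate. *)
Lemma test_marks p x : ~ LC (test_pair p) -> x \in p.2 ->
  exists t, marks (A := sync B test) (x, Some p) t.
Proof.
move=> nLC xp; have [t mt nLCt] := not_LC nLC erefl xp.
have tS : all (ev_in S) (events t).
  by rewrite all_events; apply/allP; apply: marks_alphabet mt.
have [|q dq pq] := test_run tS (p := p).
  by move=> r u ru; apply: (nLCt r (rcons u Term)); rewrite -rcons_cat ru.
have nT : delta (Some q.1) Term <> None.
  move=> dN; apply: (nLCt (events_term t) [::]); rewrite ?cats0 //.
  apply/LC_LCupto; exists 0; left; rewrite /= deltas_term.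
  by move: dq => [-> _].
case: (mt) => y xy; exists t, (y, None).
have tS' : all (ev_in S) (events_term t) by rewrite /events_term all_rcons.
apply: sync_weakI; rewrite ?proj_id // ?fsetUid //.
rewrite /events_term -cats1; apply/weak_cat; exists (Some q) => //.
exact: (weak_trans (A := test) (l := Some Term)).
Qed.


(** The terminated test is excluded because reachability in the sense of nonblocking uses events
    only. *)
Definition test_inv (z : state (sync B test)) : Prop :=
  if z.2 is Some p then
    [/\ z.1 \in p.2, tau_closed p.2 & ~ LC (test_pair p)]
  else False.

Lemma test_inv_step z l z' : trans (a := sync B test) z l z' -> l <> Some Term ->
  test_inv z -> test_inv z'.
Proof.
case: z z' => [x [p|]] [x' q] //; case: l => [[e|]|] //= step _ [xp cl nLC].
  case: step => -[/andP [e1 e2]]; rewrite ?e1 // in e2 *.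
  rewrite /test_inv /=; case: q => [q|] [/= xx'] // [_ [dA dB] nLCq]; split=> //.
    by apply: (@in_delta _ _ B p.2 e q.2 x x' (congr1 Some dB) xp); exact: (@weak_trans _ _ B _ (Some _) _ xx').
  exact: (@delta_closed _ _ B p.2 e q.2 (congr1 Some dB)).
rewrite /test_inv /=; case: step => -[/= xx' pq].
  by rewrite -pq; split=> //; apply: cl xp _; exact: (@weak_trans _ _ B _ None _ xx').
by case: q pq => [q|] // [_ pq /jumpP nLCq]; rewrite -xx' -pq.
Qed.

Lemma test_reachable z : reachable (A := sync B test) z -> test_inv z.
Proof.
case=> s [z0 [[ini0 [z02 nLC0]] [t [run_t ts]]]].
have: test_inv z0.
  rewrite /test_inv z02; split=> //=; last exact: start_set_closed.
  by rewrite inE; apply/asboolP; exists z0.1; split=> //; apply: weak_refl.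
elim: t s z0 ts run_t {ini0 z02 nLC0} => [|l t IH] s z0 /=; first by move=> _ <-.
case: l => [v|] /= ts [z1 [z01 z1z]] inv0; last first.
  by apply: IH ts z1z _; apply: (@test_inv_step z0 None z1 z01 _ inv0).
case: s ts => [|e s] //= [ve ts].
by apply: IH ts z1z _; apply: (@test_inv_step z0 (Some v) z1 z01 _ inv0); rewrite ve.
Qed.

Lemma test_nonblocking : nonblocking (sync B test).
Proof.
move=> [x [p|]] /test_reachable // [xp _ nLC]; exact: test_marks.
Qed.

Lemma test_after s : {subset s <= S} ->
  (forall r u, r ++ u = s ->
     ~ LC ((Some set0, deltas (Some (start_set B)) (events r)) : det_pair A B)) ->
  exists2 X, deltas (Some (start_set B)) (events s) = Some X &
    weak_init (A := test) (events s) (Some (set0, X)).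
Proof.
move=> sS nLC; have [|r u ru|[XA X] [dA dB] w] := @test_run (set0, start_set B) s.
- by rewrite all_events; apply/allP.
(* A prefix of a mapped list is the image of a prefix. *)
- have [r' [u' [ss ->]]] : exists r' u', s = r' ++ u' /\ r = events r'.
    by have := @filter_split _ predT (events s) r u;
      exists (take (size r) s), (drop (size r) s); rewrite cat_take_drop;
      split=> //; rewrite /events map_take -/(events s) -ru take_size_cat.
  by rewrite /delta2 /= deltas_empty; apply: (nLC r' u').
exists X => //; exists (Some (set0, start_set B)); split.
  by split=> //; apply: (nLC [::] s).
by move: dA w; rewrite /= deltas_empty => -[<-].
Qed.

(** While the tracked set contains a state from which A silently reaches its present state,
    termination of A would make [delta p.1 Term] omega, and the test refuses exactly this. As [p.1]
    is inhabited, no further jump is possible. The detour through [a] is needed because the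
    singleton entered by a jump need not be closed under silent steps. *)
Lemma test_blocks (x : state A) p t z u :
  run (A := sync A test) (x, Some p) t z ->
  (exists2 a, a \in p.1 & weak (A := A) a [::] x) -> pmap id t <> events_term u.
Proof.
elim: t x p u => [|l t IH] x p u /=; first by case: u.
case=> -[x1 q] [step run_t] [a ap ax].
case: l step => [[e|]|] /= step.
- case: step => -[/andP [e1 e2]]; rewrite ?e1 // in e2 *.
  case: q run_t => [q|] run_t [/= xx1] // [_ [dA dB] nLCq].
  case: u => [|e' u] //= [_]; apply: IH run_t _; exists x1; last exact: weak_refl.
  apply: (@in_delta _ _ A p.1 e q.1 a x1 (congr1 Some dA) ap); apply/(weak_cat _ [::]); exists x => //.
  exact: (@weak_trans _ _ A _ (Some _) _ xx1).
- case: step => xx1; case: q run_t => // run_t []; apply/delta_TermP.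
  exists a, x1; split=> //; apply/(weak_cat _ [::]); exists x => //.
  exact: (@weak_trans _ _ A _ (Some _) _ xx1).
case: step => -[/= xx1 pq].
  subst q; apply: IH run_t _; exists a => //; apply/(weak_cat _ [::]).
  by exists x => //; exact: (@weak_trans _ _ A _ None _ xx1).
by case: q pq run_t => // q [p0]; move: ap; rewrite p0 inE.
Qed.

End PermissiveTest.

(** * Criteria for certain conflicts and for the preorder; one round as a search *)

Section Criteria.
Variables (E : choiceType) (S : {fset E}) (A B : fin_automaton S).

Lemma filter_subset (U : {fset E}) (s : seq E) : {subset s <= U} ->
  filter [in U] s = s.
Proof. by move=> sU; apply/all_filterP/allP. Qed.

(** If no prefix of [s] gives a less conflicting pair, the test without jumps follows [s] and does
    not conflict with B. With the empty set on the left it is always free to terminate. *)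
Theorem certain_conflictP s : {subset s <= S} -> certain_conflict B s <->
  exists r u, r ++ u = s /\
    LC ((Some set0, deltas (Some (start_set B)) (events r)) : det_pair A B).
Proof.
move=> sS; split=> [[_ conf]|[r [u [ru LCr]]]]; last first.
  split=> // S' T [y Ty] BT.
  have sS' : {subset s <= S'} by case: Ty => z [_ /weak_events_alphabet].
  apply: (LC_conflict BT (u := s) (s := s) (y := y) (r := r) (w := u)) => //.
  - exact: filter_subset.
  - by move=> e es; rewrite in_fsetU sS.
  - by rewrite filter_subset.
  - exact: LCr.
apply: contrapT => no.
have nLC : forall r u, r ++ u = s ->
    ~ LC ((Some set0, deltas (Some (start_set B)) (events r)) : det_pair A B).
  by move=> r u ru LCr; apply: no; exists r, u.
have nj : forall XA XB, False -> ~ LC ((Some XA, Some XB) : det_pair A B) by [].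
have [X _ w] := test_after (fun _ _ => False) sS nLC.
apply: conf (test_nonblocking nj); by exists (Some (set0, X)).
Qed.

Theorem less_conflictingP :
  less_conflicting A B <-> forall p : det_pair A B, start_pair p -> LC p.
Proof.
split=> [lcAB p [s [x [sS nconf Asx ->]]]|LCp S' T BT [x y] [u [[x0 y0] [[inix iniy]]]]].
  apply: contrapT => nLCp.
  have nLC : forall r u, r ++ u = s ->
      ~ LC ((Some set0, deltas (Some (start_set B)) (events r)) : det_pair A B).
    by move=> r u ru LCr; apply: nconf; apply/(certain_conflictP sS); exists r, u.
  (* A cannot be tracked along all of [s], since pairs met on the way may be less conflicting. The
     test first follows [s] with the empty set, where only certain conflicts matter, and then jumps
     to the singleton of [x]. *)
  pose jump (XA : {set fstate A}) XB :=
    XA = [set x] /\ deltas (Some (start_set B)) (events s) = Some XB.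
  have jumpP XA XB : jump XA XB -> ~ LC ((Some XA, Some XB) : det_pair A B).
    by case=> -> dB; rewrite -dB.
  have [X dX w] := test_after jump sS nLC.
  have := lcAB _ _ (test_nonblocking jumpP).
  move=> /(_ (x, Some ([set x], X))) [].
    case: Asx w => x0 [ini0 x0x] [y0 [iniy0 y0y]].
    exists s, (x0, y0); split=> //; apply: sync_weakI.
    - by rewrite all_events fsetUid; apply/allP.
    - by rewrite proj_events filter_subset.
    rewrite proj_events filter_subset // -[events s]cats0.
    apply/weak_cat; exists (Some (set0, X)) => //.
    exact: (weak_trans (A := test jump) (l := None)).
  move=> u [z [t [xz tu]]]; apply: (test_blocks xz _ tu).
  by exists x; [rewrite inE|apply: weak_refl].
move=> xy; have [wx wy] := sync_weakE xy.
have uS : {subset u <= (S `|` S')%fset}.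
  by apply/allP; rewrite -all_events; apply: weak_alphabet xy.
(* Private events of the test are erased: the pair in question is the one that A and B reach by this
   projection. *)
pose s := filter [in S] u.
have sS : {subset s <= S} by move=> e; rewrite mem_filter => /andP [].
have [XB dB] := deltas_events (start_set B) s.
have [] : LC ((Some [set x], Some XB) : det_pair A B).
  apply: LCp; exists s, x; split=> //; last by rewrite dB.
    case/(certain_conflictP sS) => r [w [rw]].
    apply: (LC_conflict BT (u := u) (y := y) _ uS _ rw) => //; exists y0; split=> //.
    by rewrite -proj_events.
  by exists x0; split=> //; rewrite /s -proj_events.
move=> n LCn; have [||a [v [/set1P -> mv]]] := @LC_marks _ _ _ _ _ _ BT n [set x] XB y.
- by apply/LCuptoP; exists n.
- move=> x' /(deltas_start _ dB) [z [iniz zx']]; exists u, (z, y0); split=> //.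
  by apply: sync_weakI => //; rewrite ?proj_events // all_events; apply/allP.
by exists v.
Qed.

(** The default value makes [nE] the number of omega, as in the program. *)
Definition lab (k : nat) : event E := nth Term [seq Ev e | e <- enum_fset S] k.
Local Notation nE := (size (enum_fset S)).

Lemma lab_term : lab nE = Term.
Proof. by rewrite /lab nth_default ?size_map. Qed.

Lemma lab_event k : k < nE -> exists2 e, lab k = Ev e & e \in S.
Proof.
move=> kn; have [e _] : {e : E | true} by case: (enum_fset S) kn => // e; exists e.
exists (nth e (enum_fset S) k); first by rewrite /lab (nth_map e).
exact: mem_nth.
Qed.

Lemma lab_onto v : ev_in S v -> exists2 k, k <= nE & lab k = v.
Proof.
case: v => [e eS|_]; last by exists nE => //; exact: lab_term.
exists (index e (enum_fset S)); first exact: index_size.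
by rewrite /lab (nth_map e) ?index_mem // nth_index.
Qed.

Lemma lab_in k : ev_in S (lab k).
Proof.
have [/lab_event [e ->]//|kn] := ltnP k nE.
by rewrite /lab nth_default ?size_map.
Qed.

Implicit Types (p q : det_pair A B).

(* The union of MC^n_m over m, with LC^n replaced by an arbitrary set [lc]. *)
Inductive more (lc : det_pair A B -> Prop) : det_pair A B -> fstate B -> Prop :=
  | MoreEnd x : more lc (Some set0, None) x
  | MoreStep p X x v y : ~ lc p -> p.2 = Some X -> x \in X ->
      more lc (delta2 p [:: v]) y -> weak (A := B) x [:: v] y -> more lc p x.

Lemma more_end lc p y : more lc p y -> p.2 = None -> p.1 = Some set0.
Proof. by case=> // q X ? ? ? _ ->. Qed.

(** A pair of lower level satisfies the step at every later level with the empty prefix as witness;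
    only a state of B to start from has to exist. *)
Lemma LCn_LCupto n p X x : p.2 = Some X -> x \in X -> LCupto n p -> LCn n p.
Proof.
case: n => [//|n] pX xX /=; case=> // h; exists X, x; split=> // t _.
by exists [::], (events_term t); rewrite /delta2 -surjective_pairing.
Qed.

Lemma MCn_more n p x : MCn n p x <-> more (LCupto n) p x.
Proof.
split=> [[m]|].
  elim: m p x => [|m IH] p x /=; first by move=> ->; apply: MoreEnd.
  case=> nLC [X pX xX] [v [y [/IH my xy]]]; apply: (MoreStep _ pX xX my xy).
  by move=> h; apply: nLC; apply: LCn_LCupto pX xX h.
elim=> {p x} [x|p X x v y nLC pX xX _ [m my] xy]; first by exists 0.
exists m.+1; split; [|by exists X|by exists v, y].
by move=> h; apply: nLC; apply/LCuptoP; exists n.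
Qed.

(** A path of triples from [x] spells a marked trace that avoids the level, and conversely. The
    final triples are right because after omega on the B side the A side is omega, which has level
    0, or empty. *)
Lemma moreP n p X x : p.2 = Some X -> x \in X ->
  more (LCupto n) p x <->
  exists2 t, marks (A := B) x t &
    forall r u, r ++ u = events_term t -> ~ LCupto n (delta2 p r).
Proof.
move=> pX xX; split=> [mo|[t]].
  elim: mo X pX xX => {p x} [x|p X x v y nLC pX xX mo IH xy] X' pX' xX' //.
  case: v mo IH xy => [e|] mo IH xy.
    have [t yt nLCt] : exists2 t, marks (A := B) y t &
        forall r u, r ++ u = events_term t -> ~ LCupto n (delta2 (delta2 p [:: Ev e]) r).
      apply: IH; first by rewrite /delta2 /= pX.
      by rewrite inE; apply/asboolP; exists x.
    exists (e :: t); first by apply/marks_cons; exists y.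
    case=> [|v r] u /=; first by move=> _; rewrite /delta2 -surjective_pairing.
    by case=> -> ru; apply: nLCt ru.
  have mx : marks (A := B) x [::] by exists y.
  exists [::] => // r u ru.
  case: (events_term_split ru) => [->|[t1 [t2 [/esym tt ->]]]]; last first.
    by case: t1 tt => // _; rewrite /delta2 /= -surjective_pairing.
  (* After omega the second component has no elements, so the triple there must be a final one. Its
     pair, the empty set with omega, has no level by [LCupto_snd]. *)
  have dB : deltas p.2 [:: Term] = None.
    by rewrite pX; exact: (marks_deltas xX mx).
  have := more_end mo dB; rewrite /= in dB * => dA h.
  by move: (LCupto_snd h); rewrite /= dA dB => -[//|[? [? []]]].

elim: t p X x pX xX => [|e t IH] p X x pX xX /=.
  case=> y xy nLC.
  have nLCp : ~ LCupto n p.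
    by have := nLC [::] _ erefl; rewrite /delta2 -surjective_pairing.
  apply: (MoreStep nLCp pX xX _ xy).
  have -> : delta2 p [:: Term] = (Some set0, None); last exact: MoreEnd.
  have dB : deltas p.2 [:: Term] = None.
    by rewrite pX; apply: (marks_deltas (t := [::]) xX); exists y.
  rewrite /delta2 dB; congr (_, _).
  (* Omega on the A side would be of level 0, against the assumption on the full trace. *)
  have [dA|//] := delta_Term_cases p.1.
  case: (nLC [:: Term] [::] erefl); apply: (LCupto_mono (n := 0)) => //.
  by left.
case/marks_cons => z xz mz nLC.
have nLCp : ~ LCupto n p.
  by have := nLC [::] _ erefl; rewrite /delta2 -surjective_pairing.
apply: (MoreStep nLCp pX xX _ xz).
apply: (IH _ (odflt set0 (delta p.2 (Ev e)))) mz _.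
- by rewrite /delta2 /= pX.
- by rewrite pX /= inE; apply/asboolP; exists x.
by move=> r u ru; apply: (nLC (Ev e :: r) u); rewrite /= ru.
Qed.

Lemma LCstep_more n p : LCstep (LCupto n) p <->
  exists X x, [/\ p.2 = Some X, x \in X & ~ more (LCupto n) p x].
Proof.
split=> -[X [x [pX xX h]]]; exists X, x; split=> //.
  move=> /(moreP n pX xX) [t mt nLC].
  by have [r [u [ru /(nLC _ _ ru)]]] := h _ mt.
move=> t mt; apply: contrapT => no; apply: h; apply/(moreP n pX xX).
by exists t => // r u ru LCr; apply: no; exists r, u.
Qed.

Definition closed_pairs (L : pred (det_pair A B)) :=
  forall p v, L p -> ev_in S v -> L (delta2 p [:: v]).

Lemma closed_pairsP (L : pred (det_pair A B)) p s :
  closed_pairs L -> L p -> all (ev_in S) s -> L (delta2 p s).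
Proof.
move=> clL; elim: s p => [|v s IH] p Lp //=; first by case: p Lp.
by move=> /andP [vS sS]; apply: (IH _ (clL _ _ Lp vS) sS).
Qed.

(** Whether a pair of [L] enters the next level depends only on pairs reachable from it, which are
    again in [L]; so one idle round repeats forever. *)
Lemma LC_stable (L : pred (det_pair A B)) n : closed_pairs L ->
  (forall p, L p -> LCupto n.+1 p -> LCupto n p) ->
  forall m p, L p -> LCupto m p -> LCupto n p.
Proof.
move=> clL stop; have [//|m] := pselect (forall m p, L p -> LCupto m p -> LCupto n p).
case: m; elim=> [|m IH] p Lp; first exact: LCupto_mono.
case=> [/(IH _ Lp)//|[X [x [pX xX h]]]]; apply: stop => //; right.
exists X, x; split=> // t mt; have [r [u [ru LCr]]] := h t mt.
exists r, u; split=> //; apply: IH LCr; apply: closed_pairsP => //.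
have : all (ev_in S) (events_term t).
  by case: mt => y; apply: weak_alphabet.
by rewrite -ru all_cat => /andP [].
Qed.

End Criteria.

(** * Timed Hoare logic *)

Definition smem (a : string) (l : seq string) : bool := has (String.eqb a) l.

Fixpoint mods (c : cmd) : seq string :=
  match c with
  | Skip => [::]
  | Assign a _ _ => [:: a]
  | Seq c1 c2 | If _ c1 c2 => mods c1 ++ mods c2
  | While _ c => mods c
  end.

Fixpoint avoids (e : expr) (l : seq string) : bool :=
  match e with
  | Cst _ => true
  | Rd a es => ~~ smem a l && all (avoids^~ l) es
  | Bin _ e1 e2 => avoids e1 l && avoids e2 l
  end.

Definition agree (l : seq string) (m m' : memory) :=
  forall a, smem a l = false -> m' a = m a.

Lemma agree_trans l m1 m2 m3 : agree l m1 m2 -> agree l m2 m3 -> agree l m1 m3.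
Proof. by move=> h1 h2 a al; rewrite h2 // h1. Qed.

Lemma smem_cat a l1 l2 : smem a (l1 ++ l2) = smem a l1 || smem a l2.
Proof. exact: has_cat. Qed.

Lemma agree_sub l l' m m' :
  (forall a, smem a l -> smem a l') -> agree l m m' -> agree l' m m'.
Proof.
move=> sub h a al; apply: h; apply/negbTE/negP => /sub al'.
by rewrite al' in al.
Qed.

Lemma write_same m a i v j : write m a i v a j = if i == j then v else m a j.
Proof. by rewrite /write String.eqb_refl. Qed.

Lemma write_otherf m a i v b : String.eqb a b = false -> write m a i v b = m b.
Proof. by move=> ab; apply/funext => j; rewrite /write ab. Qed.

Lemma exec_agree c m m' t : exec c m m' t -> agree (mods c) m m'.
Proof.
elim=> {c m m' t} //=.
- move=> a es e m b; rewrite /smem /= orbF => ba; apply: write_otherf.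
  by apply/negbTE/negP => /String.eqb_eq ab; rewrite ab String.eqb_refl in ba.
- move=> c1 c2 m1 m2 m3 t1 t2 _ IH1 _ IH2 a; rewrite smem_cat => /norP [a1 a2].
  by rewrite IH2 ?IH1 //; apply/negbTE.
- by move=> e c1 c2 m m' t _ _ IH a; rewrite smem_cat => /norP [/negbTE /IH].
- by move=> e c1 c2 m m' t _ _ IH a; rewrite smem_cat => /norP [_ /negbTE /IH].
- by move=> e c m1 m2 m3 t1 t2 _ _ IH1 _ IH2; apply: agree_trans IH1 IH2.
Qed.

Fixpoint eval_agree l m m' (e : expr) : agree l m m' -> avoids e l -> eval m' e = eval m e.
Proof.
move=> h; case: e => [n|a es|o e1 e2] //=.
  case/andP => /negbTE /h ->; move=> als; congr (m a _).
  elim: es als => //= e es IH /andP [ae /IH ->]; congr (_ :: _).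
  exact: eval_agree h ae.
by case/andP => /(eval_agree _ _ _ _ h) -> /(eval_agree _ _ _ _ h) ->.
Qed.

(** Total correctness from one given memory. By determinism of [exec] the run that is claimed to
    exist is the only one, so [T] bounds the true running time. *)
Definition triple (m : memory) (c : cmd) (T : nat) (Q : memory -> Prop) : Prop :=
  exists m' t, [/\ exec c m m' t, t <= T & Q m'].

Lemma triple_frame m c T Q : triple m c T Q ->
  triple m c T (fun m' => Q m' /\ agree (mods c) m m').
Proof.
case=> m' [t [ex tT Qm]]; exists m', t; split=> //; split=> //.
exact: exec_agree ex.
Qed.

Lemma triple_weaken m c T T' Q Q' : triple m c T Q -> T <= T' ->
  (forall m', Q m' -> Q' m') -> triple m c T' Q'.
Proof.
case=> m' [t [ex tT Qm]] TT' QQ'; exists m', t; split; rewrite ?(leq_trans tT) //.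
exact: QQ'.
Qed.

(** The usual rule of consequence, combined with the frame: arrays that [c] never assigns keep their
    contents, so no postcondition has to mention them. *)
Lemma triple_post m c T Q Q' : triple m c T Q ->
  (forall m', Q m' -> agree (mods c) m m' -> Q' m') -> triple m c T Q'.
Proof. by move=> /triple_frame h QQ'; apply: triple_weaken h _ _ => // m' [/QQ']; apply. Qed.

Lemma triple_seq m c1 c2 T1 T2 Q :
  triple m c1 T1 (fun m1 => triple m1 c2 T2 Q) -> triple m (Seq c1 c2) (T1 + T2) Q.
Proof.
case=> m1 [t1 [ex1 le1 [m2 [t2 [ex2 le2 Qm]]]]].
by exists m2, (t1 + t2); split=> //; [apply: ExecSeq ex1 ex2|apply: leq_add].
Qed.

Lemma triple_assign m a es e T (Q : memory -> Prop) :
  Q (write m a (map (eval m) es) (eval m e)) -> sumn (map cost es) + cost e < T ->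
  triple m (Assign a es e) T Q.
Proof. by move=> Qm le; do 2!eexists; split; [apply: ExecAssign|exact: le|]. Qed.

Lemma triple_when m e c T Q :
  (eval m e != 0 -> triple m c T Q) -> (eval m e = 0 -> Q m) ->
  triple m (When e c) (T + (cost e).+2) Q.
Proof.
move=> h1 h2; have [e0|ne] := eqVneq (eval m e) 0.
  have Qm := h2 e0; exists m, (cost e + 1).+1; split=> //; last by lia.
  by apply: ExecIfF => //; apply: ExecSkip.
have [m' [t [ex tT Qm]]] := h1 ne; exists m', (cost e + t).+1; split=> //; last by lia.
exact: ExecIfT.
Qed.

(* [I f m]: the memory [m] satisfies the loop invariant and the remaining
   iterations fit into [f] steps. *)
Lemma triple_while m e c (I : nat -> memory -> Prop) f Q :
  I f m ->
  (forall f1 m1, eval m1 e != 0 -> I f1 m1 -> exists2 T, triple m1 c T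
     (fun m2 => exists2 f2, I f2 m2 & cost e + T + f2 < f1) & True) ->
  (forall f1 m1, eval m1 e = 0 -> I f1 m1 -> Q m1) ->
  triple m (While e c) (f + (cost e).+1) Q.
Proof.
move=> If body done; elim/ltn_ind: f m If => f IH m If.
have [e0|ne] := eqVneq (eval m e) 0.
  exists m, (cost e).+1; split; [exact: ExecWhileF|lia|exact: done If].
have [T [m1 [t1 [ex1 le1 [f2 If2 lt]]]] _] := body _ _ ne If.
have [|m2 [t2 [ex2 le2 Qm]]] := IH f2 _ m1 If2; first by lia.
exists m2, (cost e + t1 + t2).+1; split=> //; last by lia.
exact: ExecWhileT ex1 ex2.
Qed.

Lemma triple_for (I : nat -> memory -> Prop) i e N T c m Q :
  avoids e (i :: mods c) -> smem i (mods c) = false -> eval m e = N ->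
  I 0 (write m i [::] 0) ->
  (forall k m1, k < N -> agree (i :: mods c) m m1 -> m1 i [::] = k -> I k m1 ->
     triple m1 c T (fun m2 => I k.+1 (write m2 i [::] k.+1))) ->
  (forall m1, agree (i :: mods c) m m1 -> I N m1 -> Q m1) ->
  triple m (For i e c) (N.+1 * (T + (cost e + 10))) Q.
Proof.
move=> av ni eN I0 body post.
have fresh b : smem b (i :: mods c) = false -> String.eqb i b = false.
  move=> /= /norP [bi _]; apply/negbTE/negP => /String.eqb_eq ib.
  by rewrite ib String.eqb_refl in bi.
have step m1 v : agree (i :: mods c) m m1 -> agree (i :: mods c) m (write m1 i [::] v).
  by move=> h a al; rewrite write_otherf ?h //; apply: fresh.
have evE m1 : agree (i :: mods c) m m1 -> eval m1 e = N.
  by move=> ag; rewrite (eval_agree ag av).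
(* The initial assignment takes 2 steps. A pass takes [cost e + 2] for the guard, [T] for the body,
   4 for the increment and 1 for the loop itself; the last evaluation of the guard takes
   [cost e + 3]. *)
apply: (@triple_weaken _ _ (2 + (N * (T + (cost e + 7)) + (cost e).+3))) _ _ (fun _ h => h);
  last by nia.
apply: triple_seq; apply: triple_assign => //=.
apply: (@triple_while _ _ _ (fun f m1 => exists k, [/\ k <= N, m1 i [::] = k,
  agree (i :: mods c) m m1, I k m1 & f = (N - k) * (T + (cost e + 7))])).
- exists 0; rewrite subn0 write_same; split=> //.
  by apply: step.
- move=> f1 m1 /= lt [k [kN ik ag Ik ->]]; rewrite ik evE // in lt.
  have {}kN : k < N by case: ltnP lt.
  exists (T + 4) => //; apply: triple_seq.
  apply: triple_post (body _ _ kN ag ik Ik) _ => m2 Ik1 ag2; apply: triple_assign => //=.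
  have i2 : m2 i [::] = k by rewrite ag2.
  rewrite i2 addn1 in Ik1 *.
  exists ((N - k.+1) * (T + (cost e + 7))); last first.
    by rewrite -(subnSK kN) mulSn; lia.
  exists k.+1; split=> //; first by rewrite write_same.
  apply: step; apply: agree_trans ag (agree_sub _ ag2) => a /=.
  by rewrite /smem /= => ->; rewrite orbT.
move=> f1 m1 /= lt [k [kN ik ag Ik _]]; rewrite ik evE // in lt.
apply: post => //; suff -> : N = k by [].
by case: ltnP lt => // kN' _; apply/eqP; rewrite eqn_leq kN'.
Qed.

(** * Loops that only add entries to one table *)

Definition grows (f g : seq nat -> nat) := forall j, f j != 0 -> g j != 0.
Definition within (Z : seq nat -> Prop) (f : seq nat -> nat) :=
  forall j, f j != 0 -> Z j.
Definition upward (G : (seq nat -> nat) -> Prop) :=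
  forall f g, grows f g -> G f -> G g.

Lemma bool_neq0 (b : bool) : ((b : nat) != 0) = b.
Proof. by case: b. Qed.

(** Soundness ([Z]: every entry is justified) and completeness ([G k]: what pass [k] must enter) are
    kept apart. As [G k] survives further entries, the order of in-place updates is immaterial, and
    the postcondition has the shape required of a body, so loops nest. *)
Lemma triple_for_grow arr Z (G : nat -> (seq nat -> nat) -> Prop) i e N T c m :
  avoids e (i :: mods c) -> smem i (mods c) = false -> String.eqb i arr = false ->
  eval m e = N -> within Z (m arr) -> (forall k, upward (G k)) ->
  (forall k m1, k < N -> agree (i :: mods c) m m1 -> m1 i [::] = k ->
     grows (m arr) (m1 arr) -> within Z (m1 arr) ->
     triple m1 c T (fun m2 => [/\ within Z (m2 arr), grows (m1 arr) (m2 arr)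
                               & G k (m2 arr)])) ->
  triple m (For i e c) (N.+1 * (T + (cost e + 10)))
    (fun m2 => [/\ within Z (m2 arr), grows (m arr) (m2 arr)
                 & forall k, k < N -> G k (m2 arr)]).
Proof.
move=> av ni ia eN Zm up body.
apply: (triple_for (I := fun k m2 => [/\ within Z (m2 arr), grows (m arr) (m2 arr)
                 & forall l, l < k -> G l (m2 arr)])) => //.
  by rewrite write_otherf //; split.
move=> k m1 kN ag ik [Zm1 gr Gm1].
apply: triple_post (body k m1 kN ag ik gr Zm1) _ => m2 [Zm2 gr2 Gk] _.
rewrite write_otherf //; split=> // [j /gr /gr2 //|l].
by rewrite ltnS leq_eqVlt => /orP [/eqP -> //|/Gm1]; apply: up.
Qed.

Lemma ix_onto (Q : finType) k : k < #|Q| -> exists x : Q, enum_rank x = k :> nat.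
Proof. by move=> kQ; exists (enum_val (Ordinal kQ)); rewrite enum_valK. Qed.

Lemma triple_for_grow_fin (Q : finType) arr Z (G : Q -> (seq nat -> nat) -> Prop)
    i e T c m :
  avoids e (i :: mods c) -> smem i (mods c) = false -> String.eqb i arr = false ->
  eval m e = #|Q| -> within Z (m arr) -> (forall x, upward (G x)) ->
  (forall x m1, agree (i :: mods c) m m1 -> m1 i [::] = enum_rank x ->
     grows (m arr) (m1 arr) -> within Z (m1 arr) ->
     triple m1 c T (fun m2 => [/\ within Z (m2 arr), grows (m1 arr) (m2 arr)
                               & G x (m2 arr)])) ->
  triple m (For i e c) (#|Q|.+1 * (T + (cost e + 10)))
    (fun m2 => [/\ within Z (m2 arr), grows (m arr) (m2 arr)
                 & forall x, G x (m2 arr)]).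
Proof.
move=> av ni ia eN Zm up body.
pose G' k f := forall x : Q, enum_rank x = k :> nat -> G x f.
have upG k : upward (G' k) by move=> f g fg Gf x xk; apply: up fg _; apply: Gf.
apply: triple_weaken (triple_for_grow av ni ia eN Zm upG _) _ _ => //.
  move=> k m1 /ix_onto [x <-] ag ix gr Zm1.
  apply: triple_post (body x m1 ag ix gr Zm1) _ => m2 [? ? Gx] _; split=> //.
  by move=> y /ord_inj /enum_rank_inj ->.
by move=> m2 [? ? Gm2]; split=> // x; apply: (Gm2 (enum_rank x)).
Qed.

Lemma triple_set arr Z (G : (seq nat -> nat) -> Prop) es m :
  within Z (m arr) -> Z (map (eval m) es) ->
  (forall f, f (map (eval m) es) != 0 -> G f) ->
  triple m (Assign arr es 1) (sumn (map cost es)).+2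
    (fun m2 => [/\ within Z (m2 arr), grows (m arr) (m2 arr) & G (m2 arr)]).
Proof.
move=> Zm Zc Gc; apply: triple_assign; last by rewrite /= addn1.
split=> [j|j fj|]; last by apply: Gc; rewrite write_same eqxx.
  by rewrite write_same; case: (_ =P j) => [<- _|_ /Zm].
by rewrite write_same; case: (_ =P j).
Qed.

Lemma triple_when_set arr Z (G : (seq nat -> nat) -> Prop) cond es m :
  within Z (m arr) -> (eval m cond != 0 -> Z (map (eval m) es)) ->
  (forall f, (eval m cond != 0 -> f (map (eval m) es) != 0) -> G f) ->
  triple m (When cond (Assign arr es 1)) ((sumn (map cost es)).+2 + (cost cond).+2)
    (fun m2 => [/\ within Z (m2 arr), grows (m arr) (m2 arr) & G (m2 arr)]).
Proof.
move=> Zm Zc Gc; apply: triple_when => [ne|e0]; last first.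
  by split=> //; apply: Gc; rewrite e0.
by apply: triple_set => // [|f fj]; [apply: Zc|apply: Gc].
Qed.

(* Bounds of the form [t <= c * P] with [c] a constant found by unification. *)
Lemma bound_const c P : 0 < P -> c <= c * P.
Proof. exact: leq_pmulr. Qed.

Lemma bound_add t1 t2 c1 c2 P : t1 <= c1 * P -> t2 <= c2 * P ->
  t1 + t2 <= (c1 + c2) * P.
Proof. by rewrite mulnDl; apply: leq_add. Qed.

Lemma bound_mul N t c P : t <= c * P -> N * t <= c * (N * P).
Proof. by rewrite mulnCA leq_mul2l => ->; rewrite orbT. Qed.

Lemma bound_weak N t c P : 0 < N -> t <= c * P -> t <= c * (N * P).
Proof. by move=> N0 /leq_trans; apply; rewrite leq_mul2l leq_pmull ?orbT. Qed.

(** The number of passes [N] often depends on the run, while the time bound may only mention a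
    uniform [M]. *)
Lemma triple_for_le (I : nat -> memory -> Prop) i e N M T c m Q :
  N <= M -> avoids e (i :: mods c) -> smem i (mods c) = false -> eval m e = N ->
  I 0 (write m i [::] 0) ->
  (forall k m1, k < N -> agree (i :: mods c) m m1 -> m1 i [::] = k -> I k m1 ->
     triple m1 c T (fun m2 => I k.+1 (write m2 i [::] k.+1))) ->
  (forall m1, agree (i :: mods c) m m1 -> I N m1 -> Q m1) ->
  triple m (For i e c) (M.+1 * (T + (cost e + 10))) Q.
Proof.
move=> NM av ni eN I0 body post.
apply: triple_weaken (triple_for av ni eN I0 body post) _ _ => //.
by rewrite leq_mul2r ltnS NM orbT.
Qed.

Lemma agree_incl l l' m m' : all (smem^~ l') l -> agree l m m' -> agree l' m m'.
Proof.
move=> sub; apply: agree_sub => a; rewrite /smem.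
elim: l sub => //= b l IH /andP [bl /IH sub] /orP [/String.eqb_eq -> //|/sub].
exact.
Qed.

Lemma agree_write l m m1 a i v : smem a l -> agree l m m1 -> agree l m (write m1 a i v).
Proof.
move=> al ag b bl; rewrite write_otherf ?ag //; apply/negbTE/negP => /String.eqb_eq ab.
by rewrite ab bl in al.
Qed.

(** * Weak transitions and subsets *)

Local Notation ix x := (nat_of_ord (enum_rank x)).

Ltac rd := rewrite ?bool_neq0; repeat match goal with
  | H : agree _ _ ?m |- context [?m ?a] => rewrite (H a erefl)
  | H : ?m ?a ?j = _ |- context [?m ?a ?j] => rewrite H
  end.

Ltac ra := repeat match goal with
  | H : agree _ _ ?m |- context [?m ?a] => rewrite (H a erefl)
  end.

Ltac up := repeat intro;
  match goal with H : grows _ _ |- _ => apply: (H _) end; eauto.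

Ltac bnd := repeat first
  [ apply: bound_add | apply: bound_mul
  | by apply: bound_const; rewrite ?muln_gt0 ?expn_gt0
  | apply: bound_weak; first by rewrite ?muln_gt0 ?expn_gt0 ].

Section Tables.
Variables (E : choiceType) (S : {fset E}) (A : fin_automaton S).
Local Notation nE := (size (enum_fset S)).
Local Notation n := #|fstate A|.
Implicit Types x y z : fstate A.

Lemma onth_ix (Q : finType) (x : Q) : onth (enum Q) (ix x) = Some x.
Proof.
rewrite onthE (nth_map x) ?nth_enum_rank // -cardE; exact: ltn_ord.
Qed.

Lemma labels_lab k : k <= nE -> onth (labels S) k = Some (Some (lab S k)).
Proof.
move=> kn; rewrite /labels onthE -!cats1 !map_cat nth_cat size_cat !size_map /=.
rewrite addn1 ltnS kn nth_cat !size_map ltn_neqAle kn andbT.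
case: eqVneq => [->|ne] /=; first by rewrite subnn lab_term.
have {}kn : k < nE by rewrite ltn_neqAle ne.
have [e _] : {e : E | true} by case: (enum_fset S) kn => // e; exists e.
by rewrite /lab -map_comp (nth_map e) // (nth_map e).
Qed.

Lemma labels_silent : onth (labels S) nE.+1 = Some None.
Proof. by rewrite /labels onthE map_rcons nth_rcons !size_map size_rcons size_map ltnn eqxx. Qed.

Lemma trans_table_lab k x y : k <= nE ->
  trans_table A k (ix x) (ix y) = Defs.ftrans x (Some (lab S k)) y.
Proof. by move=> kn; rewrite /trans_table labels_lab ?onth_ix. Qed.

Lemma trans_table_silent x y : trans_table A nE.+1 (ix x) (ix y) = Defs.ftrans x None y.
Proof. by rewrite /trans_table labels_silent ?onth_ix. Qed.

Lemma init_table_ix x : init_table A (ix x) = (x \in finit A).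
Proof. by rewrite /init_table onth_ix. Qed.

Definition silent : rel (fstate A) := fun x y => Defs.ftrans x None y.

Lemma weak_nilP x y : weak (A := A) x [::] y <->
  exists2 s, path silent x s & y = last x s.
Proof.
split=> [[t [xy t0]]|[s xs ->]].
  elim: t x xy t0 => [|[v|] t IH] x //=; first by move=> ->; exists [::].
  case=> z [xz /IH h] /h [s zs ->]; exists (z :: s) => //=.
  by rewrite zs andbT.
elim: s x xs => [|z s IH] x /=; first by move=> _; apply: weak_refl.
case/andP => xz /IH zs; apply/(weak_cat _ [::]); exists z => //.
exact: (@weak_trans _ _ A _ None).
Qed.

(** A path without repetitions visits each state at most once. This is why as many rounds as there
    are states suffice in the closure computations. *)
Lemma path_short (Q : finType) (e : rel Q) (x : Q) s : path e x s ->
  exists s', [/\ path e x s', last x s' = last x s & size s' < #|Q|].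
Proof.
case/shortenP => s' xs' un _; exists s'; split=> //.
by rewrite -[_.+1]/(size (x :: s')) -(card_uniqP un) max_card.
Qed.

Definition graph_is (u : string) (m : memory) : Prop :=
  [/\ m ("n" ++ u)%string [::] = n, m "nE"%string [::] = nE &
   forall l x y, l <= nE.+1 ->
     m ("trans" ++ u)%string [:: l; ix x; ix y] = trans_table A l (ix x) (ix y)].

Definition steps_are (u : string) (m : memory) : Prop :=
  (forall x y, m ("closure" ++ u)%string [:: ix x; ix y] != 0 <->
     weak (A := A) x [::] y) /\
  (forall k x y, k <= nE -> m ("step" ++ u)%string [:: k; ix x; ix y] != 0 <->
     weak (A := A) x [:: lab S k] y).

End Tables.

Local Open Scope string_scope.

(** After [i] rounds the closure contains the endpoints of all silent paths of length at most [i],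
    and possibly more, all of them correct. The constant is left open by [eexists] and assembled by
    [bnd] from the costs of the expressions. *)
Lemma weak_steps_correct : exists C, forall u (E : choiceType) (S : {fset E})
    (A : fin_automaton S) m,
  graph_is A u m -> (forall j, m ("closure" ++ u) j = 0) ->
  (forall j, m ("step" ++ u) j = 0) ->
  triple m (weak_steps u)
    (C * ((size (enum_fset S)).+2 * (#|fstate A|.+1 * (#|fstate A|.+1 *
       (#|fstate A|.+1 * (#|fstate A|.+1 * 1))))))
    (steps_are A u).
Proof.
eexists => u E S A m [en enE etr] c0 s0.
set n := #|fstate A| in en *; set nE := size _ in enE etr *.
have ix_inj (x y : fstate A) : ix x = ix y -> x = y.
  by move/ord_inj/enum_rank_inj.
pose Zc j := exists x y : fstate A, j = [:: ix x; ix y] /\ weak (A := A) x [::] y.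
pose Zs j := exists k (x y : fstate A), [/\ j = [:: k; ix x; ix y], k <= nE &
  weak (A := A) x [:: lab S k] y].
pose cl := ("closure" ++ u).
pose reach k f := forall (x : fstate A) s, size s <= k -> path (@silent _ _ A) x s ->
  f [:: ix x; ix (last x s)] != 0.
have ZcE f (x y : fstate A) : within Zc f -> f [:: ix x; ix y] != 0 -> weak (A := A) x [::] y.
  by move=> Z /Z [x' [y' [[/ix_inj -> /ix_inj ->]]]].
rewrite /weak_steps /assign /Var.
apply: (@triple_weaken _ _ _ _ _ _ _ _ (fun _ h => h)).
  pose G0 (x : fstate A) (f : seq nat -> nat) : Prop := f [:: ix x; ix x] != 0.
  apply: triple_seq.
  apply: triple_post (@triple_for_grow_fin (fstate A) cl Zc
    G0 _ _ _ _ m _ _ _ _ _ _ _) _ => //.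
  - by move=> j; rewrite c0.
  - by up.
  - move=> x m1 ag xk gr Z1.
    apply: triple_set => //=; rewrite xk //.
    by exists x, x; split=> //; apply: weak_refl.
  move=> m1 [Z1 _ G1] ag1.
  apply: triple_seq.
  apply: (triple_for (N := n) (I := fun i m2 => within Zc (m2 cl) /\ reach i (m2 cl))) => //.
  - by rewrite /= /Var; rd.
  - by rewrite write_otherf //; split=> // x [|//] _ _; apply: G1.
  - move=> i m2 iN ag2 i2 [Z2 R2].
    (* The premise reads the table as it was at the start of the round; updates made during the
       round only add entries, so it still holds when the test is executed. *)
    pose G3 (x y z : fstate A) (f : seq nat -> nat) :=
      m2 cl [:: ix x; ix y] != 0 -> silent y z -> f [:: ix x; ix z] != 0.
    pose G2 x y f := forall z, G3 x y z f.
    pose G1' x f := forall y, G2 x y f.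
    apply: triple_post (@triple_for_grow_fin (fstate A) cl Zc G1' _ _ _ _ _ _ _ _ _ _ _ _) _ => //.
    + by rewrite /= /Var; rd.
    + by rewrite /G1' /G2 /G3; up.
    + move=> x m3 ag3 x3 gr3 Z3; apply: (triple_for_grow_fin (G := G2 x)) => //.
      * by rewrite /= /Var; rd.
      * by rewrite /G2 /G3; up.
      move=> y m4 ag4 y4 gr4 Z4; apply: (triple_for_grow_fin (G := G3 x y)) => //.
      * by rewrite /= /Var; rd.
      * by rewrite /G3; up.
      move=> z m5 ag5 z5 gr5 Z5; apply: triple_when_set => //=.
        rd; rewrite etr addn1 // trans_table_silent !bool_neq0 => /andP [c t].
        exists x, z; split=> //; apply/(weak_cat _ [::]).
        exists y; first exact: ZcE Z5 c.
        exact: (@weak_trans _ _ A _ None).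
      move=> f; rd; rewrite etr addn1 // trans_table_silent !bool_neq0 => fC c t.
      by apply: fC; apply/andP; split=> //; apply: gr5; apply: gr4; apply: gr3.
    move=> m3 [Z3 gr3 H3] ag3; rewrite write_otherf //; split=> // x s.
    have R3 y s' : size s' <= i -> path (@silent _ _ A) y s' ->
      m3 cl [:: ix y; ix (last y s')] != 0.
      by move=> le pa; apply: gr3; apply: R2.
    case/lastP: s => [|s z]; first by move=> _ _; apply: R3.
    rewrite size_rcons ltnS rcons_path last_rcons => le /andP [pa tz].
    by apply: H3 tz; apply: R2.
  move=> m2 ag2 [Z2 R2].
  have clP (x y : fstate A) : m2 cl [:: ix x; ix y] != 0 <-> weak (A := A) x [::] y.
    split; first exact: ZcE.
    case/weak_nilP => s /path_short [s' [pa <- lt]] ->; exact: R2 (ltnW lt) pa.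
  pose H4 k (x w z y : fstate A) (f : seq nat -> nat) : Prop := m2 cl [:: ix x; ix w] != 0 ->
    Defs.ftrans w (Some (lab S k)) z -> m2 cl [:: ix z; ix y] != 0 ->
    f [:: k; ix x; ix y] != 0.
  pose H3 k x w z f := forall y, H4 k x w z y f.
  pose H2 k x w f := forall z, H3 k x w z f.
  pose H1 k x f := forall w, H2 k x w f.
  pose H0 k f := forall x, H1 k x f.
  pose st := ("step" ++ u).
  apply: triple_post (@triple_for_grow st Zs H0 _ _ nE.+1 _ _ _ _ _ _ _ _ _ _) _ => //.
  - by rewrite /=; rd; rewrite addn1.
  - by move=> j; rd; rewrite s0.
  - by rewrite /H0 /H1 /H2 /H3 /H4; up.
  - move=> k m3 kE ag3 k3 gr3 Z3; apply: (triple_for_grow_fin (G := H1 k)) => //.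
    + by rewrite /=; rd.
    + by rewrite /H1 /H2 /H3 /H4; up.
    move=> x m4 ag4 x4 gr4 Z4; apply: (triple_for_grow_fin (G := H2 k x)) => //.
    + by rewrite /=; rd.
    + by rewrite /H2 /H3 /H4; up.
    move=> w m5 ag5 w5 gr5 Z5; apply: (triple_for_grow_fin (G := H3 k x w)) => //.
    + by rewrite /=; rd.
    + by rewrite /H3 /H4; up.
    move=> z m6 ag6 z6 gr6 Z6; apply: (triple_for_grow_fin (G := H4 k x w z)) => //.
    + by rewrite /=; rd.
    + by rewrite /H4; up.
    move=> y m7 ag7 y7 gr7 Z7; apply: triple_when_set => //=.
      rd; rewrite (etr _ _ _ (ltnW kE)) (trans_table_lab _ _ kE) !bool_neq0.
      case/andP => /clP c1 /andP [t /clP c2]; exists k, x, y; split=> //.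
      by apply/weak1P; exists w, z.
    move=> f; rd; rewrite (etr _ _ _ (ltnW kE)) (trans_table_lab _ _ kE) !bool_neq0.
    by move=> fC c1 t c2; apply: fC; rewrite c1 t.
  move=> m3 [Z3 _ H3'] ag3; split=> [x y|k x y kE]; first by rewrite ag3.
  split; first by case/Z3 => k' [x' [y' [[-> /ix_inj -> /ix_inj ->]]]].
  by case/weak1P => w [z [/clP c1 t /clP c2]]; apply: (H3' k kE x w z y).
rewrite /=; bnd.
Qed.

Ltac wr := repeat first
  [ rewrite write_same
  | rewrite write_otherf; [|reflexivity] ]; rewrite ?eqxx.

Lemma eqseq2 (a b c d : nat) : ([:: a; b] == [:: c; d]) = (a == c) && (b == d).
Proof. by rewrite !eqseq_cons andbT. Qed.

Lemma eqseq3 (a b c d e f : nat) :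
  ([:: a; b; c] == [:: d; e; f]) = [&& a == d, b == e & c == f].
Proof. by rewrite !eqseq_cons andbT. Qed.

(** * Subsets as bit vectors *)

Definition bit (X x : nat) : bool := odd (X %/ 2 ^ x).

Lemma bit_small X x q : X < 2 ^ q -> q <= x -> bit X x = false.
Proof.
by move=> Xq qx; rewrite /bit divn_small // (leq_trans Xq) // leq_exp2l.
Qed.

Lemma bit_add X q x : X < 2 ^ q ->
  bit (X + 2 ^ q) x = if x < q then bit X x else x == q.
Proof.
move=> Xq; case: (ltngtP x q) => [lt|gt|->].
- have -> : 2 ^ q = 2 ^ (q - x) * 2 ^ x by rewrite -expnD subnK // ltnW.
  rewrite /bit divnDMl ?expn_gt0 // oddD oddX /=.
  by rewrite -leqn0 leqNgt subn_gt0 lt addbF.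
- apply: bit_small (gt); rewrite expnS; lia.
- by rewrite /bit -{1}[2 ^ q]mul1n divnDMl ?expn_gt0 // divn_small.
Qed.

Lemma bit_sum n (b : nat -> bool) k :
  bit (\sum_(i < n) b i * 2 ^ i) k = (k < n) && b k /\
  \sum_(i < n) b i * 2 ^ i < 2 ^ n.
Proof.
elim: n => [|n [IHb IHlt]]; first by rewrite big_ord0 /bit div0n.
rewrite big_ord_recr /=; case bn: (b n); last first.
  rewrite mul0n addn0 IHb expnS mul2n -addnn; split; last exact: ltn_addr.
  by rewrite ltnS [k <= n]leq_eqVlt; case: (eqVneq k n) => [->|_] /=; rewrite ?bn ?andbF.
rewrite mul1n bit_add // IHb expnS mul2n -addnn; split; last by rewrite ltn_add2r.
by rewrite ltnS; case: ltngtP => // ->; rewrite bn.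
Qed.

Section Codes.
Variable Q : finType.

Lemma code_sum (X : {set Q}) : code (Some X) =
  \sum_(i < #|Q|) [exists x in X, ix x == i] * 2 ^ i.
Proof.
rewrite /code big_mkcond (reindex (@enum_val Q Q)) /=; last first.
  by exists enum_rank => x _; rewrite ?enum_valK ?enum_rankK.
apply: eq_bigr => i _; rewrite enum_valK.
case: existsP => [[x /andP [xX /eqP xi]]|no].
  by rewrite mul1n -(ord_inj xi) enum_rankK xX.
rewrite mul0n; case: ifP => // iX; case: no; exists (enum_val i).
by rewrite enum_valK iX eqxx.
Qed.

Lemma bit_code (X : {set Q}) x : bit (code (Some X)) (ix x) = (x \in X).
Proof.
rewrite code_sum.
have [-> _] := bit_sum #|Q| (fun i => [exists x in X, ix x == i]) (ix x).
rewrite ltn_ord; apply/existsP/idP => [[y /andP [yX /eqP]]|xX].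
  by move/ord_inj/enum_rank_inj <-.
by exists x; rewrite xX eqxx.
Qed.

Lemma code_lt (X : {set Q}) : code (Some X) < 2 ^ #|Q|.
Proof.
rewrite code_sum.
by have [_] := bit_sum #|Q| (fun i => [exists x in X, ix x == i]) 0.
Qed.

Lemma code_le (X : det Q) : code X <= 2 ^ #|Q|.
Proof. by case: X => [X|] //=; apply: ltnW; apply: code_lt. Qed.

Lemma code_inj : injective (@code Q).
Proof.
move=> [X|] [Y|] //= e; last 2 first.
- by have := code_lt X; rewrite /= e ltnn.
- by have := code_lt Y; rewrite /= -e ltnn.
by congr Some; apply/setP => x; rewrite -!bit_code /= e.
Qed.

Lemma card_det : #|{: det Q}| = (2 ^ #|Q|).+1.
Proof.
by rewrite card_option -(cardsT {set Q}) -powersetT card_powerset cardsT.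
Qed.

(** An injection between finite sets of equal size is onto. Hence a loop over the numbers up to
    [2 ^ #|Q|] visits all sets and omega. *)
Lemma code_onto k : k <= 2 ^ #|Q| -> exists X : det Q, code X = k.
Proof.
move=> kQ; pose f (X : det Q) : 'I_(2 ^ #|Q|).+1 := Ordinal (code_le X : _ < _.+1).
have fi : injective f by move=> X Y [/code_inj].
have cd : #|{: 'I_(2 ^ #|Q|).+1}| <= #|{: det Q}| by rewrite card_ord card_det.
have [g _ gK] := inj_card_bij fi cd.
by exists (g (Ordinal (kQ : _ < _.+1))); have := congr1 val (gK (Ordinal (kQ : _ < _.+1))).
Qed.

Lemma code_set0 : code (Some set0 : det Q) = 0.
Proof. by rewrite /= big_set0. Qed.

Lemma code_set1 (x : Q) : code (Some [set x]) = 2 ^ ix x.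
Proof. by rewrite /= big_set1. Qed.

Lemma code_pred (P : pred Q) : \sum_(x | P x) 2 ^ ix x = code (Some [set x | P x]).
Proof. by rewrite /=; apply: eq_bigl => x; rewrite inE. Qed.

End Codes.

(** Round [q] copies the rows of the first [2 ^ q] sets to the numbers shifted by [2 ^ q] and adds
    the element [q]. Rows not yet written must be zero, as the copying fills only the columns below
    [q]; in the end this also says that omega, in row [2 ^ n], has no elements. Every inner loop is
    charged [2 ^ n] passes, which is generous. *)
Lemma subsets_correct : exists C, forall u m n,
  m ("n" ++ u) [::] = n -> (forall j, m ("mem" ++ u) j = 0) ->
  triple m (subsets u) (C * (n.+1 * ((2 ^ n).+1 * (n.+1 * 1))))
    (fun m' => [/\ m' ("N" ++ u) [::] = 2 ^ n,
       forall q, q < n -> m' ("pow" ++ u) [:: q] = 2 ^ q,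
       forall X x, X < 2 ^ n -> (m' ("mem" ++ u) [:: X; x] != 0) = bit X x &
       forall X x, 2 ^ n <= X -> m' ("mem" ++ u) [:: X; x] = 0]).
Proof.
eexists => u m n en m0; rewrite /subsets /assign /Var.
apply: triple_weaken; [apply: triple_seq|idtac|move=> ?; apply].
  apply: triple_assign; last exact: leqnn.
  apply: (triple_for (N := n) (I := fun q m' => [/\ m' ("N" ++ u) [::] = 2 ^ q,
       forall q', q' < q -> m' ("pow" ++ u) [:: q'] = 2 ^ q',
       forall X x, X < 2 ^ q -> (m' ("mem" ++ u) [:: X; x] != 0) = bit X x &
       forall X x, 2 ^ q <= X -> m' ("mem" ++ u) [:: X; x] = 0])) => //.
  - rewrite /=; wr; split=> // X x.
    by rewrite ltnS leqn0 => /eqP ->; rewrite m0 /bit div0n.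
  - move=> q m1 qn ag1 q1 [N1 P1 B1 Z1].
    have qX : 2 ^ q <= 2 ^ n by rewrite leq_exp2l // ltnW.
    apply: triple_seq; apply: triple_assign; last exact: leqnn.
    apply: triple_seq; set m2 := write _ _ _ _.
    have N2 : m2 ("N" ++ u) [::] = 2 ^ q by rewrite /m2; wr.
    have q2 : m2 "q" [::] = q by rewrite /m2; wr.
    apply: (triple_for_le (N := 2 ^ q) (M := 2 ^ n) (I := fun K m' =>
       [/\ forall X x, X < 2 ^ q + K -> (m' ("mem" ++ u) [:: X; x] != 0) = bit X x &
        forall X x, 2 ^ q + K <= X -> m' ("mem" ++ u) [:: X; x] = 0])) => //.
    + wr; rewrite addn0; split=> X x; rewrite /m2; wr; [exact: B1|exact: Z1].
    + move=> K m3 Kq ag3 K3 [B3 Z3].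
      apply: triple_seq.
      apply: (triple_for_le (N := q) (M := n) (I := fun k m' =>
        forall Y x, m' ("mem" ++ u) [:: Y; x] = if Y == K + 2 ^ q then
          (if x < k then m3 ("mem" ++ u) [:: K; x] else 0)
          else m3 ("mem" ++ u) [:: Y; x])) => //.
      * exact: ltnW.
      * by rewrite /=; rd.
      * move=> Y x; wr; case: eqP => // ->; apply: Z3; lia.
      * move=> k m4 kq ag4 k4 H4; apply: triple_assign; last exact: leqnn.
        move=> Y x; wr; rewrite /= k4; rd; rewrite eqseq2 [K + _ == Y]eq_sym.
        (* The row that is read differs from the row that is written, so the copy does not disturb
           its source. *)
        have KN : (K == K + 2 ^ q) = false by rewrite -{1}[K]addn0 eqn_add2l ltn_eqF ?expn_gt0.
        rewrite !H4 KN; case: (eqVneq Y (K + 2 ^ q)) => [_|_] /=; last by [].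
        by rewrite ltnS [x <= k]leq_eqVlt [x == k]eq_sym; case: (eqVneq k x) => [->|_].
      move=> m4 ag4 H4; apply: triple_assign; last exact: leqnn.
      rewrite /=; rd; split=> X x; wr; rewrite eqseq2 [K + _ == X]eq_sym H4.
        case: (eqVneq X (K + 2 ^ q)) => [->|ne] /= lt; last by apply: B3; lia.
        rewrite addnC addnC bit_add // [x == q]eq_sym; case: (eqVneq q x) => [<-|ne].
          by rewrite ltnn.
        by case: ifP => // lt'; apply: B3; lia.
      by case: (eqVneq X (K + 2 ^ q)) => [->|ne] /=; [lia|move=> le; apply: Z3; lia].
    move=> m3 ag3 [B3 Z3]; apply: triple_assign; last exact: leqnn.
    rewrite /=; wr; rd; split.
    + by rewrite expnS mul2n addnn.
    + move=> q'; rewrite ltnS leq_eqVlt; wr; rd; rewrite /m2; wr; rewrite /= q1 N1.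
      rewrite eqseq_cons andbT [q == q']eq_sym.
      by case: (eqVneq q' q) => [->|] //= _; apply: P1.
    + by move=> X x lt; wr; apply: B3; move: lt; rewrite expnS; lia.
    + by move=> X x lt; wr; apply: Z3; move: lt; rewrite expnS; lia.
rewrite /=; bnd.
Qed.

Local Arguments code : simpl never.
Lemma triple_for_fin (Q : finType) (I : nat -> memory -> Prop) i e T c m R :
  avoids e (i :: mods c) -> smem i (mods c) = false -> eval m e = #|Q| ->
  I 0 (write m i [::] 0) ->
  (forall (x : Q) m1, agree (i :: mods c) m m1 -> m1 i [::] = ix x -> I (ix x) m1 ->
     triple m1 c T (fun m2 => I (ix x).+1 (write m2 i [::] (ix x).+1))) ->
  (forall m1, agree (i :: mods c) m m1 -> I #|Q| m1 -> R m1) ->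
  triple m (For i e c) (#|Q|.+1 * (T + (cost e + 10))) R.
Proof.
move=> av ni eN I0 body post; apply: (triple_for (I := I)) => // k m1 /ix_onto [x <-].
exact: body.
Qed.

Lemma ix_ltS (Q : finType) (x y : Q) : (ix y < (ix x).+1) = (ix y < ix x) || (y == x).
Proof.
rewrite ltnS leq_eqVlt orbC; congr (_ || _).
by apply/eqP/eqP => [/ord_inj/enum_rank_inj|->].
Qed.

Section CodeLoop.
Variables (Q : finType) (P : Q -> Q -> bool) (b : bool) (u : string) (cond : expr).
Local Notation v := (if b then "Y" else "X").

(** This shape occurs twice: [subset_construction] accumulates into [Y], [start_pairs] into [X]. The
    boolean [b] selects the variable. *)
Definition code_loop : cmd :=
  (For "y" (Rd ("n" ++ u) [::]) (
    Assign "found" [::] 0;;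
    For "x" (Rd ("n" ++ u) [::]) (When cond (Assign "found" [::] 1));;
    When (Rd "found" [::])
      (Assign v [::] (Bin Add (Rd v [::]) (Rd ("pow" ++ u) [:: Rd "y" [::]])))))%ram.

(* [y] is added to the set under construction if [P x y] for some [x]. *)
Lemma code_loop_correct m T :
  m ("n" ++ u) [::] = #|Q| ->
  (forall x : Q, m ("pow" ++ u) [:: ix x] = 2 ^ ix x) -> m v [::] = 0 ->
  (forall x y m', agree [:: "y"; "x"; "found"; v] m m' -> m' "x" [::] = ix x ->
     m' "y" [::] = ix y -> (eval m' cond != 0) = P x y) ->
  #|Q|.+1 * (#|Q|.+1 * (cost cond + 20) + 30) <= T ->
  triple m code_loop T
    (fun m' => m' v [::] = code (Some [set y | [exists x, P x y]])).
Proof.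
move=> nQ powm v0 condP leT.
have cases : forall t : bool -> bool, t true -> t false -> t b by case: (b).
pose L := [:: "y"; "x"; "found"; v].
have red (a : string) m1 : agree L m m1 -> smem a L = false -> m1 a = m a by move=> h /h.
apply: (triple_weaken _ (leq_trans _ leT) (fun _ h => h)).
  apply: (@triple_for_fin Q (fun K m' =>
    m' v [::] = \sum_(y | (ix y < K) && [exists x, P x y]) 2 ^ ix y)) => //.
  - by case: (b).
  - by case: (b).
  - rewrite write_otherf; last by case: (b).
    by rewrite big_pred0.
  - move=> y m1 ag1 y1 v1; apply: triple_seq; apply: triple_assign; last exact: leqnn.
    set m2 := write _ _ _ _; apply: triple_seq.
    pose G x (f : seq nat -> nat) : Prop := P x y -> f [::] != 0.
    pose Z (j : seq nat) : Prop := j = [::] -> [exists x, P x y].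
    have agL2 : agree L m m2.
      apply: agree_write; first by rewrite /L; case: (b).
      by apply: agree_incl ag1; rewrite /L; case: (b).
    have y2 : m2 "y" [::] = ix y by rewrite /m2; wr.
    apply: triple_post (@triple_for_grow_fin Q "found" Z G _ _ _ _ m2 _ _ _ _ _ _ _) _ => //.
    + by rewrite /= (red _ _ agL2) // /L; case: (b).
    + by move=> j; rewrite /m2 write_same; case: ([::] =P j) => // jn _ /esym.
    + by rewrite /G; up.
    + move=> x m3 ag3 x3 gr3 Z3.
      have agL3 : agree L m m3.
        by apply: agree_trans agL2 (agree_incl _ ag3); rewrite /L; case: (b).
      have y3 : m3 "y" [::] = ix y by rewrite (ag3 "y" erefl).
      have cP := condP x y m3 agL3 x3 y3.
      apply: triple_when_set => //; rewrite cP.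
        by move=> Pxy _; apply/existsP; exists x.
      by move=> f fP Pxy; apply: fP.
    move=> m3 [Z3 _ G3] ag3.
    have fE : (m3 "found" [::] != 0) = [exists x, P x y].
      by apply/idP/existsP => [/Z3 /(_ erefl) /existsP|[x /G3]].
    have agL3 : agree L m m3.
      by apply: agree_trans agL2 (agree_incl _ ag3); rewrite /L; case: (b).
    have v3 : m3 v [::] = m1 v [::].
      by rewrite (ag3 v) ?/m2 ?write_otherf //; case: (b).
    have y3 : m3 "y" [::] = ix y by rewrite (ag3 "y" erefl).
    have sumE : \sum_(y' | (ix y' < (ix y).+1) && [exists x, P x y']) 2 ^ ix y' =
        m1 v [::] + (if [exists x, P x y] then 2 ^ ix y else 0).
      rewrite v1 (bigID (pred1 y)) addnC /=; congr (_ + _); last first.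
        apply: eq_bigl => y'; rewrite ix_ltS; case: eqVneq => [->|ne].
          by rewrite ltnn andbF.
        by rewrite orbF andbT.
      case: ifP => Py.
        by rewrite (big_pred1 y) // => y'; rewrite ix_ltS /=; case: eqVneq => [->|]; rewrite ?andbF // orbT Py.
      by rewrite big_pred0 // => y'; case: eqVneq => [->|]; rewrite ?andbF // Py !andbF.
    apply: triple_when => /= [ne|/eqP e0]; last first.
      rewrite write_otherf; last by case: (b).
      by rewrite sumE v3 -fE e0 addn0.
    apply: triple_assign; last exact: leqnn.
    rewrite write_otherf; last by case: (b).
    rewrite write_same eqxx /= y3 v3 (red _ _ agL3); last by rewrite /L; case: (b).
    by rewrite powm sumE -fE ne.
  move=> m1 _ ->; rewrite -code_pred; apply: eq_bigl => y.
  by rewrite ltn_ord.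
rewrite /=; nia.
Qed.
End CodeLoop.

Definition subset_codes (Q : finType) u (m : memory) :=
  [/\ m ("N" ++ u) [::] = 2 ^ #|Q|,
      forall x : Q, m ("pow" ++ u) [:: ix x] = 2 ^ ix x &
      forall (X : det Q) (x : Q), (m ("mem" ++ u) [:: code X; ix x] != 0) =
        (if X is Some X then x \in X else false)].

Definition delta_is (E : choiceType) (S : {fset E}) (A : fin_automaton S) u (m : memory) :=
  forall (X : det (fstate A)) k, k <= size (enum_fset S) ->
    m ("delta" ++ u) [:: code X; k] = code (delta X (lab S k)).

(** The row of omega is no special case: its membership row is empty, so all its entries come out as
    0, the code of the empty set. *)
Lemma subset_construction_correct : exists C, forall u (E : choiceType) (S : {fset E})
    (A : fin_automaton S) m,
  graph_is A u m -> subset_codes (fstate A) u m -> steps_are A u m ->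
  triple m (subset_construction u)
    (C * ((2 ^ #|fstate A|).+2 * ((size (enum_fset S)).+1 *
       (#|fstate A|.+1 * (#|fstate A|.+1 * 1)))))
    (delta_is A u).
Proof.
eexists => u E S A m [en enE _] [N0 pow0 mem0] [_ step0].
set Q := fstate A in en N0 pow0 mem0 *; set n := #|Q| in en *.
set nE := size _ in enE *.
pose dl := "delta" ++ u.
pose P k e (x y : Q) : bool :=
  (m ("mem" ++ u) [:: k; ix x] != 0) && (m ("step" ++ u) [:: e; ix x; ix y] != 0).
pose row k (f : seq nat -> nat) :=
  (forall e, e < nE -> f [:: k; e] = code (Some [set y | [exists x, P k e x y]])) /\
  f [:: k; nE] = if [exists x, exists y, P k nE x y] then 2 ^ n else 0.
rewrite /subset_construction /assign /Var.
apply: (triple_weaken _ _ (fun _ h => h)).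
  apply: (triple_for (N := (2 ^ n).+1) (I := fun k m' => forall k', k' < k -> row k' (m' dl))) => //.
  - by rewrite /= N0 addn1.
  - move=> k m1 kN ag1 k1 R1; apply: triple_seq.
    apply: (triple_for (N := nE) (I := fun e m' =>
      (forall k', k' < k -> row k' (m' dl)) /\
      forall e', e' < e -> m' dl [:: k; e'] = code (Some [set y | [exists x, P k e' x y]]))) => //.
    + by rewrite /=; rd.
    + move=> e m2 eE ag2 e2 [R2 D2]; apply: triple_seq; apply: triple_assign; last exact: leqnn.
      apply: triple_seq; set m3 := write _ _ _ _.
      have /= H := @code_loop_correct Q (P k e) true u
        (Rd ("mem" ++ u) [:: Rd "X" [::]; Rd "x" [::]] && Rd ("step" ++ u) [:: Rd "e" [::]; Rd "x" [::]; Rd "y" [::]])%ram m3.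
      apply: triple_post (H _ _ _ _ _ (leqnn _)) _ => {H}.
      * by rewrite /m3; wr; rd.
      * by move=> x; rewrite /m3; wr; rd; apply: pow0.
      * by rewrite /m3; wr.
      * move=> x y m4 ag4 x4 y4; rd; rewrite /m3; wr; rd.
        by rewrite /P; case: (_ && _).
      move=> m4 Y4 ag4; apply: triple_assign; last exact: leqnn.
      rewrite /=; rd; rewrite /m3; wr; rd; split.
        move=> k' k'k; have [Rk Rt] := R2 k' k'k.
        split=> [e1 e1E|]; wr; rewrite eqseq2 gtn_eqF /=; rd; rewrite /m3; wr; rd => //.
        by apply: Rk.
      move=> e' e'e; wr; rd; rewrite eqseq2 eqxx /= eq_sym; case: eqVneq => [->//|ne].
      rewrite /m3; wr; apply: D2; move: e'e; rewrite ltnS leq_eqVlt.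
      by rewrite (negbTE ne).
    move=> m2 ag2 [R2 D2]; apply: triple_seq; apply: triple_assign; last exact: leqnn.
    rewrite /=; rd; set m3 := write _ _ _ _.
    have ag3 : agree [:: dl] m2 m3 by apply: agree_write; [rewrite /smem /= String.eqb_refl|].
    have d3 j : j != [:: k; nE] -> m3 dl j = m2 dl j.
      by move=> ne; rewrite /m3 write_same eq_sym (negbTE ne).
    have t3 : m3 dl [:: k; nE] = 0 by rewrite /m3 write_same eqxx.
    (* The omega entry is 0 or [2 ^ n], the codes of the empty set and of omega, and is nonzero only
       for a reason; the other entries are untouched. *)
    pose V m' := (forall j, j != [:: k; nE] -> m' dl j = m3 dl j) /\
      (m' dl [:: k; nE] = if m' dl [:: k; nE] != 0 then 2 ^ n else 0) /\
      (m' dl [:: k; nE] != 0 -> [exists x, exists y, P k nE x y]).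
    apply: (@triple_for_fin Q (fun i m' => V m' /\ forall x y, ix x < i -> P k nE x y ->
      m' dl [:: k; nE] != 0)) => //.
    + by rewrite /=; rd.
    + by rewrite /V write_otherf // t3.
    + move=> x m4 ag4 x4 [V4 C4].
      apply: (@triple_for_fin Q (fun i m' => V m' /\ forall x' y, (ix x' < ix x) || ((x' == x) && (ix y < i)) ->
        P k nE x' y -> m' dl [:: k; nE] != 0)) => //.
      * by rewrite /=; rd.
      * rewrite /V write_otherf //; split=> // x' y /orP [/C4|/andP [_]]; last by rewrite ltn0.
        by apply.
      * move=> y m5 ag5 y5 [V5 C5]; apply: triple_when.
          rewrite /=; rd => /andP [pm ps].
          have Pxy : P k nE x y by apply/andP.
          apply: triple_assign; last exact: leqnn.
          set m6 := write _ "y" _ _.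
          have dE j : m6 dl j = if j == [:: k; nE] then 2 ^ n else m5 dl j.
            by rewrite /m6; wr; rewrite /=; rd; rewrite eq_sym.
          split; last by move=> *; rewrite dE eqxx -lt0n expn_gt0.
          split; first by move=> j jn; rewrite dE (negbTE jn); apply: (proj1 V5).
          rewrite dE eqxx -lt0n expn_gt0; split=> // _.
          by apply/existsP; exists x; apply/existsP; exists y.
        rewrite /=; rd => e0; rewrite /V; wr; split=> // x' y'; rewrite ix_ltS andb_orr orbA.
        case/orP => [|/andP [/eqP -> /eqP ->]]; first exact: C5.
        by move: e0; rewrite /P; case: (_ && _).
      move=> m5 ag5 [V5 C5]; rewrite /V; wr; split=> // x' y; rewrite ix_ltS => x'x.
      by apply: C5; rewrite ltn_ord andbT.
    move=> m4 ag4 [[V4 [V4' V4'']] C4] k'; rewrite ltnS leq_eqVlt write_otherf //.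
    case/orP => [/eqP ->|k'k]; split.
    + move=> e eE; rewrite V4 ?d3 ?D2 // eqseq_cons eqxx /= eqseq_cons andbT ltn_eqF //.
    + rewrite V4'; case: ifP => [/V4'' ->//|n0]; case: existsP => // -[x /existsP [y Pxy]].
      by rewrite (C4 x y) // in n0.
    + move=> e eE; have ne : [:: k'; e] != [:: k; nE] by rewrite eqseq2 ltn_eqF.
      by have [Rk _] := R2 k' k'k; rewrite V4 // d3 // Rk.
    have ne : [:: k'; nE] != [:: k; nE] by rewrite eqseq2 ltn_eqF.
    by have [_ Rt] := R2 k' k'k; rewrite V4 // d3.
  move=> m1 ag1 R1 X k kE; have [Rk Rt] := R1 _ (code_le X : code X < (2 ^ n).+1).
  have PE x y : P (code X) k x y <->
      is_true (if X is Some X then x \in X else false) /\ weak (A := A) x [:: lab S k] y.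
    have sE := step0 k x y kE; rewrite /P mem0.
    by split=> [/andP [xX /sE]|[-> /sE ->]].
  have [lt|eqk] := ltnP k nE.
    have [e eE _] := lab_event lt; rewrite -/dl Rk //.
    rewrite eE in PE *; case: X PE {Rk Rt} => [X|] PE /=; congr (code (Some _)).
      apply/setP => y; rewrite !inE; apply/existsP/asboolP => -[x].
        by move=> /PE; exists x.
      by move=> /PE Pxy; exists x.
    by apply/setP => y; rewrite !inE; apply/existsP => -[x /PE []].
  have {eqk} kE' : k = nE by apply/eqP; rewrite eqn_leq kE.
  rewrite kE' lab_term -/dl Rt in PE *; case: X PE {Rk Rt} => [X|] PE /=; last first.
    rewrite code_set0; case: existsP => // -[x /existsP [y]].
    by move=> /PE [].
  case: existsP => [[x /existsP [y /PE Pxy]]|no]; case: asboolP => //.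
  + by case; exists x, y.
  + by case=> x [y Pxy]; case: no; exists x; apply/existsP; exists y; apply/PE.
  by rewrite code_set0.
rewrite /=; bnd.
Qed.

Definition prepared (E : choiceType) (S : {fset E}) (A : fin_automaton S) u (m : memory) :=
  [/\ graph_is A u m, subset_codes (fstate A) u m, steps_are A u m & delta_is A u m].

Lemma prepare_correct : exists C, forall u (E : choiceType) (S : {fset E})
    (A : fin_automaton S) m,
  graph_is A u m -> (forall j, m ("mem" ++ u) j = 0) ->
  (forall j, m ("closure" ++ u) j = 0) -> (forall j, m ("step" ++ u) j = 0) ->
  triple m (prepare u)
    (C * ((size (enum_fset S)).+2 * ((2 ^ #|fstate A|).+2 * #|fstate A|.+1 ^ 4)))
    (prepared A u).
Proof.
have [C1 H1] := weak_steps_correct; have [C2 H2] := subsets_correct.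
have [C3 H3] := subset_construction_correct.
exists (C1 + (C2 + C3)) => u E S A m gm m0 c0 s0.
set n := #|fstate A|; set nE := size _.
apply: (triple_weaken _ _ (fun _ h => h)).
  apply: triple_seq; apply: triple_post (H1 u E S A m gm c0 s0) _ => m1 st1 ag1.
  apply: triple_seq.
  apply: triple_post (H2 u m1 n _ _) _; first by rewrite (ag1 ("n" ++ u) erefl); case: gm.
    by move=> j; rewrite (ag1 ("mem" ++ u) erefl).
  move=> m2 [N2 P2 B2 Z2] ag2.
  have st2 : steps_are A u m2.
    by rewrite /steps_are; ra.
  have sc2 : subset_codes (fstate A) u m2.
    split=> // [x|X x]; first by apply: P2.
    case: X => [X|]; first by rewrite B2 ?code_lt // bit_code.
    by rewrite Z2.
  have gr2 : graph_is A u m2.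
    by rewrite /graph_is; ra.
  apply: triple_post (H3 u E S A m2 gr2 sc2 st2) _ => m3 d3 ag3; split=> //.
  - by rewrite /graph_is; ra.
  - by rewrite /subset_codes (ag3 ("N" ++ u) erefl) (ag3 ("pow" ++ u) erefl) (ag3 ("mem" ++ u) erefl).
  by rewrite /steps_are (ag3 ("closure" ++ u) erefl) (ag3 ("step" ++ u) erefl).
rewrite -/n -/nE !mulnDl; apply: leq_add; [|apply: leq_add]; rewrite leq_mul2l; apply/orP; right.
- by rewrite !expnS expn0 leq_mul2l /= -{1}[n.+1 * _]mul1n leq_mul2r orbC ltnS.
- by rewrite mulnCA [X in _ <= X]mulnCA leq_mul // !expnS expn0 !muln1; nia.
rewrite mulnCA; apply: leq_mul; first exact: leqnSn.
by apply: leq_mul => //; rewrite muln1 mulnn; apply: leq_pexp2l.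
Qed.

(** * States of B with nonempty marked language *)

Definition lives_are (E : choiceType) (S : {fset E}) (B : fin_automaton S) (m : memory) :=
  forall x : fstate B, m "live" [:: ix x] != 0 <-> exists s, marks (A := B) x s.

Lemma live_states_correct : exists C, forall (E : choiceType) (S : {fset E})
    (B : fin_automaton S) m,
  graph_is B "B" m -> steps_are B "B" m -> (forall j, m "live" j = 0) ->
  triple m live_states
    (C * (#|fstate B|.+1 * ((size (enum_fset S)).+1 * (#|fstate B|.+1 * (#|fstate B|.+1 * 1)))))
    (lives_are B).
Proof.
eexists => E S B m [en enE _] [_ step0] l0.
set Q := fstate B in en step0 *; set n := #|Q| in en *; set nE := size _ in enE step0 *.
rewrite /= in en step0; rewrite /live_states /assign /Var.
pose Z j := exists x : Q, j = [:: ix x] /\ exists s, marks (A := B) x s.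
have ZE f (x : Q) : within Z f -> f [:: ix x] != 0 -> exists s, marks (A := B) x s.
  by move=> Zf /Zf [y [[/ord_inj/enum_rank_inj ->]]].
apply: (triple_weaken _ _ (fun _ h => h)).
  pose G2 (x y : Q) (f : seq nat -> nat) : Prop := weak (A := B) x [:: Term] y -> f [:: ix x] != 0.
  pose G1 x f := forall y, G2 x y f.
  apply: triple_seq.
  apply: triple_post (@triple_for_grow_fin Q "live" Z G1 _ _ _ _ m _ _ _ _ _ _ _) _ => //.
  - by move=> j; rewrite l0.
  - by rewrite /G1 /G2; up.
  - move=> x m1 ag1 x1 gr1 Z1; apply: (triple_for_grow_fin (G := G2 x)) => //.
    + by rewrite /=; rd.
    + by rewrite /G2; up.
    move=> y m2 ag2 y2 gr2 Z2; apply: triple_when_set => //=.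
      rd => /(step0 _ _ _ (leqnn _)); rewrite lab_term => xy; exists x; split=> //.
      by exists [::], y.
    move=> f; rd => fC xy; apply: fC; apply/(step0 _ _ _ (leqnn _)).
    by rewrite lab_term.
  move=> m1 [Z1 _ H1] ag1.
  (* Labels are forgotten: a marked trace becomes a path to a state with an omega step, which can be
     shortened to fewer edges than there are states. *)
  pose edge : rel Q := fun x y => `[< exists k, k < nE /\ weak (A := B) x [:: lab S k] y >].
  pose reach k (f : seq nat -> nat) := forall (x y : Q) s, size s <= k -> path edge x s ->
    weak (A := B) (last x s) [:: Term] y -> f [:: ix x] != 0.
  apply: (@triple_for (fun i m2 => within Z (m2 "live") /\ reach i (m2 "live")) _ _ n) => //.
  - by rewrite /=; rd.
  - by rewrite write_otherf //; split=> // x y [|//] _ _; apply: H1.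
  - move=> i m2 iN ag2 i2 [Z2 R2].
    pose K3 k (x y : Q) (f : seq nat -> nat) : Prop := k < nE -> weak (A := B) x [:: lab S k] y ->
      m2 "live" [:: ix y] != 0 -> f [:: ix x] != 0.
    pose K2 k x f := forall y, K3 k x y f.
    pose K1 k f := forall x, K2 k x f.
    apply: triple_post (@triple_for_grow "live" Z K1 _ _ nE _ _ m2 _ _ _ _ _ _ _) _ => //.
    + by rewrite /=; rd.
    + by rewrite /K1 /K2 /K3; up.
    + move=> k m3 kE ag3 k3 gr3 Z3; apply: (triple_for_grow_fin (G := K2 k)) => //.
      * by rewrite /=; rd.
      * by rewrite /K2 /K3; up.
      move=> x m4 ag4 x4 gr4 Z4; apply: (triple_for_grow_fin (G := K3 k x)) => //.
      * by rewrite /=; rd.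
      * by rewrite /K3; up.
      move=> y m5 ag5 y5 gr5 Z5; apply: triple_when_set => //=.
        rd => /andP [/(step0 _ _ _ (ltnW kE)) xy /(ZE _ _ Z5) [s ms]].
        have [e eE _] := lab_event kE; rewrite eE in xy.
        by exists x; split=> //; exists (e :: s); apply/marks_cons; exists y.
      move=> f; rd => fC _ /(step0 _ _ _ (ltnW kE)) xy ly; apply: fC.
      by rewrite xy; apply: gr5; apply: gr4; apply: gr3.
    move=> m3 [Z3 gr3 H3] ag3; rewrite write_otherf //; split=> // x y [|z s] /=.
      by move=> _ _ xy; apply: gr3; apply: (R2 x y [::]).
    rewrite ltnS => le /andP [/asboolP [k [kE xz]] zs] sy.
    by apply: (H3 k kE x z kE xz); apply: R2 le zs sy.
  move=> m2 ag2 [Z2 R2] x; split=> [/(ZE _ _ Z2)//|[s]].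
  have alph t (z : Q) : marks (A := B) z t -> exists y p, path edge z p /\ weak (A := B) (last z p) [:: Term] y.
    elim: t z => [|e t IH] z; first by case=> y zy; exists y, [::].
    case/marks_cons => w zw mw; have [y [p [wp py]]] := IH w mw.
    exists y, (w :: p); split=> //=; rewrite wp andbT; apply/asboolP.
    have eS : ev_in S (Ev e) by have := weak_alphabet zw; rewrite /= andbT.
    have [k kE ke] := lab_onto eS; exists k; rewrite ke; split=> //.
    rewrite ltn_neqAle kE andbT; apply/eqP => kn.
    by move: ke; rewrite kn lab_term.
  case/alph => y [p [/path_short [p' [pp' lp lt]] py]].
  by apply: (R2 x y p' (ltnW lt) pp'); rewrite lp.
rewrite /=; bnd.
Qed.

(** * Exploration of the pair graph *)

Section PairGraph.
Variables (E : choiceType) (S : {fset E}) (A B : fin_automaton S).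
Local Notation D := (det_pair A B).
Local Notation nE := (size (enum_fset S)).
Local Notation n := #|fstate B|.
Implicit Types (p q : D) (L : seq D) (x y : fstate B) (m : memory).

Definition env m := [/\ prepared A "A" m, prepared B "B" m & lives_are B m].

Definition env_names := [:: "nE"; "nA"; "nB"; "transA"; "transB"; "NA"; "NB"; "powA";
  "powB"; "memA"; "memB"; "closureA"; "closureB"; "stepA"; "stepB"; "deltaA"; "deltaB"; "live"].

(** The prepared tables are read-only later on; with concrete names the side condition is decided by
    computation. *)
Lemma env_agree l m m' : ~~ has (smem^~ l) env_names -> agree l m m' -> env m -> env m'.
Proof.
move=> no ag; have red a : smem a env_names -> m' a = m a.
  move=> am; apply: ag; apply/negbTE; apply: contra no; rewrite /smem.
  elim: env_names am => //= b s IH /orP [/String.eqb_eq ->|/IH h /h]; first by move=> ->.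
  by rewrite orbC => ->.
rewrite /env /prepared /graph_is /subset_codes /steps_are /delta_is /lives_are.
by repeat match goal with |- context [m' ?a] => rewrite (red a isT) end.
Qed.

Definition at_pair m (a : string) p : nat := m a [:: code p.1; code p.2].

Definition p0 : D := (None, None).

Definition nodes_are L m := [/\ uniq L, m "tail" [::] = size L,
  forall p, at_pair m "node" p = (p \in L) &
  forall i, i < size L -> m "nodeA" [:: i] = code (nth p0 L i).1 /\
    m "nodeB" [:: i] = code (nth p0 L i).2].

Lemma pair_code_eq p q :
  ([:: code p.1; code p.2] == [:: code q.1; code q.2]) = (p == q).
Proof.
by case: p q => [p1 p2] [q1 q2]; rewrite eqseq2 !(inj_eq (@code_inj _)) xpair_eqE.
Qed.

Lemma card_pairs : #|{: D}| = (2 ^ #|fstate A|).+1 * (2 ^ #|fstate B|).+1.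
Proof. by rewrite card_prod !card_det. Qed.

Lemma size_nodes L : uniq L -> size L <= #|{: D}|.
Proof. by move=> /card_uniqP <-; apply: max_card. Qed.

(** The arguments are expressions that are evaluated again after writes to [node] and [nodeA], hence
    the conditions that they avoid these arrays. *)
Lemma add_node_correct L m a b p :
  nodes_are L m -> eval m a = code p.1 -> eval m b = code p.2 ->
  avoids a [:: "node"; "nodeA"; "nodeB"] -> avoids b [:: "node"; "nodeA"; "nodeB"] ->
  triple m (add_node a b) (3 * (cost a + cost b) + 40)
    (nodes_are (if p \in L then L else rcons L p)).
Proof.
move=> [uL tL nL abL] ea eb fa fb; rewrite /add_node /assign /Var.
apply: (triple_weaken _ _ (fun _ h => h)).
  apply: triple_when => /=; rewrite ea eb -/(at_pair m "node" p) nL; case: ifP => //= pL _.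
  apply: triple_seq; apply: triple_assign; last exact: leqnn.
  rewrite /= ea eb; set m1 := write _ _ _ _.
  have ag1 : agree [:: "node"; "nodeA"; "nodeB"] m m1 by apply: agree_write.
  apply: triple_seq; apply: triple_assign; last exact: leqnn.
  rewrite (eval_agree ag1 fa) ea /=; set m2 := write _ _ _ _.
  have ag2 : agree [:: "node"; "nodeA"; "nodeB"] m m2 by apply: agree_write.
  apply: triple_seq; apply: triple_assign; last exact: leqnn.
  rewrite (eval_agree ag2 fb) eb /=; set m3 := write _ _ _ _.
  apply: triple_assign; last exact: leqnn.
  rewrite /=; have tE : m3 "tail" [::] = size L by rewrite /m3 /m2 /m1; wr.
  rewrite tE; split.
  - by rewrite rcons_uniq pL.
  - by wr; rewrite size_rcons addn1.
  - move=> q; rewrite /at_pair; wr; rewrite /m3 /m2 /m1; wr.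
    rewrite pair_code_eq mem_rcons inE [q == p]eq_sym; case: eqP => // _.
    exact: nL.
  move=> i; rewrite size_rcons ltnS leq_eqVlt nth_rcons; wr; rewrite /m3 /m2 /m1; wr.
  rewrite !eqseq_cons !andbT; have -> : m "tail" [::] = size L by [].
  wr; case: (eqVneq i (size L)) => [->|ne] /= lt; first by rewrite ltnn.
  by rewrite lt; apply: abL.
rewrite /=; lia.
Qed.

(** The main iteration reuses the tables of the certain conflicts. Old predecessor entries may stay,
    since the counters [cnt] delimit the lists. *)
Lemma reset_correct m : env m ->
  triple m reset ((2 ^ #|fstate A|).+2 * ((2 ^ #|fstate B|).+2 * 60))
    (fun m' => [/\ nodes_are [::] m', forall p, at_pair m' "cnt" p = 0 &
                   forall p, at_pair m' "lc" p = 0]).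
Proof.
move=> [[_ [NA _ _] _ _] [_ [NB _ _] _ _] _]; rewrite /= in NA NB.
pose Z (P : D -> bool) m' := m' "tail" [::] = 0 /\
  forall p, P p -> [/\ at_pair m' "node" p = 0, at_pair m' "cnt" p = 0 & at_pair m' "lc" p = 0].
rewrite /reset /assign /Var; apply: (triple_weaken _ _ (fun _ h => h)).
  apply: triple_seq; apply: triple_assign; last exact: leqnn.
  set m0 := write _ _ _ _.
  apply: (triple_for (N := (2 ^ #|fstate A|).+1) (I := fun k => Z (fun p => code p.1 < k))) => //.
  - by rewrite /= /m0; wr; rewrite NA addn1.
  - move=> k m1 kN ag1 k1 Z1.
    apply: (triple_for (N := (2 ^ #|fstate B|).+1)
      (I := fun j => Z (fun p => (code p.1 < k) || ((code p.1 == k) && (code p.2 < j))))) => //.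
    + by rewrite /=; rd; rewrite /m0; wr; rewrite NB addn1.
    + case: Z1 => t1 Z1; split; first by wr.
      by move=> p; rewrite andbF orbF => /Z1; rewrite /at_pair; wr.
    + move=> j m2 jN ag2 j2 [t2 Z2].
      have k2 : m2 "XA" [::] = k by rewrite (ag2 "XA" erefl).
      do 2!(apply: triple_seq; apply: triple_assign; last exact: leqnn).
      apply: triple_assign; last exact: leqnn.
      rewrite /=; wr; rewrite j2 k2; split; first by wr.
      move=> p; rewrite ltnS [code p.2 <= j]leq_eqVlt andb_orr orbCA => h.
      rewrite /at_pair; wr; rewrite !eqseq2 [k == _]eq_sym [j == _]eq_sym.
      by case: (_ && _) h => //= /Z2.
    move=> m2 ag2 [t2 Z2]; split; first by wr.
    move=> p; rewrite ltnS leq_eqVlt orbC => h; rewrite /at_pair; wr; apply: Z2.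
    by move: h; rewrite ltnS code_le andbT.
  move=> m1 ag1 [t1 Z1]; have Z1' p := Z1 p (code_le p.1 : code p.1 < _.+1).
  by split=> [|p|p]; [split=> // p; rewrite in_nil; case: (Z1' p)|case: (Z1' p)|case: (Z1' p)].
rewrite /=; nia.
Qed.

Definition arrow := (D * nat)%type.
Definition dst (a : arrow) : D := delta2 a.1 [:: lab S a.2].
Definition arrows_from p k : seq arrow := [seq (p, e) | e <- iota 0 k].
Local Arguments arrows_from : simpl never.

Lemma arrows_fromS p k : arrows_from p k.+1 = rcons (arrows_from p k) (p, k).
Proof. by rewrite /arrows_from -addn1 iotaD map_cat cats1. Qed.

Definition arrows L : seq arrow :=
  flatten [seq arrows_from p nE.+1 | p <- L].
Definition preds_of (s : seq arrow) q := filter (fun a => dst a == q) s.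

Definition preds_are (s : seq arrow) m := forall q, let P := preds_of s q in
  at_pair m "cnt" q = size P /\ forall k, k < size P ->
  [/\ m "predA" [:: code q.1; code q.2; k] = code (nth (p0, 0) P k).1.1,
      m "predB" [:: code q.1; code q.2; k] = code (nth (p0, 0) P k).1.2 &
      m "predE" [:: code q.1; code q.2; k] = (nth (p0, 0) P k).2].

Lemma size_arrows L : size (arrows L) = size L * nE.+1.
Proof.
rewrite /arrows size_flatten /shape -map_comp.
by elim: L => //= p L ->; rewrite size_map size_iota mulSn.
Qed.

Lemma mem_arrows L a : (a \in arrows L) = (a.1 \in L) && (a.2 <= nE).
Proof.
apply/flatten_mapP/andP => [[p pL /mapP [e]]|[aL ae]].
  by rewrite mem_iota => /andP [_ h] -> /=; rewrite pL.
exists a.1 => //; apply/mapP; exists a.2; last by case: a {aL ae}.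
by rewrite mem_iota.
Qed.

Lemma delta_pair m p e : env m -> e <= nE ->
  m "deltaA" [:: code p.1; e] = code (dst (p, e)).1 /\
  m "deltaB" [:: code p.2; e] = code (dst (p, e)).2.
Proof. by move=> [[_ _ _ dA] [_ _ _ dB] _] eE; split; [apply: dA|apply: dB]. Qed.

(** A pair enters the node list once and is expanded once, so the number of all pairs minus [head]
    measures the remaining work. The lists hold the arrows of exactly the expanded nodes. *)
Lemma explore_correct L m : env m -> nodes_are L m -> (forall p, at_pair m "cnt" p = 0) ->
  triple m explore (#|{: D}| * (nE.+2 * 400) + 20)
    (fun m' => exists L', [/\ nodes_are L' m', {subset L <= L'},
       closed_pairs (mem L') & preds_are (arrows L') m']).
Proof.
move=> envm nL c0; rewrite /explore /assign /Var.
pose w := nE.+2 * 400.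
pose inv f m' := exists L' h, [/\ m' "head" [::] = h /\ h <= size L',
  agree (mods explore) m m', nodes_are L' m', {subset L <= L'} &
  [/\ preds_are (arrows (take h L')) m',
   forall p e, p \in take h L' -> e <= nE -> dst (p, e) \in L' &
   f = (#|{: D}| - h) * w]].
apply: (triple_weaken _ _ (fun _ h => h)).
  apply: triple_seq; apply: triple_assign; last exact: leqnn.
  apply: (triple_while (I := inv) (f := #|{: D}| * w)).
  - exists L, 0; rewrite take0 subn0; split=> //.
      by apply: agree_write.
    by split=> // q; split=> //; apply: c0.
  - move=> f m1 /= ne [L1 [h [[h1 hL] ag1 nL1 sub1 [pr1 cl1 ->]]]].
    have [uL1 t1 nd1 ab1] := nL1.
    rewrite h1 t1 in ne; have {ne hL} hL : h < size L1 by case: ltnP ne.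
    have [hA hB] := ab1 h hL; set p := nth p0 L1 h in hA hB.
    have env1 : env m1 by apply: env_agree envm; last exact: ag1.
    exists (nE.+2 * 390) => //.
    apply: (triple_weaken (Q := fun m2 => exists2 f2, inv f2 m2 & f2 = (#|{: D}| - h.+1) * w)).
    + apply: triple_seq; apply: triple_assign; last exact: leqnn.
      apply: triple_seq; apply: triple_assign; last exact: leqnn.
      apply: triple_seq; apply: triple_assign; last exact: leqnn.
      rewrite /=; wr; rewrite h1 hA hB; set m2 := write _ _ _ _.
      have ag2 : agree [:: "XA"; "XB"; "head"] m1 m2 by do 3!apply: agree_write => //.
      have env2 : env m2 by apply: env_agree env1; last exact: ag2.
      (* New nodes are only appended, so the expanded prefix of [L1] stays in place while its
         extension [L2] grows. *)
      apply: (triple_for (N := nE.+1) (I := fun e m' => exists L2 : seq D, [/\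
          nodes_are (L1 ++ L2)%SEQ m', env m', m' "head" [::] = h.+1 /\ m' "XA" [::] = code p.1 /\ m' "XB" [::] = code p.2,
          preds_are (arrows (take h L1) ++ arrows_from p e)%SEQ m' &
          forall e', e' < e -> dst (p, e') \in (L1 ++ L2)%SEQ])) => //.
      * by case: env2 => [[[_ ? _] _ _ _] _ _]; rewrite /= addn1; congr _.+1.
      * exists [::]; rewrite !cats0; split=> //.
        by wr; rewrite /m2; wr; rewrite addn1.
      * move=> e m3 eE ag3 e3 [L2 [nL2 env3 [h3 [A3 B3]] pr3 cl3]].
        have [dA dB] := delta_pair p env3 (eE : e <= nE); have [q qE] : {q | q = dst (p, e)} by exists (dst (p, e)).
        rewrite -qE in dA dB.
        do 2!(apply: triple_seq; apply: triple_assign; last exact: leqnn).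
        rewrite /=; wr; rewrite e3 A3 B3 dA dB.
        apply: triple_seq; apply: triple_assign; last exact: leqnn.
        rewrite /=; wr; have [cnt3 ent3] := pr3 q; rewrite -/(at_pair m3 "cnt" q) cnt3.
        set P := preds_of _ q in cnt3 ent3 *.
        do 4!(apply: triple_seq; apply: triple_assign; last exact: leqnn).
        rewrite /=; wr; rewrite A3 B3 e3; set m4 := write _ _ _ _.
        have nL4 : nodes_are (L1 ++ L2)%SEQ m4 by rewrite /nodes_are /at_pair /m4; wr.
        apply: triple_post (add_node_correct (p := q) nL4 _ _ _ _) _ => //.
        move=> m5 nL5 ag5; pose q' := if q \in (L1 ++ L2)%SEQ then [::] else [:: q].
        have L5E : (if q \in (L1 ++ L2)%SEQ then (L1 ++ L2)%SEQ else rcons (L1 ++ L2)%SEQ q) = (L1 ++ (L2 ++ q'))%SEQ.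
          by rewrite /q'; case: ifP => _; rewrite ?cats0 // -cats1 catA.
        rewrite L5E in nL5; exists (L2 ++ q')%SEQ.
        have env4 : env m4.
          by apply: (env_agree (l := mods explore)) env3 => //; do 7!apply: agree_write => //.
        split.
        -- by rewrite /nodes_are /at_pair; wr.
        -- apply: (env_agree (l := "e" :: mods (add_node "YA" "YB"))) env4 => //.
           by apply: agree_write => //; apply: agree_incl ag5.
        -- by wr; ra; rewrite /m4; wr.
        -- move=> q2; rewrite /preds_of arrows_fromS -rcons_cat filter_rcons.
           rewrite -/(preds_of _ q2) -qE /at_pair; wr.
           rewrite (ag5 "cnt" erefl) (ag5 "predA" erefl) (ag5 "predB" erefl) (ag5 "predE" erefl).
           have [cnt2 ent2] := pr3 q2; rewrite -/(at_pair m3 "cnt" q2) in cnt2.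
           case: (eqVneq q q2) => [qq|ne].
             rewrite -qq -/P size_rcons; split.
               by rewrite /m4; wr; rewrite addn1.
             move=> k; rewrite ltnS leq_eqVlt nth_rcons /m4; wr.
             rewrite !eqseq3 !eqxx /= eq_sym; case: eqVneq => [->|nk] /= lt.
               by rewrite ltnn.
             by rewrite lt; apply: ent3.
           split; first by rewrite /m4; wr; rewrite pair_code_eq (negbTE ne).
           move=> k kP; rewrite /m4; wr.
           have nE3 j : ([:: code q.1; code q.2; j] == [:: code q2.1; code q2.2; k]) = false.
             by rewrite eqseq3 andbA -eqseq2 pair_code_eq (negbTE ne).
           by rewrite !nE3; apply: ent2.
        move=> e'; rewrite ltnS leq_eqVlt catA mem_cat => /orP [/eqP ->|/cl3 -> //].
        by rewrite -qE /q'; case: ifP => // _; rewrite inE eqxx orbT.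
      move=> m3 ag3 [L2 [nL2 env3 [h3 _] pr3 cl3]].
      have tk : take h.+1 (L1 ++ L2)%SEQ = rcons (take h L1) p.
        by rewrite takel_cat // (take_nth p0).
      exists ((#|{: D}| - h.+1) * w) => //; exists (L1 ++ L2)%SEQ, h.+1; split=> //.
      * by rewrite size_cat (leq_trans hL) ?leq_addr.
      * apply: agree_trans ag1 (agree_trans (agree_incl _ ag2) (agree_incl _ ag3)) => //.
      * by move=> q /sub1; rewrite mem_cat => ->.
      rewrite tk; split=> //.
        by rewrite /arrows map_rcons flatten_rcons.
      move=> q e; rewrite mem_rcons inE => /orP [/eqP -> eE|qt eE]; first exact: cl3.
      by rewrite mem_cat cl1.
    + rewrite /=; lia.
    + move=> m2 [f2 I2 f2E]; rewrite f2E in I2; exists ((#|{: D}| - h.+1) * w) => //.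
      have hD : h < #|{: D}| by rewrite (leq_trans hL) // size_nodes.
      by rewrite -(subnSK hD) /w mulSn; lia.
  move=> f m1 /= ne [L1 [h [[h1 hL] ag1 nL1 sub1 [pr1 cl1 _]]]].
  have [uL1 t1 nd1 ab1] := nL1.
  rewrite h1 t1 in ne; have hE : h = size L1.
    by apply/eqP; rewrite eqn_leq hL leqNgt; move: ne; case: (h < size L1).
  rewrite hE take_size in pr1 cl1; exists L1; split=> // p v pL vS.
  by have [k kE <-] := lab_onto vS; apply: (cl1 p k).
rewrite /=; rewrite /w; lia.
Qed.

End PairGraph.

(** * The nested iteration *)

Section MoreConflicting.
Variables (E : choiceType) (S : {fset E}) (A B : fin_automaton S).
Local Notation D := (det_pair A B).
Local Notation nE := (size (enum_fset S)).
Local Notation n := #|fstate B|.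
Local Notation p0 := (p0 A B).
Implicit Types (p q : D) (L : seq D) (x y : fstate B) (m : memory).
Definition triple_type := (D * fstate B)%type.
Definition mc_at m (t : triple_type) : nat :=
  m "mc" [:: code t.1.1; code t.1.2; ix t.2].

(** The table [mc] is described only at pairs of [L], because a round clears it only there. *)
Definition queue_are L (s : seq triple_type) m := [/\ uniq s, m "qtail" [::] = size s,
  forall t, t.1 \in L -> mc_at m t = (t \in s) &
  forall i t, i < size s -> nth t s i = t ->
    [/\ m "queueA" [:: i] = code t.1.1, m "queueB" [:: i] = code t.1.2 &
        m "queuex" [:: i] = ix t.2]].

Lemma triple_code_eq (t t' : triple_type) :
  ([:: code t.1.1; code t.1.2; ix t.2] == [:: code t'.1.1; code t'.1.2; ix t'.2]) = (t == t').
Proof.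
case: t t' => [[p1 p2] x] [[q1 q2] y]; rewrite eqseq3 !(inj_eq (@code_inj _)) !xpair_eqE andbA.
by rewrite /= (inj_eq (@ord_inj _)) (inj_eq enum_rank_inj).
Qed.

Lemma add_triple_correct L s m a b (x : expr) (t : triple_type) :
  queue_are L s m -> t \notin s -> eval m a = code t.1.1 -> eval m b = code t.1.2 ->
  eval m x = ix t.2 -> avoids a [:: "mc"; "queueA"; "queueB"] ->
  avoids b [:: "mc"; "queueA"; "queueB"] -> avoids x [:: "mc"; "queueA"; "queueB"] ->
  triple m (add_triple a b x) (3 * (cost a + cost b + cost x) + 40) (queue_are L (rcons s t)).
Proof.
move=> [us ts ms abs] ns ea eb ex fa fb fx; rewrite /add_triple /assign /Var.
apply: (triple_weaken _ _ (fun _ h => h)).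
  apply: triple_seq; apply: triple_assign; last exact: leqnn.
  rewrite /= ea eb ex; set m1 := write _ _ _ _.
  have ag1 : agree [:: "mc"; "queueA"; "queueB"] m m1 by apply: agree_write.
  apply: triple_seq; apply: triple_assign; last exact: leqnn.
  rewrite (eval_agree ag1 fa) ea /=; set m2 := write _ _ _ _.
  have ag2 : agree [:: "mc"; "queueA"; "queueB"] m m2 by apply: agree_write.
  apply: triple_seq; apply: triple_assign; last exact: leqnn.
  rewrite (eval_agree ag2 fb) eb /=; set m3 := write _ _ _ _.
  have ag3 : agree [:: "mc"; "queueA"; "queueB"; "queuex"] m m3.
    by apply: agree_write => //; apply: agree_incl ag2.
  have ag3' : agree [:: "mc"; "queueA"; "queueB"] m m3 by apply: agree_write.
  apply: triple_seq; apply: triple_assign; last exact: leqnn.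
  rewrite (eval_agree ag3' fx) ex /=; set m4 := write _ _ _ _.
  apply: triple_assign; last exact: leqnn.
  have tE : m4 "qtail" [::] = size s by rewrite /m4 /m3 /m2 /m1; wr.
  rewrite /= tE; split.
  - by rewrite rcons_uniq ns.
  - by wr; rewrite size_rcons addn1.
  - move=> t' tL; rewrite /mc_at; wr; rewrite /m4 /m3 /m2 /m1; wr.
    rewrite triple_code_eq mem_rcons inE [t' == t]eq_sym; case: eqP => // _.
    exact: ms.
  move=> i t'; rewrite size_rcons ltnS leq_eqVlt nth_rcons; wr; rewrite /m4 /m3 /m2 /m1; wr.
  rewrite !eqseq_cons !andbT ts; case: (eqVneq i (size s)) => [->|ne] /= lt.
    by rewrite ltnn => <-.
  by rewrite lt; apply: abs.
rewrite /=; lia.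
Qed.

Definition arrow_into (bad : D -> Prop) (t : triple_type) (a : arrow A B) x : Prop :=
  exists X, [/\ dst a = t.1, ~ bad a.1, a.1.2 = Some X, x \in X &
    weak (A := B) x [:: lab S a.2] t.2].

Definition mc_cost (t : triple_type) L := 200 + (size (preds_of (arrows L) t.1)).+1 * (n.+1 * 200).

(** The indegrees add up to the number of arrows of the pair graph. Each arrow is traversed once for
    every state at its target and then tries every state at its source, whence the square of the
    number of states of B. *)
Lemma sum_mc_cost L : uniq L ->
  \sum_(t : triple_type) mc_cost t L <= #|{: D}| * (nE.+2 * (n.+1 * (n.+1 * 600))).
Proof.
move=> uL.
have -> : \sum_(t : triple_type) mc_cost t L =
    \sum_(p : D) \sum_(x : fstate B) mc_cost (p, x) L.
  by rewrite pair_big /=; apply: eq_bigr => -[].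
have -> : \sum_(p : D) \sum_(x : fstate B) mc_cost (p, x) L =
    n * (#|{: D}| * (200 + n.+1 * 200) + (\sum_(p : D) size (preds_of (arrows L) p)) * (n.+1 * 200)).
  transitivity (\sum_(p : D) n * (200 + n.+1 * 200 + size (preds_of (arrows L) p) * (n.+1 * 200))).
    by apply: eq_bigr => p _; rewrite /mc_cost /= sum_nat_const mulSn addnA.
  by rewrite -big_distrr /= big_split /= sum_nat_const big_distrl.
have -> : \sum_(p : D) size (preds_of (arrows L) p) = size (arrows L).
  elim: (arrows L) => [|a s IH]; first by rewrite big1.
  (* Each arrow counts for exactly one target. *)
  rewrite /= -IH -add1n; have -> : 1 = \sum_(p : D) (dst a == p).
    rewrite (bigD1 (dst a)) //= eqxx big1 ?addn0 // => p /negbTE.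
    by rewrite eq_sym => ->.
  by rewrite -big_split /=; apply: eq_bigr => p _; case: ifP.
have := size_nodes uL; rewrite size_arrows; set M := #|{: D}|; set l := size L => lM.
apply: (@leq_trans (n * (M * (200 + n.+1 * 200) + M * nE.+1 * (n.+1 * 200)))).
  by rewrite leq_mul2l leq_add2l leq_mul2r leq_mul2r lM !orbT.
nia.
Qed.

Lemma bool_eq0 (b : bool) : (b : nat) = 0 -> ~~ b.
Proof. by case: b. Qed.

(** The level is abstracted to a predicate [bad], of which only agreement with [lc] on the explored
    pairs is known. *)
Lemma more_conflicting_correct (bad : D -> Prop) L m : env A B m -> nodes_are L m ->
  closed_pairs (mem L) -> preds_are (arrows L) m ->
  (forall p, p \in L -> at_pair m "lc" p = 0 <-> ~ bad p) ->
  triple m more_conflicting (#|{: D}| * (nE.+2 * (n.+1 * (n.+1 * 800))) + 1000 * n.+1)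
    (fun m' => forall t, t.1 \in L -> mc_at m' t = `[< more bad t.1 t.2 >]).
Proof.
move=> envm nL clL prL lcL; rewrite /more_conflicting /assign /Var.
have [uL tL ndL abL] := nL.
have [[_ nBm _] [NBm _ memBm] [_ stepBm] _] : prepared B "B" m by case: envm.
have nB : m "nB" [::] = n by case: envm => _ [[]].
pose pe : D := (Some set0, None).
pose keep m' := agree (mods more_conflicting) m m'.
pose sound (s : seq triple_type) := forall t, t \in s -> t.1 \in L /\ more bad t.1 t.2.
(* The potential charges all triples not yet dequeued, whether queued or not. So adding to the queue
   leaves it unchanged, and dequeuing [t] releases [mc_cost t L]. *)
pose rest (s : seq triple_type) h := \sum_(t | t \notin take h s) mc_cost t L.
pose inv f m' := exists s h, [/\ keep m', m' "qhead" [::] = h /\ h <= size s,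
  queue_are L s m', sound s & [/\ forall x, pe \in L -> (pe, x) \in s,
  forall t a x, t \in take h s -> a \in arrows L -> arrow_into bad t a x -> (a.1, x) \in s &
  f = rest s h]].
have step (s : seq triple_type) h t : uniq s -> h < size s -> (forall u, nth u s h = t) ->
    rest s h = mc_cost t L + rest s h.+1.
  move=> us hs nt; rewrite /rest (bigD1 t) /=; last first.
    have := us; rewrite -{1}(cat_take_drop h s) (drop_nth t hs) nt cat_uniq.
    by case/and3P => _ /hasPn/(_ t); rewrite inE eqxx => /(_ isT).
  congr (_ + _); apply: eq_bigl => u; rewrite (take_nth t hs) nt mem_rcons inE negb_or andbC.
  by [].
have costB : \sum_(t : triple_type) mc_cost t L <= #|{: D}| * (nE.+2 * (n.+1 * (n.+1 * 600))).
  exact: sum_mc_cost.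
apply: (triple_weaken _ _ (fun _ h => h)).
  apply: triple_seq.
  apply: (triple_for_le (N := size L) (M := #|{: D}|) (I := fun k m' =>
    forall i x, i < k -> mc_at m' (nth p0 L i, x) = 0)); first exact: size_nodes.
  - by [].
  - by [].
  - by [].
  - by [].
  - move=> k m1 kL ag1 k1 Z1.
    apply: (triple_for_fin (Q := fstate B) (I := fun j m' =>
      (forall i x, i < k -> mc_at m' (nth p0 L i, x) = 0) /\
      forall x, ix x < j -> mc_at m' (nth p0 L k, x) = 0)).
    + by [].
    + by [].
    + by rewrite /= (ag1 "nB" erefl).
    + by split=> // i x ik; rewrite /mc_at; wr; apply: Z1.
    + move=> x m2 ag2 x2 [Z2 X2]; apply: triple_assign; last exact: leqnn.
      have h2 : m2 "h" [::] = k by rewrite (ag2 "h" erefl).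
      have [a2 b2] : m2 "nodeA" [:: k] = code (nth p0 L k).1 /\ m2 "nodeB" [:: k] = code (nth p0 L k).2.
        by rewrite (ag2 "nodeA" erefl) (ag2 "nodeB" erefl) (ag1 "nodeA" erefl) (ag1 "nodeB" erefl); apply: abL.
      rewrite /= h2 a2 b2 x2; split=> [i y ik|y]; rewrite /mc_at; wr.
        by case: ifP => // _; apply: Z2.
      rewrite (triple_code_eq (nth p0 L k, x) (nth p0 L k, y)) ix_ltS xpair_eqE eqxx /= eq_sym.
      by case: eqP => //= _; rewrite orbF => /X2.
    move=> m2 ag2 [Z2 X2] i x; rewrite ltnS leq_eqVlt => /orP [/eqP ->|ik]; rewrite /mc_at; wr.
      by apply: X2; apply: ltn_ord.
    exact: Z2.
  move=> m1 ag1 Z1.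
  apply: triple_seq; apply: triple_assign; last exact: leqnn.
  apply: triple_seq; apply: triple_assign; last exact: leqnn.
  rewrite /=; set m2 := write _ _ _ _.
  have k2 : keep m2 by do 2!apply: agree_write => //; apply: agree_incl ag1.
  have q2 : queue_are L [::] m2.
    split=> // t /(nthP p0) [i iL tE].
    by rewrite /m2 /mc_at; wr; rewrite -tE in_nil; have := Z1 i t.2 iL; rewrite /mc_at /= tE.
  have h2 : m2 "qhead" [::] = 0 by rewrite /m2; wr.
  apply: triple_seq; pose start m' := [/\ keep m', m' "qhead" [::] = 0 & exists s,
    [/\ queue_are L s m', forall t, t \in s -> t.1 = pe /\ pe \in L & forall x, pe \in L -> (pe, x) \in s]].
  apply: (triple_post (Q := start)).
    (* The empty set has code 0 and omega the code held in [NB]; the search has seeds only if this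
       pair was explored. *)
    have ndpe : m2 "node" [:: 0; m2 "NB" [::]] = (pe \in L).
      by rewrite !k2 // NBm -ndL /at_pair /= code_set0.
    apply: triple_when => /=; rewrite ndpe; last first.
      move=> /eqP; rewrite eqb0 => peL; split=> //; exists [::]; split=> // x.
      by rewrite (negbTE peL).
    rewrite bool_neq0 => peL.
    apply: (triple_for_fin (Q := fstate B) (I := fun j m' => exists s, queue_are L s m' /\
      forall t, (t \in s) = (t.1 == pe) && (ix t.2 < j))).
    + by [].
    + by [].
    + by rewrite /= k2.
    + exists [::]; split=> [|t]; last by rewrite ltn0 andbF.
      by case: q2 => qa qb qc qd; split=> //; rewrite /mc_at; wr.
    + move=> x m3 ag3 x3 [s [qs ms]].
      apply: triple_post (add_triple_correct (t := (pe, x)) qs _ _ _ _ _ _ _) _ => //=.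
      * by rewrite ms /= ltnn andbF.
      * by rewrite code_set0.
      * by rewrite (ag3 "NB" erefl) k2.
      move=> m4 qs4 _; exists (rcons s (pe, x)); split.
        by case: qs4 => qa qb qc qd; split=> //; rewrite /mc_at; wr.
      move=> t; rewrite mem_rcons inE ms ix_ltS {1}[t]surjective_pairing xpair_eqE.
      by case: (t.1 == pe); rewrite //= orbC.
    move=> m3 ag3 [s [qs ms]]; split.
    + by apply: agree_trans k2 (agree_incl _ ag3).
    + by rewrite (ag3 "qhead" erefl).
    exists s; split=> // [t|x _]; rewrite ms.
      by case/andP => /eqP ->.
    by rewrite eqxx; apply: ltn_ord.
  move=> m9 [k9 h9 [s1 [q1 e1 b1]]] _.
  apply: (triple_while (I := inv) (f := \sum_(t : triple_type) mc_cost t L)).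
  - exists s1, 0; split=> //; first by move=> t /e1 [-> peL]; split=> //; apply: MoreEnd.
    split=> //; first by move=> t a x; rewrite take0.
    by rewrite /rest take0; apply: eq_bigl => t; rewrite in_nil.
  - move=> f m3 /= ne [s [h [k3 [h3 hs] q3 so3 [pe3 cl3 ->]]]].
    have [us3 t3 mc3 ab3] := q3.
    rewrite h3 t3 in ne; have {ne hs} hs : h < size s by case: (h < size s) ne.
    have [t tE] : exists t, forall u, nth u s h = t.
      by case: (s) hs => // u s' hs; exists (nth u (u :: s') h) => v; apply: set_nth_default.
    have [tA tB tx] := ab3 h t hs (tE t).
    have tL' : t.1 \in L by have := mem_nth t hs; rewrite tE => /so3 [].
    rewrite (step s h t us3 hs tE); set P := preds_of (arrows L) t.1.
    have memP a : (a \in P) = (dst a == t.1) && (a \in arrows L) by rewrite mem_filter.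
    exists (190 + (size P).+1 * (n.+1 * 200)) => //.
    apply: (triple_weaken (Q := fun m' => inv (rest s h.+1) m' \/ exists s2, inv (rest (s ++ s2)%SEQ h.+1) m')).
    + do 4!(apply: triple_seq; apply: triple_assign; last exact: leqnn).
      rewrite /=; wr; rewrite h3 tA tB tx addn1; set m4 := write _ _ _ _.
      have ag4 : agree [:: "YA"; "YB"; "y"; "qhead"] m3 m4 by do 4!apply: agree_write => //.
      have k4 : keep m4 by apply: agree_trans k3 (agree_incl _ ag4).
      have [YA4 YB4 y4] : [/\ m4 "YA" [::] = code t.1.1, m4 "YB" [::] = code t.1.2 & m4 "y" [::] = ix t.2].
        by rewrite /m4; wr.
      have [cntP entP] := prL t.1; rewrite -/P in cntP entP.
      pose J (s2 : seq triple_type) m' := queue_are L (s ++ s2)%SEQ m' /\ sound (s ++ s2)%SEQ.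
      apply: (triple_for (N := size P) (I := fun k m' => exists s2, J s2 m' /\
        forall a x, a \in take k P -> arrow_into bad t a x -> (a.1, x) \in (s ++ s2)%SEQ)).
      * by [].
      * by [].
      * by rewrite /= YA4 YB4 k4.
      * exists [::]; rewrite /J cats0 take0; split=> //; split=> //.
      * move=> k m5 kP ag5 k5 [s2 [[q5 so5] c5]].
        have [aA aB aE] := entP k kP; set a := nth (p0, 0) P k in aA aB aE.
        have aP : a \in P by apply: mem_nth.
        have [/eqP da aarr] : dst a == t.1 /\ a \in arrows L by apply/andP; rewrite -memP.
        have [aL aE'] : a.1 \in L /\ a.2 <= nE by apply/andP; rewrite -mem_arrows.
        have k5' : keep m5 by apply: agree_trans k4 (agree_incl _ ag5).
        have [YA5 YB5 y5] : [/\ m5 "YA" [::] = code t.1.1, m5 "YB" [::] = code t.1.2 & m5 "y" [::] = ix t.2].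
          by rewrite (ag5 "YA" erefl) (ag5 "YB" erefl) (ag5 "y" erefl).
        do 3!(apply: triple_seq; apply: triple_assign; last exact: leqnn).
        rewrite /=; wr; rewrite k5 YA5 YB5 (k5' "predA" erefl) (k5' "predB" erefl) (k5' "predE" erefl) aA aB aE; set m6 := write _ _ _ _.
        have ag6 : agree [:: "XA"; "XB"; "e"] m5 m6 by do 3!apply: agree_write => //.
        have k6 : keep m6 by apply: agree_trans k5' (agree_incl _ ag6).
        have [XA6 XB6 e6] : [/\ m6 "XA" [::] = code a.1.1, m6 "XB" [::] = code a.1.2 & m6 "e" [::] = a.2].
          by rewrite /m6; wr.
        have y6 : m6 "y" [::] = ix t.2 by rewrite /m6; wr.
        have q6 : queue_are L (s ++ s2)%SEQ m6 by rewrite /queue_are /mc_at /m6; wr.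
        have lc6 : m6 "lc" [:: code a.1.1; code a.1.2] = 0 <-> ~ bad a.1 by rewrite k6 //; apply: lcL.
        have takeS (s3 : seq triple_type) : (forall a x, a \in take k P -> arrow_into bad t a x -> (a.1, x) \in s3) ->
            (forall x, arrow_into bad t a x -> (a.1, x) \in s3) ->
            forall a x, a \in take k.+1 P -> arrow_into bad t a x -> (a.1, x) \in s3.
          move=> h1' h2' a' x; rewrite (take_nth (p0, 0) kP) mem_rcons inE -/a.
          by case/orP => [/eqP -> /h2' //|inP ax]; apply: h1'.
        apply: triple_when => /=; rewrite XA6 XB6.
          rewrite bool_neq0 => /eqP /lc6 nbad.
          apply: (triple_for_fin (Q := fstate B) (I := fun j m' => exists s3, [/\ J s3 m',
            forall a x, a \in take k P -> arrow_into bad t a x -> (a.1, x) \in (s ++ s3)%SEQ &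
            forall x, ix x < j -> arrow_into bad t a x -> (a.1, x) \in (s ++ s3)%SEQ])).
          -- by [].
          -- by [].
          -- by rewrite /= k6.
          -- by exists s2; split=> //; split=> //; rewrite /queue_are /mc_at; wr.
          -- move=> x m7 ag7 x7 [s3 [[q7 so7] c7 x7c]].
             have [us7 t7 mc7 ab7] := q7.
             have [XA7 XB7 e7 y7] : [/\ m7 "XA" [::] = code a.1.1, m7 "XB" [::] = code a.1.2, m7 "e" [::] = a.2 & m7 "y" [::] = ix t.2].
               by rewrite (ag7 "XA" erefl) (ag7 "XB" erefl) (ag7 "e" erefl) (ag7 "y" erefl).
             have mem7 : (m7 "memB" [:: code a.1.2; ix x] != 0) = (if a.1.2 is Some X then x \in X else false).
               by rewrite (ag7 "memB" erefl) k6 //; apply: memBm.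
             have step7 : m7 "stepB" [:: a.2; ix x; ix t.2] != 0 <-> weak (A := B) x [:: lab S a.2] t.2.
               by rewrite (ag7 "stepB" erefl) k6 //; apply: stepBm.
             have mcx : m7 "mc" [:: code a.1.1; code a.1.2; ix x] = ((a.1, x) \in (s ++ s3)%SEQ).
               exact: (mc7 (a.1, x)).
             have into : arrow_into bad t a x <-> (m7 "memB" [:: code a.1.2; ix x] != 0) && (m7 "stepB" [:: a.2; ix x; ix t.2] != 0).
               split=> [[X [_ _ aX xX xt]]|/andP []].
                 by rewrite mem7 aX xX; apply/step7.
               by rewrite mem7; case aX: a.1.2 => [X|] // xX /step7; exists X.
             apply: triple_when => /=; rewrite XA7 XB7 e7 y7 x7 mcx.
               rewrite !bool_neq0 eqb0 => /andP [/into xin nin].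
               apply: triple_post (add_triple_correct (t := (a.1, x)) q7 nin _ _ _ _ _ _) _ => //.
               move=> m8 q8 _; exists (rcons s3 (a.1, x)); rewrite /J -rcons_cat.
               split; [split| |].
               ++ by case: q8 => qa qb qc qd; split=> //; rewrite /mc_at; wr.
               ++ move=> u; rewrite mem_rcons inE => /orP [/eqP -> /=|/so7 //]; split=> //.
                  case: xin => X [_ _ aX xX xt]; apply: (MoreStep nbad aX xX _ xt).
                  by rewrite -/(dst a) da; have [] := so7 t; rewrite // mem_cat; have := mem_nth t hs; rewrite tE => ->.
               ++ by move=> a' x' /c7 hx /hx; rewrite mem_rcons inE orbC => ->.
               move=> x'; rewrite ix_ltS mem_rcons inE xpair_eqE eqxx /= orbC.
               by case: eqP => //= _ /x7c hx /hx.
             move=> /bool_eq0; rewrite !bool_neq0 eqb0 negb_and negbK => no.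
             exists s3; split=> // x'; rewrite ix_ltS => /orP [/x7c //|/eqP -> /into hx].
             by move: no; rewrite hx.
          move=> m7 ag7 [s3 [[q7 so7] c7 x7]]; exists s3; split.
            by split=> //; case: q7 => qa qb qc qd; split=> //; rewrite /mc_at; wr.
          by apply: takeS => // x; apply: x7; apply: ltn_ord.
        move=> /bool_eq0 /eqP lcn; exists s2; split.
          by split=> //; case: q6 => qa qb qc qd; split=> //; rewrite /mc_at; wr.
        by apply: takeS => // x [X [_ nb _ _ _]]; case: lcn; apply/lc6.
      move=> m5 ag5 [s2 [[q5 so5] c5]]; right; exists s2, (s ++ s2)%SEQ, h.+1; split=> //.
      * by apply: agree_trans k4 (agree_incl _ ag5).
      * rewrite (ag5 "qhead" erefl) /m4; wr; split=> //.
        by rewrite size_cat (leq_trans hs) ?leq_addr.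
      split=> //; first by move=> x peL; rewrite mem_cat pe3.
      move=> u a x; rewrite takel_cat // (take_nth t hs) tE mem_rcons inE.
      case/orP => [/eqP -> aL tax|uh aL uax]; last by rewrite mem_cat (cl3 u).
      have da : dst a == t.1 by case: tax => X [->].
      by apply: (c5 a x) => //; rewrite take_size memP aL andbT.
    + rewrite /=; nia.
    + move=> m4 h4; have : exists f2, inv f2 m4 /\ f2 = rest s h.+1.
        case: h4 => [h4|[s2 h4]]; first by exists (rest s h.+1).
        exists (rest s h.+1); split=> //; move: h4; congr (inv _ m4).
        by rewrite /rest takel_cat.
      case=> f2 [I4 f2E]; exists f2 => //; rewrite f2E /mc_cost /= -/P; lia.
  move=> f m3 /= ne [s [h [k3 [h3 hs] q3 so3 [pe3 cl3 _]]]] [p x] /= pL.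
  have [us3 t3 mc3 ab3] := q3.
  rewrite h3 t3 in ne; have hE : h = size s.
    by apply/eqP; rewrite eqn_leq hs leqNgt; move: ne; case: (h < size s).
  rewrite mc3 //; congr nat_of_bool; apply/idP/asboolP => [/so3 []//|].
  rewrite hE take_size in cl3.
  (* Completeness: when the queue is exhausted, all predecessors of its members are in it. Closure
     of [L] ensures that the successor pair is explored too, and [L] contains the source, so the
     arrow is in the lists. *)
  move=> mo; elim: mo pL => {p x} [x|p X x v y nb pX xX _ IH xy] pL; first exact: pe3.
  have vS : ev_in S v by have := weak_alphabet xy; rewrite /= andbT.
  have [k kE kv] := lab_onto vS; rewrite -kv in IH xy.
  have := IH (clL _ _ pL (lab_in _ _)) => yin.
  apply: (cl3 _ (p, k) x yin); first by rewrite mem_arrows pL.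
  by exists X; split.
rewrite /=; set M := #|{: D}| in costB *.
have M0 : 0 < M by rewrite /M card_pairs.
(* Of the 800, 600 pay for the search itself and 200 for clearing [mc]. *)
have -> : nE.+2 * (n.+1 * (n.+1 * 800)) = nE.+2 * (n.+1 * (n.+1 * 600)) + nE.+2 * (n.+1 * (n.+1 * 200)) by lia.
rewrite [M * (_ + _)]mulnDr.
have : M.+1 * (n.+1 * 100) <= M * (nE.+2 * (n.+1 * (n.+1 * 200))) by nia.
have : M.+1 <= M.+1 * n.+1 by apply: leq_pmulr.
move: costB; set Z := \sum_(t : triple_type) _; clearbody Z M.
set X := M * (nE.+2 * (n.+1 * (n.+1 * 600))); set Y := M * (nE.+2 * _).
clearbody X Y; rewrite /= !mulnDr !mulnA; set k := n.+1.
have k0 : 0 < k by []. clearbody k; move: M0; set W := M.+1 * k; clearbody W.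
lia.
Qed.
End MoreConflicting.

(** * The rounds of the iteration *)

Section LessConflictingPairs.
Variables (E : choiceType) (S : {fset E}) (A B : fin_automaton S).
Local Notation D := (det_pair A B).
Local Notation nE := (size (enum_fset S)).
Local Notation n := #|fstate B|.
Local Notation p0 := (p0 A B).
Local Notation M := #|{: D}|.
Implicit Types (p q : D) (L : seq D) (x y : fstate B) (m : memory).

Definition in_snd p x : bool := if p.2 is Some X then x \in X else false.

Lemma LC0P p : LC0 p <-> p.1 = None \/ exists x, in_snd p x /\ blocked (A := B) x.
Proof.
rewrite /LC0 /in_snd; split=> -[->|]; try by left.
  by case=> X [x [-> xX bx]]; right; exists x.
by case: p.2 => [X|] [x [xX bx]] //; right; exists X, x.
Qed.

(** An entry is the first level plus one. The bound [N.+1] says that nothing has been entered for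
    levels beyond [N]. *)
Definition lc_upto L N m := forall p, p \in L -> at_pair m "lc" p <= N.+1 /\
  forall i, i <= N -> 0 < at_pair m "lc" p <= i.+1 <-> LCupto i p.

Definition lc_right L m := forall p, p \in L ->
  forall i, 0 < at_pair m "lc" p <= i.+1 <-> LCupto i p.

Definition mc_right L N m := forall t : triple_type A B, t.1 \in L ->
  mc_at m t = `[< more (LCupto N) t.1 t.2 >].

Definition lcp_init : cmd :=
  (For "h" "tail" (
    "XA" <- "nodeA"@["h"];;
    "XB" <- "nodeB"@["h"];;
    When ("XA" == "NA") ("lc"@["XA", "XB"] <- 1);;
    For "x" "nB" (
      When ("memB"@["XB", "x"] && ("live"@["x"] == 0))
        ("lc"@["XA", "XB"] <- 1))))%ram.

Lemma lcp_init_correct L m : env A B m -> nodes_are L m ->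
  (forall p, at_pair m "lc" p = 0) ->
  triple m lcp_init (M.+1 * (n.+1 * 100)) (lc_upto L 0).
Proof.
move=> envm [uL tL ndL abL] l0; rewrite /lcp_init /assign /Var.
have [[nBm _ _] [_ _ memBm] _ _] : prepared B "B" m by case: envm.
have [_ [NAm _ _] _ _] : prepared A "A" m by case: envm.
have liveM : lives_are B m by case: envm.
apply: (triple_weaken _ _ (fun _ h => h)).
  apply: (triple_for_le (N := size L) (M := M) (I := fun k m' =>
    forall q, at_pair m' "lc" q = (q \in take k L) && `[< LC0 q >])).
  - exact: size_nodes.
  - by [].
  - by [].
  - by [].
  - by move=> q; rewrite take0 in_nil; apply: l0.
  - move=> k m1 kL ag1 k1 I1; have [aA aB] := abL k kL; set p := nth p0 L k in aA aB.
    do 2!(apply: triple_seq; apply: triple_assign; last exact: leqnn).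
    rewrite /=; wr; rewrite k1 (ag1 "nodeA" erefl) (ag1 "nodeB" erefl) aA aB; set m2 := write _ _ _ _.
    have ag2 : agree ("h" :: mods lcp_init) m m2.
      by do 2!apply: agree_write => //; apply: agree_incl ag1.
    have [XA2 XB2] : m2 "XA" [::] = code p.1 /\ m2 "XB" [::] = code p.2 by rewrite /m2; wr.
    have l2 q : at_pair m2 "lc" q = (q \in take k L) && `[< LC0 q >] by apply: I1.
    have pk : p \notin take k L.
      have := uL; rewrite -{1}(cat_take_drop k L) (drop_nth p0 kL) cat_uniq.
      by case/and3P => _ /hasPn/(_ p); rewrite inE eqxx => /(_ isT).
    apply: triple_seq; pose I3 j m' := forall q, at_pair m' "lc" q =
      if q == p then (p.1 == None) || [exists x, [&& ix x < j, in_snd p x & `[< blocked (A := B) x >]]] : nat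
      else at_pair m2 "lc" q.
    apply: (triple_post (Q := I3 0)).
      have no0 : [exists x : fstate B, [&& ix x < 0, in_snd p x & `[< blocked (A := B) x >]]] = false.
        by apply/existsP => -[x].
      apply: triple_when => /=; rewrite XA2 (ag2 "NA" erefl) NAm -[2 ^ _]/(code (None : det (fstate A))) (inj_eq (@code_inj _)).
        rewrite bool_neq0 => pN; apply: triple_assign; last exact: leqnn.
        move=> q; rewrite /at_pair; wr; rewrite /= XA2 XB2 pair_code_eq no0 eq_sym pN.
        by case: eqP.
      move=> /bool_eq0 pN q; rewrite no0 (negbTE pN); case: eqP => // ->.
      by rewrite l2 (negbTE pk).
    move=> m3 H3 ag3.
    apply: (triple_for_fin (Q := fstate B) (I := I3)).
    + by [].
    + by [].
    + by rewrite /= (ag3 "nB" erefl) (ag2 "nB" erefl).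
    + exact: H3.
    + move=> x m4 ag4 x4 H4.
      have [XA4 XB4] : m4 "XA" [::] = code p.1 /\ m4 "XB" [::] = code p.2.
        by rewrite (ag4 "XA" erefl) (ag4 "XB" erefl) (ag3 "XA" erefl) (ag3 "XB" erefl).
      have mem4 : (m4 "memB" [:: code p.2; ix x] != 0) = in_snd p x.
        by rewrite (ag4 "memB" erefl) (ag3 "memB" erefl) (ag2 "memB" erefl); apply: memBm.
      have live4 : (m4 "live" [:: ix x] == 0) = `[< blocked (A := B) x >].
        rewrite (ag4 "live" erefl) (ag3 "live" erefl) (ag2 "live" erefl).
        apply/idP/asboolP => [/eqP l x0|bx]; first by have := proj2 (liveM x) x0; rewrite l.
        by apply: contrapT => /negP /(liveM x).
      have exS : [exists x', [&& ix x' < (ix x).+1, in_snd p x' & `[< blocked (A := B) x' >]]] =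
          [exists x', [&& ix x' < ix x, in_snd p x' & `[< blocked (A := B) x' >]]] ||
          (in_snd p x && `[< blocked (A := B) x >]).
        apply/existsP/orP => [[x']|[/existsP [x' /andP [lt h]]|h]].
        * rewrite ix_ltS andb_orl => /orP [h|/andP [/eqP -> h]]; last by right.
          by left; apply/existsP; exists x'.
        * by exists x'; rewrite ix_ltS lt.
        by exists x; rewrite ltnSn.
      apply: triple_when => /=; rewrite XB4 x4 !mem4 live4 !bool_neq0.
        move=> h; apply: triple_assign; last exact: leqnn.
        move=> q; rewrite /at_pair; wr; rewrite /= XA4 XB4 pair_code_eq exS h !orbT eq_sym.
        by case: (eqVneq q p) => // ne; have := H4 q; rewrite (negbTE ne).
      move=> /bool_eq0 h q; rewrite exS (negbTE h) orbF; exact: H4.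
    move=> m4 ag4 H4 q; rewrite /at_pair; wr; rewrite -/(at_pair m4 "lc" q) H4 l2.
    rewrite (take_nth p0 kL) -/p mem_rcons inE; case: eqP => [->|//] /=.
    congr nat_of_bool; apply/idP/asboolP; rewrite LC0P.
      case/orP => [/eqP|/existsP [x /and3P [_ px /asboolP bx]]]; first by left.
      by right; exists x.
    case=> [->//|[x [px bx]]]; apply/orP; right; apply/existsP; exists x.
    by rewrite ltn_ord px; apply/asboolP.
  move=> m1 ag1 I1 p pL; rewrite I1 take_size pL /=; split; first by case: asboolP.
  by move=> [|//] _; case: asboolP.
rewrite /=; nia.
Qed.

Definition lcp_update : cmd :=
  (For "h" "tail" (
      "XA" <- "nodeA"@["h"];;
      "XB" <- "nodeB"@["h"];;
      When ("lc"@["XA", "XB"] == 0) (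
        For "x" "nB" (
          When ("memB"@["XB", "x"] && ("mc"@["XA", "XB", "x"] == 0)) (
            "lc"@["XA", "XB"] <- "n" + 2;;
            "changed" <- 1)))))%ram.

Lemma lcp_update_correct L N m : env A B m -> nodes_are L m ->
  m "n" [::] = N -> m "changed" [::] = 0 -> lc_upto L N m -> mc_right L N m ->
  triple m lcp_update (M.+1 * (n.+1 * 150)) (fun m' => lc_upto L N.+1 m' /\
    (m' "changed" [::] != 0 <-> exists p, [/\ p \in L, ~ LCupto N p & LCupto N.+1 p])).
Proof.
move=> envm [uL tL ndL abL] nN ch0 lcN mcN; rewrite /lcp_update /assign /Var.
have [[nBm _ _] [_ _ memBm] _ _] : prepared B "B" m by case: envm.
pose has_new j p := [exists x, [&& ix x < j, in_snd p x & mc_at m (p, x) == 0]].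
(* This refers to the memory before the pass. The pass leaves [mc] alone and meets each pair once,
   so earlier additions do not influence later decisions. *)
pose new p := (at_pair m "lc" p == 0) && has_new n p.
pose I k m' := (forall q, at_pair m' "lc" q = if (q \in take k L) && new q then N.+2 else at_pair m "lc" q) /\
  (m' "changed" [::] != 0) = has new (take k L).
have newP p : p \in L -> new p <-> ~ LCupto N p /\ LCupto N.+1 p.
  move=> pL; have [_ /(_ N (leqnn N)) lcE] := lcN p pL.
  have [lcle _] := lcN p pL; have lcE' : at_pair m "lc" p == 0 <-> ~ LCupto N p.
    rewrite -lcE lcle andbT lt0n; split=> [->//|/negP]; by rewrite negbK.
  rewrite /new; split=> [/andP [/lcE' nl /existsP [x /and3P [_ px mx]]]|[/lcE' nl h]].
    split=> //; right; apply/LCstep_more; move: px; rewrite /in_snd.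
    case pX: p.2 => [X|] // xX; exists X, x; split=> // mo.
    by move: mx; rewrite mcN //= (asboolT mo).
  rewrite nl /=; case: h => [h|/LCstep_more [X [x [pX xX nmo]]]]; first by case: (proj1 lcE' nl h).
  apply/existsP; exists x; rewrite ltn_ord /in_snd pX xX mcN //=.
  by rewrite (asboolF nmo).
apply: (triple_weaken _ _ (fun _ h => h)).
  apply: (triple_for_le (N := size L) (M := M) (I := I)).
  - exact: size_nodes.
  - by [].
  - by [].
  - by [].
  - by rewrite /I take0; split=> //; wr; rewrite ch0.
  - move=> k m1 kL ag1 k1 [I1 c1]; have [aA aB] := abL k kL; set p := nth p0 L k in aA aB.
    have pL : p \in L by apply: mem_nth.
    do 2!(apply: triple_seq; apply: triple_assign; last exact: leqnn).
    rewrite /=; wr; rewrite k1 (ag1 "nodeA" erefl) (ag1 "nodeB" erefl) aA aB; set m2 := write _ _ _ _.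
    have ag2 : agree ("h" :: mods lcp_update) m m2.
      by do 2!apply: agree_write => //; apply: agree_incl ag1.
    have [XA2 XB2] : m2 "XA" [::] = code p.1 /\ m2 "XB" [::] = code p.2 by rewrite /m2; wr.
    have l2 q : at_pair m2 "lc" q = if (q \in take k L) && new q then N.+2 else at_pair m "lc" q by apply: I1.
    have c2 : (m2 "changed" [::] != 0) = has new (take k L) by apply: c1.
    have pk : p \notin take k L.
      have := uL; rewrite -{1}(cat_take_drop k L) (drop_nth p0 kL) cat_uniq.
      by case/and3P => _ /hasPn/(_ p); rewrite inE eqxx => /(_ isT).
    have lp2 : m2 "lc" [:: code p.1; code p.2] = at_pair m "lc" p.
      by have := l2 p; rewrite (negbTE pk).
    apply: triple_when => /=; rewrite XA2 XB2 lp2; last first.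
      move=> /bool_eq0 /negbTE nl; split.
        move=> q; rewrite /at_pair; wr; rewrite -/(at_pair m2 "lc" q) l2 (take_nth p0 kL) mem_rcons inE -/p.
        by case: eqP => // ->; rewrite /new nl !andbF.
      by wr; rewrite c2 (take_nth p0 kL) has_rcons -/p /new nl.
    rewrite bool_neq0 => lp0.
    pose I3 j m' := (forall q, at_pair m' "lc" q = if q == p then (if has_new j p then N.+2 else 0) else at_pair m2 "lc" q) /\
      (m' "changed" [::] != 0) = has_new j p || has new (take k L).
    have exS x : has_new (ix x).+1 p = has_new (ix x) p || (in_snd p x && (mc_at m (p, x) == 0)).
      apply/existsP/orP => [[x']|[/existsP [x' /andP [lt h]]|h]].
      + rewrite ix_ltS andb_orl => /orP [h|/andP [/eqP -> h]]; last by right.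
        by left; apply/existsP; exists x'.
      + by exists x'; rewrite ix_ltS lt.
      by exists x; rewrite ltnSn.
    apply: (triple_for_fin (Q := fstate B) (I := I3)).
    + by [].
    + by [].
    + by rewrite /= (ag2 "nB" erefl).
    + have no0 : has_new 0 p = false by apply/existsP => -[x].
      rewrite /I3 no0; split=> // q; rewrite -[LHS]/(at_pair m2 "lc" q); case: eqP => // ->.
      by rewrite /at_pair lp2; apply/eqP.
    + move=> x m4 ag4 x4 [H4 C4].
      have [XA4 XB4] : m4 "XA" [::] = code p.1 /\ m4 "XB" [::] = code p.2.
        by rewrite (ag4 "XA" erefl) (ag4 "XB" erefl).
      have n4 : m4 "n" [::] = N by rewrite (ag4 "n" erefl) (ag2 "n" erefl).
      have mem4 : (m4 "memB" [:: code p.2; ix x] != 0) = in_snd p x.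
        by rewrite (ag4 "memB" erefl) (ag2 "memB" erefl); apply: memBm.
      have mc4 : m4 "mc" [:: code p.1; code p.2; ix x] = mc_at m (p, x).
        by rewrite (ag4 "mc" erefl) (ag2 "mc" erefl).
      apply: triple_when => /=; rewrite XA4 XB4 x4 !mem4 mc4 !bool_neq0.
        move=> h; apply: triple_seq; apply: triple_assign; last exact: leqnn.
        apply: triple_assign; last exact: leqnn.
        split; last by wr; rewrite exS h orbT.
        move=> q; rewrite /at_pair; wr; rewrite /= XA4 XB4 n4 pair_code_eq exS h !orbT eq_sym.
        case: (eqVneq q p) => [_|ne]; first by rewrite addn2.
        by have := H4 q; rewrite (negbTE ne).
      move=> /bool_eq0 h; split; first by move=> q; rewrite exS (negbTE h) orbF; apply: H4.
      by wr; rewrite exS (negbTE h) orbF.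
    move=> m4 ag4 [H4 C4]; split.
      move=> q; rewrite /at_pair; wr; rewrite -/(at_pair m4 "lc" q) H4 l2.
      rewrite (take_nth p0 kL) -/p mem_rcons inE; case: eqP => [->|//] /=.
      by rewrite /new lp0 /=; case: ifP => // _; apply/esym/eqP.
    by wr; rewrite C4 (take_nth p0 kL) has_rcons -/p /new lp0.
  move=> m1 ag1 [I1 C1]; split; last first.
    rewrite C1 take_size; split=> [/hasP [p pL /(newP p pL) [? ?]]|[p [pL h1 h2]]].
      by exists p.
    by apply/hasP; exists p => //; apply/(newP p pL).
  move=> p pL; rewrite I1 take_size pL /=; have [le lcE] := lcN p pL.
  case: ifP => [/(newP p pL) [nl yl]|/negP nnew]; split=> //.
  - move=> i; rewrite leq_eqVlt => /orP [/eqP ->|]; first by rewrite leqnn.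
    rewrite ltnS => iN; split=> [|/(LCupto_mono iN)]; last by [].
    by case/andP => _; rewrite ltnS => Ni; have := leq_trans Ni iN; rewrite ltnn.
  - exact: leqW.
  move=> i; rewrite leq_eqVlt => /orP [/eqP ->|]; last by rewrite ltnS => iN; apply: lcE.
  have lcN' := lcE N (leqnn N).
  rewrite (leqW le) andbT; have {}lcN' : 0 < at_pair m "lc" p <-> LCupto N p by rewrite -lcN' le andbT.
  rewrite lcN'; split=> [|h]; first by left.
  by apply: contrapT => nl; apply: nnew; apply/(newP p pL).
rewrite /=; nia.
Qed.

Definition mc_bound := M * (nE.+2 * (n.+1 * (n.+1 * 800))) + 1000 * n.+1.
(** At most [M.+1] rounds, the last one idle; one further unit pays for [lcp_init]. *)
Definition lcp_bound := M.+2 * (mc_bound + M.+1 * (n.+1 * 150) + 100).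

(** The last round fills [mc] from the level before the counter [n] is increased, hence the
    predecessor of the final counter. *)
Lemma less_conflicting_pairs_correct L m : env A B m -> nodes_are L m ->
  closed_pairs (mem L) -> preds_are (arrows L) m -> (forall p, at_pair m "lc" p = 0) ->
  triple m less_conflicting_pairs lcp_bound (fun m' => lc_right L m' /\
    mc_right L (m' "n" [::]).-1 m').
Proof.
move=> envm nL clL prL l0; rewrite /less_conflicting_pairs -/lcp_init -/lcp_update.
pose w := mc_bound + M.+1 * (n.+1 * 150) + 50.
pose c N := #|[set p | (p \in L) && `[< LCupto N p >]]|.
pose keep m' := agree (mods less_conflicting_pairs) m m'.
have keepE m' : keep m' -> [/\ env A B m', nodes_are L m' & preds_are (arrows L) m'].
  move=> k; split; first by apply: env_agree envm; last exact: k.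
    by rewrite /nodes_are /at_pair !k.
  by rewrite /preds_are /at_pair !k.
(* Either a round is still due, paid for by the pairs that have no level yet plus one idle round, or
   the last round was idle and no steps remain. *)
pose inv f m' := exists N, [/\ keep m', m' "n" [::] = N, lc_upto L N m' &
  (m' "changed" [::] != 0 /\ f = (M.+1 - c N) * w) \/
  [/\ m' "changed" [::] = 0, 0 < N, forall p, p \in L -> LCupto N p -> LCupto N.-1 p,
    mc_right L N.-1 m' & f = 0]].
have cM N : c N <= M by apply: max_card.
apply: (triple_weaken _ _ (fun _ h => h)).
  apply: triple_seq; apply: triple_post (lcp_init_correct envm nL l0) _ => m1 lc1 ag1.
  do 2!(apply: triple_seq; apply: triple_assign; last exact: leqnn).
  rewrite /=; set m2 := write _ _ _ _.
  apply: (triple_while (I := inv) (f := (M.+1 - c 0) * w)).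
  - exists 0; split; [|by rewrite /m2; wr|exact: lc1|by left; rewrite /m2; wr].
    by do 2!apply: agree_write => //; apply: agree_incl ag1.
  - move=> f m3 /= ne [N [k3 n3 lc3 [[ch ->]|[ch _ _ _ _]]]]; last by rewrite ch in ne.
    exists (mc_bound + M.+1 * (n.+1 * 150) + 20) => //.
    apply: (triple_weaken (Q := fun m' => exists2 f2, inv f2 m' & f2 + w <= (M.+1 - c N) * w)).
    + apply: triple_seq; apply: triple_assign; last exact: leqnn.
      rewrite /=; set m4 := write _ _ _ _.
      have k4 : keep m4 by apply: agree_write.
      have [env4 nL4 pr4] := keepE _ k4.
      have bad4 p : p \in L -> at_pair m4 "lc" p = 0 <-> ~ LCupto N p.
        move=> pL; have [le lcE] := lc3 p pL; rewrite -(lcE N (leqnn N)) le andbT lt0n.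
        have -> : at_pair m4 "lc" p = at_pair m3 "lc" p by rewrite /at_pair /m4; wr.
        by split=> [->//|/negP]; rewrite negbK => /eqP.
      apply: triple_seq.
      apply: triple_post (more_conflicting_correct env4 nL4 clL pr4 bad4) _ => m5 mc5 ag5.
      have k5 : keep m5 by apply: agree_trans k4 (agree_incl _ ag5).
      have [env5 nL5 pr5] := keepE _ k5.
      apply: triple_seq.
      have n5 : m5 "n" [::] = N by rewrite (ag5 "n" erefl).
      have ch5 : m5 "changed" [::] = 0 by rewrite (ag5 "changed" erefl).
      have lc5 : lc_upto L N m5 by rewrite /lc_upto /at_pair (ag5 "lc" erefl).
      apply: triple_post (lcp_update_correct env5 nL5 n5 ch5 lc5 mc5) _ => m6 [lc6 ch6] ag6.
      have k6 : keep m6 by apply: agree_trans k5 (agree_incl _ ag6).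
      have n6 : m6 "n" [::] = N by rewrite (ag6 "n" erefl).
      apply: triple_assign; last exact: leqnn.
      rewrite /= n6 addn1; set m7 := write _ _ _ _.
      have k7 : keep m7 by apply: agree_write.
      have [ch0|chn] := eqVneq (m6 "changed" [::]) 0.
        exists 0; last by rewrite leq_pmull // subn_gt0 ltnS.
        exists N.+1; split=> //; right; split=> //.
          move=> p pL h; apply: contrapT => nh.
          by have := proj2 ch6 (ex_intro _ p (And3 pL nh h)); rewrite ch0.
        by rewrite /mc_right /mc_at /m7; wr; rewrite (ag6 "mc" erefl).
      exists ((M.+1 - c N.+1) * w).
        by exists N.+1; split=> //; left.
      rewrite addnC -mulSn leq_mul2r; apply/orP; right.
      have [p [pL np yp]] := proj1 ch6 chn.
      have lt : c N < c N.+1.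
        (* A round that sets [changed] strictly increases the number of pairs with a level. *)
        apply: proper_card; apply/properP; split.
          by apply/subsetP => q; rewrite !inE => /andP [-> /asboolP h]; apply/asboolP; left.
        by exists p; rewrite !inE pL; [apply/asboolP|apply/asboolP].
      have := cM N.+1; lia.
    + rewrite -/mc_bound; move: mc_bound (M.+1 * (n.+1 * 150)) => a b /=; lia.
    + move=> m4 [f2 I2 le]; exists f2 => //.
      move: le; rewrite /w /=; move: mc_bound (M.+1 * (n.+1 * 150)) (_ * _) => a b d; lia.
  move=> f m3 /= ne [N [k3 n3 lc3 [[ch _]|[ch N0 st mcr _]]]]; first by rewrite ne in ch.
  rewrite n3; split=> // p pL i; have [le lcE] := lc3 p pL.
  (* The idle round led from level [N.-1] to [N], so every later level on [L] is already reached at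
     [N.-1]. *)
  have stab : forall i q, q \in L -> LCupto i q -> LCupto N.-1 q.
    by apply: LC_stable clL _ => q qL; rewrite prednK //; apply: st.
  have [iN|Ni] := leqP i N; first exact: lcE.
  have lcN := lcE N (leqnn N); split=> [/andP [l1 _]|h].
    by apply: (LCupto_mono (ltnW Ni)); apply/lcN; rewrite l1 le.
  have /lcN/andP [l1 l2] : LCupto N p.
    by apply: (LCupto_mono (leq_pred N)); apply: stab h.
  by rewrite l1 (leq_trans l2) // ltnW.
have h0 : (M.+1 - c 0) * w <= M.+1 * w by rewrite leq_mul2r leq_subr orbT.
have hw : M.+1 * (n.+1 * 100) <= w.
  apply: (@leq_trans (M.+1 * (n.+1 * 150))); first by rewrite !leq_mul.
  by rewrite /w -addnA addnCA leq_addr.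
have wE : mc_bound + M.+1 * (n.+1 * 150) + 100 = w + 50 by rewrite /w -!addnA.
rewrite /lcp_bound wE [M.+2 * _]mulnDr [M.+2 * w]mulSn.
by move: h0 hw; move: (M.+1 * w) (M.+1 * (n.+1 * 100)) (_ * w) => a b d /=; lia.
Qed.

Definition explore_bound := M * (nE.+2 * 400) + 20.
Definition reset_bound := (2 ^ #|fstate A|).+2 * ((2 ^ n).+2 * 60).

(** All pairs with the empty set on the left are nodes from the outset, so the table is right for
    every set of states of B, whether or not a trace reaches it. *)
Lemma certain_conflicts_correct m : env A B m ->
  triple m certain_conflicts
    (reset_bound + (2 ^ n).+2 * 100 + explore_bound + lcp_bound + (2 ^ n).+1 * 50)
    (fun m' => forall X : {set fstate B},
       m' "conf" [:: code (Some X)] = `[< LC ((Some set0, Some X) : D) >]).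
Proof.
move=> envm; rewrite /certain_conflicts.
have [[nBm _ _] [NBm _ memBm] _ _] : prepared B "B" m by case: envm.
have envk m' : agree (mods certain_conflicts) m m' -> env A B m'.
  by move=> k; apply: env_agree envm; last exact: k.
apply: (triple_weaken _ _ (fun _ h => h)).
  apply: triple_seq; apply: triple_post (reset_correct envm) _ => m1 [nL1 c1 l1] ag1.
  have k1 : agree (mods certain_conflicts) m m1 by apply: agree_incl ag1.
  apply: triple_seq.
  apply: (triple_for (N := (2 ^ n).+1) (I := fun k m' => exists L : seq D, nodes_are L m' /\
    forall p, (p \in L) = (p.1 == Some set0) && (code p.2 < k))).
  - by [].
  - by [].
  - by rewrite /= (k1 "NB" erefl) NBm addn1.
  - by exists [::]; split=> // p; rewrite ltn0 andbF.
  - move=> k m2 kN ag2 k2 [L [nL mL]].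
    have [X kX] := code_onto (kN : k <= 2 ^ n).
    apply: triple_post (@add_node_correct _ _ A B L m2 0 (Rd "X" [::]) (Some set0, X) nL _ _ _ _) _ => //.
    + by rewrite /= code_set0.
    + by rewrite /= k2 kX.
    have -> : ((Some set0, X) : D) \in L = false by rewrite mL /= kX ltnn andbF.
    move=> m3 nL3 _; exists (rcons L (Some set0, X)); split=> // p.
    rewrite mem_rcons inE mL ltnS [code p.2 <= k]leq_eqVlt -kX (inj_eq (@code_inj _)).
    by case: p => p1 p2; rewrite xpair_eqE /= -andb_orr.
  move=> m2 ag2 [L [nL mL]].
  have k2 : agree (mods certain_conflicts) m m2 by apply: agree_trans k1 (agree_incl _ ag2).
  have c2 p : at_pair m2 "cnt" p = 0 by rewrite /at_pair (ag2 "cnt" erefl); apply: c1.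
  apply: triple_seq; apply: triple_post (explore_correct (envk _ k2) nL c2) _.
  move=> m3 [L3 [nL3 sub3 cl3 pr3]] ag3.
  have k3 : agree (mods certain_conflicts) m m3 by apply: agree_trans k2 (agree_incl _ ag3).
  have l3 p : at_pair m3 "lc" p = 0.
    by rewrite /at_pair (ag3 "lc" erefl) (ag2 "lc" erefl); apply: l1.
  apply: triple_seq.
  apply: triple_post (less_conflicting_pairs_correct (envk _ k3) nL3 cl3 pr3 l3) _ => m4 [lc4 _] ag4.
  have k4 : agree (mods certain_conflicts) m m4 by apply: agree_trans k3 (agree_incl _ ag4).
  have lcX (X : {set fstate B}) : (0 < m4 "lc" [:: 0; code (Some X)]) = `[< LC ((Some set0, Some X) : D) >].
    have pL : ((Some set0, Some X) : D) \in L3.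
      by apply: sub3; rewrite mL /= eqxx ltnS code_le.
    have lcE i : 0 < m4 "lc" [:: 0; code (Some X)] <= i.+1 <-> LCupto i ((Some set0, Some X) : D).
      by have := lc4 _ pL i; rewrite /at_pair /= code_set0.
    apply/idP/asboolP => [l0|/LC_LCupto [i /lcE /andP []] //].
    apply/LC_LCupto; exists (m4 "lc" [:: 0; code (Some X)]).-1; apply/lcE.
    by rewrite l0 prednK /=.
  rewrite /assign /Var.
  apply: (triple_for (N := 2 ^ n) (I := fun k m' => forall X : {set fstate B},
    code (Some X) < k -> m' "conf" [:: code (Some X)] = `[< LC ((Some set0, Some X) : D) >])).
  - by [].
  - by [].
  - by rewrite /= (k4 "NB" erefl) NBm.
  - by [].
  - move=> k m5 kN ag5 k5 I5; apply: triple_assign; last exact: leqnn.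
    move=> X; rewrite ltnS leq_eqVlt; wr; rewrite /= k5 eqseq_cons andbT eq_sym (ag5 "lc" erefl).
    by case: (eqVneq k (code (Some X))) => [-> _|_ /=]; [rewrite lcX|apply: I5].
  by move=> m5 _ I5 X; apply: I5; apply: code_lt.
rewrite -/explore_bound -/reset_bound.
move: reset_bound explore_bound lcp_bound (2 ^ n) => a b d e /=; lia.
Qed.
End LessConflictingPairs.

(** * The pairs on which the answer depends *)

Section StartPairs.
Variables (E : choiceType) (S : {fset E}) (A B : fin_automaton S).
Local Notation D := (det_pair A B).
Local Notation nE := (size (enum_fset S)).
Local Notation nA := #|fstate A|.
Local Notation n := #|fstate B|.
Implicit Types (x y : fstate A) (m : memory).

Definition start_type := (fstate A * det (fstate B))%type.
Implicit Types (t : start_type) (L : seq start_type).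

Definition starts_are L m := [/\ uniq L, m "stail" [::] = size L,
  forall t, m "start" [:: ix t.1; code t.2] = (t \in L) &
  forall i t, i < size L -> nth t L i = t ->
    m "startA" [:: i] = ix t.1 /\ m "startB" [:: i] = code t.2].

Lemma start_code_eq t t' :
  ([:: ix t.1; code t.2] == [:: ix t'.1; code t'.2]) = (t == t').
Proof.
case: t t' => [x X] [y Y]; rewrite eqseq2 (inj_eq (@code_inj _)) xpair_eqE.
by rewrite (inj_eq (@ord_inj _)) (inj_eq enum_rank_inj).
Qed.

Lemma add_start_correct L m a b t :
  starts_are L m -> eval m a = ix t.1 -> eval m b = code t.2 ->
  avoids a [:: "start"; "startA"; "startB"] -> avoids b [:: "start"; "startA"; "startB"] ->
  triple m (add_start a b) (3 * (cost a + cost b) + 40)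
    (starts_are (if t \in L then L else rcons L t)).
Proof.
move=> [uL tL sL abL] ea eb fa fb; rewrite /add_start /assign /Var.
apply: (triple_weaken _ _ (fun _ h => h)).
  apply: triple_when => /=; rewrite ea eb sL; case: ifP => //= pL _.
  apply: triple_seq; apply: triple_assign; last exact: leqnn.
  rewrite /= ea eb; set m1 := write _ _ _ _.
  have ag1 : agree [:: "start"; "startA"; "startB"] m m1 by apply: agree_write.
  apply: triple_seq; apply: triple_assign; last exact: leqnn.
  rewrite (eval_agree ag1 fa) ea /=; set m2 := write _ _ _ _.
  have ag2 : agree [:: "start"; "startA"; "startB"] m m2 by apply: agree_write.
  apply: triple_seq; apply: triple_assign; last exact: leqnn.
  rewrite (eval_agree ag2 fb) eb /=; set m3 := write _ _ _ _.
  apply: triple_assign; last exact: leqnn.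
  rewrite /=; have tE : m3 "stail" [::] = size L by rewrite /m3 /m2 /m1; wr.
  rewrite tE; split.
  - by rewrite rcons_uniq pL.
  - by wr; rewrite size_rcons addn1.
  - move=> q; wr; rewrite /m3 /m2 /m1; wr.
    by rewrite start_code_eq mem_rcons inE [q == t]eq_sym; case: eqP.
  move=> i q; rewrite size_rcons ltnS leq_eqVlt nth_rcons; wr; rewrite /m3 /m2 /m1; wr.
  rewrite !eqseq_cons !andbT tL; case: (eqVneq i (size L)) => [->|ne] /= lt.
    by rewrite ltnn => <-.
  by rewrite lt; apply: abL.
rewrite /=; lia.
Qed.

Definition inits_are (C : fin_automaton S) u m :=
  forall x : fstate C, m ("init" ++ u) [:: ix x] = (x \in finit C).

Definition confs_are m := forall X : {set fstate B},
  m "conf" [:: code (Some X)] = `[< LC ((Some set0, Some X) : D) >].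

Definition start_at t : Prop := start_pair ((Some [set t.1], t.2) : D).

Definition start_bound := n.+1 * (n.+1 * 30 + 30) + nA.+1 * (nA.+1 * 100) +
  nA * (2 ^ n).+1 * (nE.+1 * (nA.+1 * 200)) + 200.

Lemma start_atP x s X : {subset s <= S} -> weak_init (A := A) (events s) x ->
  deltas (Some (start_set B)) (events s) = Some X ->
  ~ certain_conflict B s -> start_at (x, Some X).
Proof. by move=> sS sx dX nc; exists s, x; rewrite dX. Qed.

(** The proper prefixes are settled by [s], so only the set reached at the end has to be looked up.
    This is why the search needs no memory of its trace. *)
Lemma certain_conflict_rcons s e X : {subset rcons s e <= S} -> ~ certain_conflict B s ->
  deltas (Some (start_set B)) (events (rcons s e)) = Some X ->
  certain_conflict B (rcons s e) <-> LC ((Some set0, Some X) : D).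
Proof.
move=> sS nc dX; rewrite (certain_conflictP A B sS); split=> [[r [u [ru]]]|h]; last first.
  by exists (rcons s e), [::]; rewrite cats0 dX.
case/lastP: u ru => [|u e']; first by rewrite cats0 => ->; rewrite dX.
rewrite -rcons_cat => /rcons_inj [ru _] h; case: nc.
apply/(certain_conflictP A B); last by exists r, u.
by move=> a as_; apply: sS; rewrite mem_rcons inE as_ orbT.
Qed.

(** Traces that are not certain conflicts are closed under prefixes, so cutting the search off at a
    set marked in [conf] loses nothing. *)
Lemma start_pairs_correct m : env A B m -> inits_are A "A" m -> inits_are B "B" m ->
  confs_are m -> (forall j, m "start" j = 0) ->
  triple m start_pairs start_bound (fun m' => exists L, starts_are L m' /\
    forall t, t \in L <-> start_at t).
Proof.
move=> envm iA iB conf0 s0; rewrite /start_pairs /assign /Var.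
have [[nAm nEm _] _ [clA stA] dA] : prepared A "A" m by case: envm.
have [[nBm _ _] [_ powB _] [clB stB] dB] : prepared B "B" m by case: envm.
pose keep m' := agree (mods start_pairs) m m'.
pose X0 := start_set B.
pose sound L := forall t, t \in L -> start_at t.
have noconf0 : ~ LC ((Some set0, Some X0) : D) <-> ~ certain_conflict B [::].
  have e0 : {subset ([::] : seq E) <= S} by [].
  rewrite (certain_conflictP A B e0); split=> nc.
    by case=> r [u [ru h]]; apply: nc; case: r ru h.
  by move=> h; apply: nc; exists [::], [::].
apply: (triple_weaken _ _ (fun _ h => h)).
  do 2!(apply: triple_seq; apply: triple_assign; last exact: leqnn).
  rewrite /=; set m1 := write _ _ _ _.
  have k1 : keep m1 by do 2!apply: agree_write => //.
  apply: triple_seq.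
  have := @code_loop_correct (fstate B) (fun x y : fstate B => (x \in finit B) && `[< weak (A := B) x [::] y >])
    false "B" (Rd "initB" [:: Rd "x" [::]] && Rd "closureB" [:: Rd "x" [::]; Rd "y" [::]])%ram m1.
  rewrite /code_loop => H; apply: triple_post (H _ _ _ _ _ (leqnn _)) _ => {H}.
  - by rewrite /m1; wr.
  - by move=> x; rewrite /m1; wr; apply: powB.
  - by rewrite /m1; wr.
  - move=> x y m2 ag2 x2 y2; rewrite /= x2 y2 (ag2 "initB" erefl) (ag2 "closureB" erefl) /m1; wr.
    rewrite bool_neq0 (iB x) bool_neq0; congr (_ && _); apply/idP/asboolP; by move/clB.
  move=> m2 Y2 ag2.
  have k2 : keep m2 by apply: agree_trans k1 (agree_incl _ ag2).
  have XE : [set y : fstate B | [exists x : fstate B, (x \in finit B) && `[< weak (A := B) x [::] y >]]] = X0.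
    apply/setP => y; rewrite !inE; apply/existsP/asboolP => -[x].
      by case/andP => xi /asboolP xy; exists x.
    by case=> xi xy; exists x; apply/andP; split=> //; apply/asboolP.
  have X2 : m2 "X" [::] = code (Some X0) by rewrite -XE; exact: Y2.
  have st2 : starts_are [::] m2.
    split=> //; first by rewrite (ag2 "stail" erefl) /m1; wr.
    by move=> t; rewrite (ag2 "start" erefl) /m1; wr; rewrite s0.
  pose start0 m' := exists L, [/\ keep m', starts_are L m', sound L &
    forall x, weak_init (A := A) [::] x -> ~ LC ((Some set0, Some X0) : D) -> (x, Some X0) \in L].
  apply: triple_seq; apply: (triple_post (Q := start0)).
    have cE : m2 "conf" [:: m2 "X" [::]] = `[< LC ((Some set0, Some X0) : D) >].
      by rewrite X2 k2 //; apply: conf0.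
    apply: triple_when => /=; rewrite cE; last first.
      move=> /bool_eq0; rewrite eqb0 negbK => /asboolP h; exists [::]; split=> //.
    rewrite bool_neq0 eqb0 => /asboolP /noconf0 nc0.
    have d0 : deltas (Some (start_set B)) (events [::]) = Some X0 by [].
    pose J (P : fstate A -> fstate A -> bool) m' := exists L, [/\ starts_are L m', sound L &
      forall x y, P x y -> x \in finit A -> weak (A := A) x [::] y -> (y, Some X0) \in L].
    apply: (triple_for_fin (Q := fstate A) (I := fun i => J (fun x _ => ix x < i))).
    + by [].
    + by [].
    + by rewrite /= k2.
    + exists [::]; split=> //; case: st2 => qa qb qc qd; split=> // t; by wr.
    + move=> x m3 ag3 x3 [L [nL so c3]].
      apply: (triple_for_fin (Q := fstate A) (I := fun i => J (fun x' y => (ix x' < ix x) || ((x' == x) && (ix y < i))))).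
      * by [].
      * by [].
      * by rewrite /= (ag3 "nA" erefl) k2.
      * by exists L; split=> // x' y; rewrite ltn0 andbF orbF; apply: c3.
      * move=> y m4 ag4 y4 [L4 [nL4 so4 c4]].
        have x4 : m4 "x" [::] = ix x by rewrite (ag4 "x" erefl).
        have X4 : m4 "X" [::] = code (Some X0) by rewrite (ag4 "X" erefl) (ag3 "X" erefl).
        have i4 : m4 "initA" [:: ix x] = (x \in finit A).
          by rewrite (ag4 "initA" erefl) (ag3 "initA" erefl) k2 //; apply: iA.
        have cl4 : m4 "closureA" [:: ix x; ix y] != 0 <-> weak (A := A) x [::] y.
          by rewrite (ag4 "closureA" erefl) (ag3 "closureA" erefl) k2 //; apply: clA.
        apply: triple_when => /=; rewrite x4 y4 i4 !bool_neq0.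
          case/andP => xi /cl4 xy.
          apply: triple_post (add_start_correct (t := (y, Some X0)) nL4 _ _ _ _) _ => // m5 nL5 _.
          eexists; split; [|move=> t|].
          -- by case: nL5 => qa qb qc qd; split; [exact: qa|exact: qb|exact: qc|exact: qd].
          -- have sy : start_at (y, Some X0).
               by apply: (start_atP (s := [::])) d0 nc0 => //; exists x.
             by case: ifP => _; [apply: so4|rewrite mem_rcons inE => /orP [/eqP ->|/so4]].
          move=> x' y'; rewrite ix_ltS andb_orr orbA => h xi' xy'.
          case/orP: h => [h|/andP [/eqP _ /eqP ->]].
            by have := c4 x' y' h xi' xy'; case: ifP => // _; rewrite mem_rcons inE => ->; rewrite orbT.
          by case: ifP => // _; rewrite mem_rcons inE eqxx.
        move=> /bool_eq0 no; exists L4; split=> //.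
        move=> x' y'; rewrite ix_ltS andb_orr orbA => h xi' xy'.
        case/orP: h => [h|/andP [/eqP xx /eqP yy]]; first exact: (c4 x' y').
        by move: no xi'; rewrite xx yy in xy' *; rewrite (proj2 cl4 xy') andbT => /negP.
      move=> m4 ag4 [L4 [nL4 so4 c4]]; exists L4; split=> // x' y; rewrite ix_ltS => h.
      by apply: c4; rewrite ltn_ord andbT.
    move=> m3 ag3 [L [nL so c3]]; exists L; split=> //.
      by apply: agree_trans k2 (agree_incl _ ag3).
    by move=> y [x [xi xy]] _; apply: (c3 x y) => //; apply: ltn_ord.
  move=> m3 [L [k3 nL so c3]] _.
  apply: triple_seq; apply: triple_assign; last exact: leqnn.
  rewrite /=; set m4 := write _ _ _ _.
  pose w := nE.+1 * (nA.+1 * 200).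
  pose N := #|{: start_type}|.
  pose inv f m' := exists L h, [/\ keep m', m' "shead" [::] = h /\ h <= size L, starts_are L m',
    sound L & [/\ forall x, weak_init (A := A) [::] x -> ~ LC ((Some set0, Some X0) : D) -> (x, Some X0) \in L,
      forall t k y Y, t \in take h L -> k < nE -> delta t.2 (lab S k) = Some Y ->
        weak (A := A) t.1 [:: lab S k] y -> ~ LC ((Some set0, Some Y) : D) -> (y, Some Y) \in L &
      f = (N - h) * w]].
  apply: (triple_while (I := inv) (f := N * w)).
  - exists L, 0; rewrite take0 subn0; split=> //; first by apply: agree_write.
  - move=> f m5 /= ne [L5 [h [k5 [h5 hs] nL5 so5 [c5 cl5 ->]]]].
    have [uL5 t5 _ ab5] := nL5.
    rewrite h5 t5 in ne; have {ne hs} hs : h < size L5 by case: (h < size L5) ne.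
    have [t tE] : exists t, forall u, nth u L5 h = t.
      by case: (L5) hs => // u s' hs; exists (nth u (u :: s') h) => v; apply: set_nth_default.
    have [tA tB] := ab5 h t hs (tE t).
    have tL : t \in L5 by have := mem_nth t hs; rewrite tE.
    have hN : h < N by apply: leq_trans hs _; rewrite -(card_uniqP uL5) max_card.
    exists (w - 10) => //.
    apply: (triple_weaken (Q := inv ((N - h.+1) * w))).
    + do 3!(apply: triple_seq; apply: triple_assign; last exact: leqnn).
      rewrite /=; wr; rewrite h5 tA tB addn1; set m6 := write _ _ _ _.
      have k6 : keep m6 by do 3!apply: agree_write => //.
      have [x6 X6 h6] : [/\ m6 "x" [::] = ix t.1, m6 "X" [::] = code t.2 & m6 "shead" [::] = h.+1].
        by rewrite /m6; wr.
      pose J P m' := exists L', [/\ starts_are (L5 ++ L')%SEQ m', sound (L5 ++ L')%SEQ &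
        forall k y Y, P k y -> k < nE -> delta t.2 (lab S k) = Some Y ->
        weak (A := A) t.1 [:: lab S k] y -> ~ LC ((Some set0, Some Y) : D) -> (y, Some Y) \in (L5 ++ L')%SEQ].
      have JF m' P : (forall k y, P k y -> False) -> starts_are L5 m' -> J P m'.
        by move=> noP st; exists [::]; rewrite cats0; split=> // k y Y /noP.
      apply: (triple_for (N := nE) (I := fun i => J (fun k _ => k < i))).
      * by [].
      * by [].
      * by rewrite /= k6.
      * by apply: JF => //; case: nL5 => qa qb qc qd; split=> // t'; wr; rewrite /m6; wr.
      * move=> e m7 eE ag7 e7 [L7 [nL7 so7 c7]].
        have [x7 X7] : m7 "x" [::] = ix t.1 /\ m7 "X" [::] = code t.2 by rewrite (ag7 "x" erefl) (ag7 "X" erefl).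
        have k7 : keep m7 by apply: agree_trans k6 (agree_incl _ ag7).
        have d7 : m7 "deltaB" [:: code t.2; e] = code (delta t.2 (lab S e)) by rewrite k7 //; apply: dB; apply: ltnW.
        have [ev eE' evS] := lab_event eE.
        (* The queue holds no traces; soundness of the queued item supplies one, to be extended by
           the current event. *)
        have [X [s [sS nc [i [ini wt]] tX dX]]] : exists X s, [/\ {subset s <= S}, ~ certain_conflict B s,
            weak_init (A := A) (events s) t.1, t.2 = Some X & deltas (Some (start_set B)) (events s) = Some X].
          case: (so5 _ tL) => s [x [sS nc sx []]] /set1_inj xE tX; have [X dX] := deltas_events (start_set B) s.
          by exists X, s; rewrite xE tX dX.
        have [Y dY] : exists Y, delta t.2 (lab S e) = Some Y by rewrite eE' tX; eexists.
        have ds : deltas (Some (start_set B)) (events (rcons s ev)) = Some Y.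
          by rewrite -cats1 events_cat deltas_cat dX -tX /= -eE' dY.
        have sS' : {subset rcons s ev <= S} by move=> a; rewrite mem_rcons inE => /orP [/eqP ->|/sS].
        apply: triple_seq; apply: triple_assign; last exact: leqnn.
        rewrite /= X7 e7 d7 dY; set m8 := write _ _ _ _.
        have k8 : keep m8 by apply: agree_write.
        have [x8 e8 Y8] : [/\ m8 "x" [::] = ix t.1, m8 "e" [::] = e & m8 "Y" [::] = code (Some Y)] by rewrite /m8; wr.
        have nL8 : starts_are (L5 ++ L7)%SEQ m8 by case: nL7 => qa qb qc qd; split=> // t'; rewrite /m8; wr.
        have split_e (L' : seq start_type) : (forall k y Y, k < e -> k < nE -> delta t.2 (lab S k) = Some Y ->
              weak (A := A) t.1 [:: lab S k] y -> ~ LC ((Some set0, Some Y) : D) -> (y, Some Y) \in L') ->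
            (forall y, weak (A := A) t.1 [:: lab S e] y -> ~ LC ((Some set0, Some Y) : D) -> (y, Some Y) \in L') ->
            forall k y Y, k < e.+1 -> k < nE -> delta t.2 (lab S k) = Some Y ->
              weak (A := A) t.1 [:: lab S k] y -> ~ LC ((Some set0, Some Y) : D) -> (y, Some Y) \in L'.
          move=> H1 H2 k y Y'; rewrite ltnS leq_eqVlt => /orP [/eqP ->|ke]; last exact: H1.
          by move=> _; rewrite dY => -[<-]; apply: H2.
        have cE : m8 "conf" [:: code (Some Y)] = `[< LC ((Some set0, Some Y) : D) >].
          by rewrite k8 //; apply: conf0.
        apply: triple_when => /=; rewrite Y8 cE; last first.
          move=> /bool_eq0; rewrite eqb0 negbK => /asboolP lcY; exists L7; split=> //.
          by apply: split_e => // y _ /(_ lcY).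
        rewrite bool_neq0 eqb0 => /asboolP nlc.
        have nc' : ~ certain_conflict B (rcons s ev) by rewrite (certain_conflict_rcons sS' nc ds).
        apply: (triple_for_fin (Q := fstate A) (I := fun i => J (fun k y => (k < e) || ((k == e) && (ix y < i))))).
        -- by [].
        -- by [].
        -- by rewrite /= k8.
        -- by exists L7; split=> // k y Y'; rewrite ltn0 andbF orbF; apply: c7.
        -- move=> y m9 ag9 y9 [L9 [nL9 so9 c9]].
           have st9 : m9 "stepA" [:: e; ix t.1; ix y] != 0 <-> weak (A := A) t.1 [:: lab S e] y.
             by rewrite (ag9 "stepA" erefl) k8 //; apply: stA; apply: ltnW.
           apply: triple_when => /=; rewrite (ag9 "e" erefl) (ag9 "x" erefl) e8 x8 y9.
             move=> /st9 ty.
             have Y9 : m9 "Y" [::] = code (Some Y) by rewrite (ag9 "Y" erefl).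
             apply: triple_post (add_start_correct (t := (y, Some Y)) nL9 _ _ _ _) _ => // mA nLA _.
             pose q' := if (y, Some Y) \in (L5 ++ L9)%SEQ then [::] else [:: (y, Some Y)].
             have LE : (if (y, Some Y) \in (L5 ++ L9)%SEQ then (L5 ++ L9)%SEQ else rcons (L5 ++ L9)%SEQ (y, Some Y)) = (L5 ++ (L9 ++ q'))%SEQ.
               by rewrite /q'; case: ifP => _; rewrite ?cats0 // -cats1 catA.
             rewrite LE in nLA; exists (L9 ++ q')%SEQ; split.
             ++ by case: nLA => qa qb qc qd; split=> // t'; wr.
             ++ move=> t'; rewrite catA mem_cat => /orP [/so9 //|].
                rewrite /q'; case: ifP => // _; rewrite inE => /eqP ->.
                apply: (start_atP sS' _ ds nc'); exists i; split=> //.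
                by rewrite -cats1 events_cat; apply/weak_cat; exists t.1 => //=; rewrite -eE'.
             move=> k y' Y'; rewrite ix_ltS andb_orr orbA catA mem_cat => hk kE dk wk nk.
             case/orP: hk => [hk|/andP [/eqP ke /eqP yy]]; first by rewrite (c9 k y' Y').
             have YE : Y = Y' by move: dk; rewrite ke dY => -[].
             by rewrite yy -YE /q'; case: ifP => [yL|_]; rewrite ?yL ?inE ?eqxx ?orbT.
           move=> st0; exists L9; split=> // k y' Y'; rewrite ix_ltS andb_orr orbA => hk kE dk wk nk.
           case/orP: hk => [hk|/andP [/eqP ke /eqP yy]]; first exact: (c9 k y' Y').
           by rewrite ke yy in wk; have := proj2 st9 wk; rewrite st0.
        move=> m9 ag9 [L9 [nL9 so9 c9]]; exists L9; split=> //.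
        move=> k y Y' ke; apply: c9; move: ke; rewrite ltnS leq_eqVlt orbC => /orP [->//|->].
        by rewrite ltn_ord orbT.
      move=> m7 ag7 [L7 [nL7 so7 c7]]; exists (L5 ++ L7)%SEQ, h.+1; split=> //.
      * by apply: agree_trans k6 (agree_incl _ ag7).
      * by rewrite (ag7 "shead" erefl) h6 size_cat (leq_trans hs) ?leq_addr.
      split=> //; first by move=> x wx nx; rewrite mem_cat c5.
      move=> t' k y Y; rewrite takel_cat // (take_nth t hs) tE mem_rcons inE.
      case/orP => [/eqP ->|th] kE; first by apply: c7.
      by move=> dk wk nk; rewrite mem_cat (cl5 t' k).
    + rewrite /w /=; nia.
    + move=> m6 I6; exists ((N - h.+1) * w) => //.
      rewrite -(subnSK hN) mulSn /w /=; nia.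
  move=> f m5 /= ne [L5 [h [k5 [h5 hs] nL5 so5 [c5 cl5 _]]]].
  have [uL5 t5 _ ab5] := nL5.
  rewrite h5 t5 in ne; have hE : h = size L5.
    by apply/eqP; rewrite eqn_leq hs leqNgt; move: ne; case: (h < size L5).
  rewrite hE take_size in cl5; exists L5; split=> // -[y Y0]; split; first exact: so5.
  case=> s [x [sS nc sx [/set1_inj -> ->]]] {y Y0}.
  (* The trace is built up from the left, as the search does; the target of each extension is found
     when its source is dequeued. *)
  elim/last_ind: s sS nc x sx => [|s e IH] sS nc x sx.
    by apply: c5 => //; apply/noconf0.
  have sS' : {subset s <= S} by move=> a as_; apply: sS; rewrite mem_rcons inE as_ orbT.
  have eS : e \in S by apply: sS; rewrite mem_rcons inE eqxx.
  have [X dX] := deltas_events (start_set B) s; have [Y dY] := deltas_events (start_set B) (rcons s e).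
  have nc' : ~ certain_conflict B s.
    move=> /(certain_conflictP A B sS') [r [u [ru hr]]]; apply: nc.
    by apply/(certain_conflictP A B sS); exists r, (rcons u e); rewrite -rcons_cat ru.
  move: sx => [i [ini]]; rewrite -cats1 events_cat => /weak_cat [z iz zx].
  have zL := IH sS' nc' z (ex_intro _ i (conj ini iz)).
  have [k kE kv] := lab_onto (eS : ev_in S (Ev e)).
  have {}kE : k < nE.
    by rewrite ltn_neqAle kE andbT; apply/eqP => kn; move: kv; rewrite kn lab_term.
  rewrite -events_cat cats1 dY; apply: (cl5 _ k x Y zL kE); rewrite ?kv //=.
    by rewrite -dY -cats1 events_cat deltas_cat.
  by move=> lcY; apply: nc; apply/(certain_conflict_rcons sS nc' dY).
have NE : #|{: start_type}| = nA * (2 ^ n).+1 by rewrite card_prod card_det.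
rewrite /start_bound NE /=; lia.
Qed.
End StartPairs.

(** * Running time *)

(** The quotient of the two powers is largest at [n = 5], where it is 40.5. From there on the left
    side at most doubles, since the fourth power of 7/6 is below 2. *)
Lemma expn4_le_exp2 n : n.+1 ^ 4 <= 41 * 2 ^ n.
Proof.
have [n5|] := leqP n 5; first by move: n n5; do 6!case=> //.
elim: n => // n IH; rewrite ltnS leq_eqVlt => /orP [/eqP <- //|n5].
rewrite [2 ^ n.+1]expnS; apply: leq_trans (_ : 2 * n.+1 ^ 4 <= _); last by have := IH n5; lia.
have -> : n.+2 ^ 4 = n.+2 * n.+2 * (n.+2 * n.+2) by lia.
have -> : n.+1 ^ 4 = n.+1 * n.+1 * (n.+1 * n.+1) by lia.
have h : 6 * n.+2 <= 7 * n.+1 by lia.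
have h2 : 36 * (n.+2 * n.+2) <= 49 * (n.+1 * n.+1) by have := leq_mul h h; lia.
have := leq_mul h2 h2; lia.
Qed.

Section Bounds.
Variables e x y : nat.
Let a := 2 ^ x.
Let b := 2 ^ y.
Let u := a * b.
Let v := e.+1 * y.+1 ^ 2.

(** The successors keep the measure positive: without events or without states in B the product of
    the theorem vanishes, while the procedure still takes steps. *)
Definition work := e.+1 * y.+1 ^ 2 * (2 ^ x * 2 ^ y * (2 ^ x * 2 ^ y)).

Let a0 : 0 < a. Proof. exact: expn_gt0. Qed.
Let b0 : 0 < b. Proof. exact: expn_gt0. Qed.
Let au : a <= u. Proof. exact: leq_pmulr. Qed.
Let bu : b <= u. Proof. exact: leq_pmull. Qed.
Let u0 : 0 < u. Proof. by rewrite muln_gt0 a0. Qed.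
Let y2v : y.+1 * y.+1 <= v. Proof. by rewrite mulnn leq_pmull. Qed.
Let yv : y.+1 <= v. Proof. by apply: leq_trans y2v; apply: leq_pmull. Qed.
Let ev : e.+1 <= v. Proof. by apply: leq_pmulr; rewrite expn_gt0. Qed.
Let v0 : 0 < v. Proof. exact: leq_trans yv. Qed.
Let uw c : c * (v * u) <= c * work.
Proof. by rewrite leq_mul2l /work -/a -/b -/u -/v leq_mul2l leq_pmulr ?orbT. Qed.
Let low c z : z <= v * u -> c * z <= c * work.
Proof. by move=> zw; apply: leq_trans (uw c); rewrite leq_mul2l zw orbT. Qed.

Lemma exp2_sum : (2 ^ x).+1 * (2 ^ y).+1 <= 4 * (2 ^ x * 2 ^ y).
Proof. have : (2 ^ x).+1 * (2 ^ y).+1 <= (2 * a) * (2 * b) by apply: leq_mul; lia. lia. Qed.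

Lemma prepare_work : e.+2 * ((2 ^ x).+2 * x.+1 ^ 4) <= 246 * work /\
  e.+2 * ((2 ^ y).+2 * y.+1 ^ 4) <= 246 * work.
Proof.
have key z : 2 ^ z <= u -> e.+2 * ((2 ^ z).+2 * z.+1 ^ 4) <= 246 * work.
  move=> zu; have z0 : 0 < 2 ^ z by rewrite expn_gt0.
  (* The constant 246 is the product of 2, 3 and 41. *)
  have h : e.+2 * ((2 ^ z).+2 * z.+1 ^ 4) <= (2 * v) * ((3 * u) * (41 * u)).
    apply: leq_mul; first by lia.
    apply: leq_mul; first by lia.
    by apply: leq_trans (expn4_le_exp2 z) _; lia.
  by apply: leq_trans h _; rewrite /work -/a -/b -/u -/v; lia.
by split; apply: key.
Qed.

Lemma live_work : y.+1 * (e.+1 * (y.+1 * (y.+1 * 1))) <= work.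
Proof.
have h : (e.+1 * (y.+1 * y.+1)) * y.+1 <= v * u.
  apply: leq_mul; first by rewrite mulnn.
  by apply: leq_trans bu; apply: ltn_expl.
by have := low 1 h; lia.
Qed.

Lemma reset_work : (2 ^ x).+2 * ((2 ^ y).+2 * 60) <= 540 * work.
Proof.
have : a.+2 * (b.+2 * 60) <= (3 * a) * ((3 * b) * 60).
  by apply: leq_mul; [lia|rewrite leq_mul2r; lia].
have := low 540 (leq_pmull u v0); rewrite /a /b /u; lia.
Qed.

Lemma explore_work M : M <= 4 * (2 ^ x * 2 ^ y) -> M * (e.+2 * 400) + 20 <= 3220 * work.
Proof.
move=> Mu; have : M * (e.+2 * 400) <= (4 * u) * ((2 * v) * 400).
  by apply: leq_mul => //; rewrite leq_mul2r; lia.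
have := uw 3200; have := low 20 (leq_mul v0 u0); lia.
Qed.

Lemma lcp_work M : M <= 4 * (2 ^ x * 2 ^ y) ->
  M.+2 * (M * (e.+2 * (y.+1 * (y.+1 * 800))) + 1000 * y.+1 + M.+1 * (y.+1 * 150) + 100)
    <= 6 * (55 * 150) * work.
Proof.
move=> Mu.
have h1 : M * (e.+2 * (y.+1 * (y.+1 * 800))) <= 80 * 80 * (v * u).
  have : M * (e.+2 * (y.+1 * (y.+1 * 800))) <= (4 * u) * ((2 * e.+1) * (y.+1 * (y.+1 * 800))).
    by apply: leq_mul => //; rewrite leq_mul2r; lia.
  rewrite /v -mulnn; lia.
have h2 : y.+1 <= v * u by apply: leq_trans yv _; apply: leq_pmulr.
have h3 : M.+1 * (y.+1 * 150) <= (5 * u) * (v * 150).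
  by apply: leq_mul; [lia|rewrite leq_mul2r yv orbT].
have h4 : 1 <= v * u by apply: (leq_mul v0 u0).
have h5 : M.+2 <= 6 * u by lia.
(* The four summands contribute 6400, 1000, 750 and 100, in total 8250, which is 55 times 150. *)
have h6 : M * (e.+2 * (y.+1 * (y.+1 * 800))) + 1000 * y.+1 + M.+1 * (y.+1 * 150) + 100
    <= 55 * 150 * (v * u) by lia.
apply: leq_trans (leq_mul h5 h6) _; rewrite /work -/a -/b -/u -/v; lia.
Qed.

Lemma start_work : y.+1 * (y.+1 * 30 + 30) + x.+1 * (x.+1 * 100) +
  x * (2 ^ y).+1 * (e.+1 * (x.+1 * 200)) + 200 <= 760 * work.
Proof.
have xa : x.+1 <= a by apply: ltn_expl.
have h1 : y.+1 * (y.+1 * 30 + 30) <= 60 * (y.+1 * y.+1) by nia.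
have h2 := low 60 (leq_trans y2v (leq_pmulr v u0)).
have wE : work = v * (u * u) by [].
have h3 : x.+1 * x.+1 <= work.
  by rewrite wE -[_ * _]mul1n; apply: leq_mul v0 _; apply: leq_mul; apply: leq_trans xa au.
have h4 : x * b.+1 * (e.+1 * (x.+1 * 200)) <= (a * (2 * b)) * (v * (a * 200)).
  by apply: leq_mul; apply: leq_mul; lia.
have h5 : (a * (2 * b)) * (v * (a * 200)) <= 400 * work.
  rewrite wE; have -> : a * (2 * b) * (v * (a * 200)) = 400 * (v * (u * a)) by rewrite /u; lia.
  by rewrite !leq_mul2l au !orbT.
have h6 : 1 <= work by rewrite wE; apply: (leq_mul v0 (leq_mul u0 u0)).
rewrite -/b; lia.
Qed.

Lemma starts_work : (x * (2 ^ y).+1).+1 <= 3 * work /\ (2 ^ y).+2 <= 3 * work.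
Proof.
have xa : x.+1 <= a by apply: ltn_expl.
have h : x * b.+1 <= a * (2 * b) by apply: leq_mul; lia.
have uE : u = a * b by []; have := low 1 (leq_pmull u v0); rewrite -/b; split; lia.
Qed.

Lemma work_le : 0 < e -> 0 < y -> work <= 8 * (e * y ^ 2 * 4 ^ x * 4 ^ y).
Proof.
move=> e0 y0; have h : e.+1 * y.+1 ^ 2 <= (2 * e) * (2 * y) ^ 2.
  by apply: leq_mul; [lia|rewrite leq_exp2r; lia].
have E4 z : 4 ^ z = 2 ^ z * 2 ^ z by rewrite -expnMn.
rewrite /work !E4 -/a -/b -/u; apply: leq_trans (leq_mul h (leqnn _)) _.
by rewrite expnMn /u; lia.
Qed.

(** Every polynomial factor is below a power of 2, which gives the exponent [C + e + 2 * x + 4 * y];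
    the 4 is the coefficient of [y]. *)
Lemma work_exp C : C * work <= 2 ^ ((C + 4) * (e + x + y).+1).
Proof.
have h : C * work <= 2 ^ C * ((2 ^ e * (2 ^ y) ^ 2) * (a * b * (a * b))).
  apply: leq_mul; first by apply/ltnW/ltn_expl.
  apply: leq_mul => //; apply: leq_mul; first exact: ltn_expl.
  by rewrite leq_exp2r //; apply: ltn_expl.
apply: leq_trans h _; rewrite /a /b -expnM -!expnD leq_exp2l //; nia.
Qed.

End Bounds.

(** * The procedure *)

Section Answer.
Variables (E : choiceType) (S : {fset E}) (A B : fin_automaton S).
Local Notation D := (det_pair A B).
Local Notation nE := (size (enum_fset S)).
Local Notation nA := #|fstate A|.
Local Notation n := #|fstate B|.
Implicit Types (t : start_type A B) (p : D) (m : memory).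

Definition pair_of t : D := (Some [set t.1], t.2).

Lemma starts_nth (L : seq (start_type A B)) m k : starts_are L m -> k < size L ->
  exists2 t, t \in L & [/\ take k.+1 L = rcons (take k L) t,
    m "startA" [:: k] = ix t.1 & m "startB" [:: k] = code t.2].
Proof.
move=> [_ _ _ abL] kL; have [t tE] : exists t, forall u, nth u L k = t.
  by case: (L) kL => // u s ks; exists (nth u (u :: s) k) => v; apply: set_nth_default.
have [tA tB] := abL k t kL (tE t).
exists t; first by have := mem_nth t kL; rewrite tE.
by rewrite (take_nth t kL) tE.
Qed.

Lemma size_starts (L : seq (start_type A B)) m : starts_are L m ->
  size L <= nA * (2 ^ n).+1.
Proof.
case=> /card_uniqP <- _ _ _; apply: leq_trans (max_card _) _.
by rewrite card_prod card_det.
Qed.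

Lemma starts_agree (L : seq (start_type A B)) m m' l : agree l m m' ->
  ~~ has (smem^~ l) [:: "stail"; "start"; "startA"; "startB"] -> starts_are L m -> starts_are L m'.
Proof.
move=> ag /= /norP [/negbTE h1 /norP [/negbTE h2 /norP [/negbTE h3 /norP [/negbTE h4 _]]]].
by case=> qa qb qc qd; split=> //; rewrite ?(ag _ h1) ?(ag _ h2) ?(ag _ h3) ?(ag _ h4).
Qed.

Definition start_nodes : cmd :=
  For "h" (Var "stail") (add_node (Rd "powA" [:: Rd "startA" [:: Var "h"]]) (Rd "startB" [:: Var "h"])).

Lemma pow_start m t : env A B m -> m "powA" [:: ix t.1] = code (pair_of t).1.
Proof. by move=> [[_ [_ pA _] _ _] _ _]; rewrite code_set1; apply: pA. Qed.

Lemma start_nodes_correct L m : env A B m -> starts_are L m -> nodes_are (Nil D) m ->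
  triple m start_nodes ((nA * (2 ^ n).+1).+1 * 100) (fun m' => exists P, nodes_are P m' /\
    forall t, t \in L -> pair_of t \in P).
Proof.
move=> envm stL n0; have [uL tL _ _] := stL; rewrite /start_nodes.
apply: (triple_weaken _ _ (fun _ h => h)).
  apply: (triple_for_le (N := size L) (I := fun k m' => exists P, nodes_are P m' /\
    forall t, t \in take k L -> pair_of t \in P)).
  - exact: size_starts stL.
  - by [].
  - by [].
  - by rewrite /= tL.
  - by exists [::]; split=> // t; rewrite take0.
  - move=> k m1 kL ag1 k1 [P [nP inP]].
    have st1 : starts_are L m1 by apply: starts_agree ag1 _ stL.
    have [t tin [tE tA tB]] := starts_nth st1 kL.
    have env1 : env A B m1 by apply: env_agree envm; last exact: ag1.
    apply: triple_post (add_node_correct (p := pair_of t) nP _ _ _ _) _ => //.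
    + by rewrite /= k1 tA pow_start.
    + by rewrite /= k1 tB.
    move=> m2 nP2 _; eexists; split; first exact: nP2.
    move=> t'; rewrite tE mem_rcons inE => /orP [/eqP ->|/inP tP]; case: ifP => //.
      by rewrite mem_rcons inE eqxx.
    by rewrite mem_rcons inE tP orbT.
  by move=> m1 _ [P [nP inP]]; exists P; split=> // t tL'; apply: inP; rewrite take_size.
by rewrite /=; lia.
Qed.

Definition final_answer : cmd :=
  Seq (Assign "answer" [::] 1)
  (For "h" (Var "stail") (When (Bin Eq (Rd "lc" [:: Rd "powA" [:: Rd "startA" [:: Var "h"]]; Rd "startB" [:: Var "h"]]) 0)
      (Assign "answer" [::] 0))).

Lemma final_answer_correct L m : env A B m -> starts_are L m ->
  (forall t, t \in L -> at_pair m "lc" (pair_of t) != 0 <-> LC (pair_of t)) ->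
  triple m final_answer ((nA * (2 ^ n).+1).+1 * 50 + 10)
    (fun m' => m' "answer" [::] = all (fun t => `[< LC (pair_of t) >]) L).
Proof.
move=> envm stL lcL; have [uL tL _ _] := stL; rewrite /final_answer.
apply: (triple_weaken _ _ (fun _ h => h)).
  apply: triple_seq; apply: triple_assign; last exact: leqnn.
  set m0 := write _ _ _ _.
  apply: (triple_for_le (N := size L) (I := fun k m' => m' "answer" [::] = all (fun t => `[< LC (pair_of t) >]) (take k L))).
  - exact: size_starts stL.
  - by [].
  - by [].
  - by rewrite /= /m0; wr.
  - by rewrite take0 /m0; wr.
  - move=> k m1 kL ag1 k1 a1.
    have ag : agree [:: "h"; "answer"] m m1.
      by apply: agree_trans ag1; apply: agree_write.
    have st1 : starts_are L m1 by apply: starts_agree ag _ stL.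
    have [t tin [tE tA tB]] := starts_nth st1 kL.
    have env1 : env A B m1 by apply: env_agree envm; last exact: ag.
    have lcE : at_pair m1 "lc" (pair_of t) != 0 <-> LC (pair_of t).
      by rewrite /at_pair (ag "lc" erefl); apply: lcL.
    rewrite /at_pair in lcE.
    apply: triple_when; rewrite /= k1 tA tB pow_start //.
      rewrite bool_neq0 => /eqP l0; apply: triple_assign; last exact: leqnn.
      rewrite tE all_rcons; wr; case: asboolP => // /lcE; by rewrite l0.
    move=> /bool_eq0 /lcE lct; wr; rewrite a1 tE all_rcons.
    by have -> : `[< LC (pair_of t) >] = true by apply/asboolP.
  by move=> m1 _; rewrite take_size.
by rewrite /=; lia.
Qed.

Lemma prepared_agree (C : fin_automaton S) u l m m' : agree l m m' ->
  ~~ has (smem^~ l) ("nE" :: map (String.append^~ u)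
    [:: "n"; "trans"; "N"; "pow"; "mem"; "closure"; "step"; "delta"]) ->
  prepared C u m -> prepared C u m'.
Proof.
rewrite /prepared /graph_is /subset_codes /steps_are /delta_is => ag /= no.
by do 9!(case/norP: no => /negbTE /ag E' no; rewrite ?E'; clear E').
Qed.

Lemma all_ev_in s : (forall e r u, s = r ++ Ev e :: u -> e \in S)%SEQ -> all (ev_in S) s.
Proof.
elim: s => //= v s IH h; rewrite IH ?andbT; last first.
  by move=> e r u sE; apply: (h e (v :: r) u); rewrite sE.
by case: v h => //= e h; apply: (h e [::] s).
Qed.

Lemma input_graphs : graph_is A "A" (input A B) /\ graph_is B "B" (input A B).
Proof. by []. Qed.

Lemma input_inits : inits_are A "A" (input A B) /\ inits_are B "B" (input A B).
Proof. by split=> x; rewrite -init_table_ix. Qed.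

Definition correct_tables m :=
  [/\ forall s : seq E, {subset s <= S} -> certain_conflict B s <->
        exists r u, (r ++ u)%SEQ = s /\
          conf_table m (code (deltas (Some (start_set B)) (events r))) = 1,
      forall p k, reachable_pair p ->
        0 < lc_table m (code p.1) (code p.2) <= k.+1 <-> exists2 i, i <= k & LCn i p,
      forall p (x : fstate B), reachable_pair p ->
        mc_table m (code p.1) (code p.2) (enum_rank x) = 1 <-> MCn (iterations m).-1 p x,
      answer m = 1 <-> forall p : D, start_pair p -> LC p &
      answer m = 1 <-> less_conflicting A B].

Definition procedure_bound C1 C2 :=
  C1 * (nE.+2 * ((2 ^ nA).+2 * nA.+1 ^ 4)) +
  (C1 * (nE.+2 * ((2 ^ n).+2 * n.+1 ^ 4)) +
  (C2 * (n.+1 * (nE.+1 * (n.+1 * (n.+1 * 1)))) +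
  ((reset_bound A B + (2 ^ n).+2 * 100 + explore_bound A B + lcp_bound A B + (2 ^ n).+1 * 50) +
  (start_bound A B + (reset_bound A B + ((nA * (2 ^ n).+1).+1 * 100 +
  (explore_bound A B + (lcp_bound A B + ((nA * (2 ^ n).+1).+1 * 50 + 10))))))))).

End Answer.

Lemma procedure_correct : exists C1 C2, forall (E : choiceType) (S : {fset E})
    (A B : fin_automaton S),
  triple (input A B) procedure (procedure_bound A B C1 C2) (correct_tables A B).
Proof.
have [C1 H1] := prepare_correct; have [C2 H2] := live_states_correct.
exists C1, C2 => E S A B; set m0 := input A B.
have [gA gB] := input_graphs A B; have [iA iB] := input_inits A B.
rewrite /procedure /procedure_bound.
apply: triple_seq; apply: triple_post (H1 "A" E S A m0 gA _ _ _) _ => // m1 pA ag1.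
have gB1 : graph_is B "B" m1.
  by case: gB => qa qb qc; split; [rewrite (ag1 "nB" erefl)|rewrite (ag1 "nE" erefl)|rewrite (ag1 "transB" erefl)].
apply: triple_seq; apply: triple_post (H1 "B" E S B m1 gB1 _ _ _) _.
- by move=> j; rewrite (ag1 "memB" erefl).
- by move=> j; rewrite (ag1 "closureB" erefl).
- by move=> j; rewrite (ag1 "stepB" erefl).
move=> m2 pB ag2.
have pA2 : prepared A "A" m2 by apply: prepared_agree ag2 _ pA.
have [gB2 _ sB2 _] := pB.
apply: triple_seq; apply: triple_post (H2 E S B m2 gB2 sB2 _) _.
  by move=> j; rewrite (ag2 "live" erefl) (ag1 "live" erefl).
move=> m3 lv ag3.
have env3 : env A B m3.
  by split=> //; [apply: prepared_agree ag3 _ pA2|apply: prepared_agree ag3 _ pB].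
apply: triple_seq; apply: triple_post (certain_conflicts_correct env3) _ => m4 cf4 ag4.
have env4 : env A B m4 by apply: env_agree env3; last exact: ag4.
have iA4 : inits_are A "A" m4.
  by move=> x; rewrite (ag4 "initA" erefl) (ag3 "initA" erefl) (ag2 "initA" erefl) (ag1 "initA" erefl).
have iB4 : inits_are B "B" m4.
  by move=> x; rewrite (ag4 "initB" erefl) (ag3 "initB" erefl) (ag2 "initB" erefl) (ag1 "initB" erefl).
apply: triple_seq; apply: triple_post (start_pairs_correct env4 iA4 iB4 cf4 _) _.
  by move=> j; rewrite (ag4 "start" erefl) (ag3 "start" erefl) (ag2 "start" erefl) (ag1 "start" erefl).
move=> m5 [L [stL Lat]] ag5.
have env5 : env A B m5 by apply: env_agree env4; last exact: ag5.
apply: triple_seq; apply: triple_post (reset_correct env5) _ => m6 [n6 c6 l6] ag6.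
have env6 : env A B m6 by apply: env_agree env5; last exact: ag6.
have st6 : starts_are L m6 by apply: starts_agree ag6 _ stL.
apply: triple_seq; apply: triple_post (start_nodes_correct env6 st6 n6) _ => m7 [P [n7 LP]] ag7.
have env7 : env A B m7 by apply: env_agree env6; last exact: ag7.
have c7 (p : det_pair A B) : at_pair m7 "cnt" p = 0 by rewrite /at_pair (ag7 "cnt" erefl); apply: c6.
apply: triple_seq; apply: triple_post (explore_correct env7 n7 c7) _ => m8 [P8 [n8 sub8 cl8 pr8]] ag8.
have env8 : env A B m8 by apply: env_agree env7; last exact: ag8.
have l8 (p : det_pair A B) : at_pair m8 "lc" p = 0.
  by rewrite /at_pair (ag8 "lc" erefl) (ag7 "lc" erefl); apply: l6.
apply: triple_seq; apply: triple_post (less_conflicting_pairs_correct env8 n8 cl8 pr8 l8) _.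
move=> m9 [lc9 mc9] ag9.
have env9 : env A B m9 by apply: env_agree env8; last exact: ag9.
have st9 : starts_are L m9.
  by apply: starts_agree ag9 _ _ => //; apply: starts_agree ag8 _ _ => //; apply: starts_agree ag7 _ _.
have LC9 p : p \in P8 -> at_pair m9 "lc" p != 0 <-> LC p.
  move=> pP; rewrite -lt0n; split=> [l0|/LC_LCupto [k h]].
    apply/LC_LCupto; exists (at_pair m9 "lc" p).-1.
    by apply/(lc9 p pP); rewrite prednK // l0 leqnn.
  by have /andP [] := proj2 (lc9 p pP k) h.
apply: triple_post (final_answer_correct env9 st9 _) _ => [t tL|m ans ag].
  by apply: LC9; apply: sub8; apply: LP.
have lcm : m "lc" = m9 "lc" by apply: (ag "lc" erefl).
have mcm : m "mc" = m9 "mc" by apply: (ag "mc" erefl).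
have nm : m "n" = m9 "n" by apply: (ag "n" erefl).
have cfm : m "conf" = m4 "conf".
  by rewrite (ag "conf" erefl) (ag9 "conf" erefl) (ag8 "conf" erefl) (ag7 "conf" erefl) (ag6 "conf" erefl) (ag5 "conf" erefl).
(* The explored pairs contain the start pairs and are closed, so they include everything
   reachable. *)
have reach p : reachable_pair p -> p \in P8.
  case=> q [s [sq sS ->]]; apply: (closed_pairsP cl8); last exact: all_ev_in sS.
  case: sq => s' [x [s'S nc sx ->]]; apply: (sub8 (pair_of (x, _))); apply: LP.
  by apply/Lat; exists s', x.
have ansP : answer m = 1 <-> forall p : det_pair A B, start_pair p -> LC p.
  rewrite /answer ans; split=> [|h].
    case: (boolP (all _ _)) => // /allP al _ p sp; have [s [x [s'S nc sx pE]]] := sp.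
    have : (x, deltas (Some (start_set B)) (events s)) \in L by apply/Lat; exists s, x.
    by move=> /al /asboolP; rewrite pE.
  suff -> : all (fun t => `[< LC (pair_of t) >]) L by [].
  by apply/allP => t /Lat st; apply/asboolP; apply: h.
split=> //.
- move=> s sS; rewrite (certain_conflictP A B sS); split=> -[r [w [rw h]]]; exists r, w; split=> //.
    have [X dX] := deltas_events (start_set B) r; rewrite dX in h *.
    by rewrite /conf_table cfm cf4; have -> : `[< LC ((Some set0, Some X) : det_pair A B) >] = true by apply/asboolP.
  have [X dX] := deltas_events (start_set B) r; rewrite dX in h *.
  by move: h; rewrite /conf_table cfm cf4; case: asboolP.
- by move=> p k /reach pP; rewrite -LCuptoP /lc_table lcm; apply: lc9.
- move=> p x /reach pP; rewrite MCn_more /mc_table mcm /iterations nm.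
  have -> : m9 "mc" [:: code p.1; code p.2; ix x] = mc_at m9 ((p, x) : triple_type A B) by [].
  by rewrite (mc9 (p, x) pP); case: asboolP.
by rewrite ansP; symmetry; apply: less_conflictingP.
Qed.

Lemma procedure_work C1 C2 : exists C, forall (E : choiceType) (S : {fset E}) (A B : fin_automaton S),
  procedure_bound A B C1 C2 <= C * work (size (enum_fset S)) #|fstate A| #|fstate B|.
Proof.
exists (246 * C1 + 246 * C1 + C2 + (540 + 300 + 3220 + 6 * (55 * 150) + 150) + (760 + (540 + (300
  + (3220 + (6 * (55 * 150) + 160)))))) => E S A B.
set e := size _; set x := #|fstate A|; set y := #|fstate B|.
have M4 : #|{: det_pair A B}| <= 4 * (2 ^ x * 2 ^ y) by rewrite card_pairs; apply: exp2_sum.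
have [pA pB] := prepare_work e x y; have [s1 s2] := starts_work e x y.
have lv := live_work e x y; have rs := reset_work e x y.
have ex : explore_bound A B <= _ := explore_work e M4.
have lp : lcp_bound A B <= _ := lcp_work e M4.
have st := start_work e x y; have rb : reset_bound A B <= _ := rs.
have sb : start_bound A B <= _ := st.
have pA' := leq_mul (leqnn C1) pA; have pB' := leq_mul (leqnn C1) pB.
have lv' := leq_mul (leqnn C2) lv.
rewrite /procedure_bound -/e -/x -/y.
move: (work e x y) (reset_bound A B) (explore_bound A B) (lcp_bound A B) (start_bound A B) rb ex lp sb pA' pB' lv' s1 s2 => W.
clear; move=> rbd exd lpd sbd rb ex lp sb.
set t1 := C1 * _; set t2 := C1 * (e.+2 * _); set t3 := C2 * (y.+1 * _).
move: t1 t2 t3; move: (x * (2 ^ y).+1); move: (2 ^ y) => z2 z1 t1 t2 t3; lia.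
Qed.
Local Close Scope string_scope.

Theorem mainTheorem4 :
  exists C K : nat,
  forall (E : choiceType) (S : {fset E}) (A B : fin_automaton S),
  exists (m : memory) (t : nat),
    exec procedure (input A B) m t
    (* the tables computed by the procedure *)
    /\ (forall s : seq E, {subset s <= S} ->
          certain_conflict B s <->
          exists r u, r ++ u = s /\
            conf_table m (code (deltas (Some (start_set B)) (events r))) = 1)
    /\ (forall (p : det_pair A B) (n : nat), reachable_pair p ->
          0 < lc_table m (code p.1) (code p.2) <= n.+1 <->
          exists2 i, i <= n & LCn i p)
    /\ (forall (p : det_pair A B) (x : fstate B), reachable_pair p ->
          mc_table m (code p.1) (code p.2) (enum_rank x) = 1 <->
          MCn (iterations m).-1 p x)
    (* the answer *)
    /\ (answer m = 1 <-> forall p : det_pair A B, start_pair p -> LC p)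
    /\ (answer m = 1 <-> less_conflicting A B)
    (* the running time *)
    /\ (0 < #|` S|%fset -> 0 < #|fstate B| ->
          t <= C * (#|` S|%fset * #|fstate B| ^ 2
                    * 4 ^ #|fstate A| * 4 ^ #|fstate B|)
          /\ t <= C * (#|` S|%fset * #|fstate B| ^ 2
                       * 2 ^ (2 * #|fstate A| + 2 * #|fstate B|)))
    /\ t <= 2 ^ (K * (#|` S|%fset + #|fstate A| + #|fstate B|).+1).
Proof.
have [C1 [C2 correct]] := procedure_correct; have [C bound] := procedure_work C1 C2.
(* The 8 is the price in [work_le] of replacing successors by the positive numbers themselves; the 4
   comes from [work_exp]. *)
exists (C * 8), (C + 4) => E S A B.
have [m [t [ex tb [conf lc mc ans lcf]]]] := correct E S A B.
have tw := leq_trans tb (bound E S A B).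
exists m, t; split; first exact: ex.
split; first exact: conf.
split; first exact: lc.
split; first exact: mc.
split; first exact: ans.
split; first exact: lcf.
split; last exact: leq_trans tw (work_exp _ _ _ _).
move=> e0 y0; have t8 := leq_trans tw (leq_mul (leqnn C) (work_le #|fstate A| e0 y0)).
have E2 : 2 ^ (2 * #|fstate A| + 2 * #|fstate B|) = 4 ^ #|fstate A| * 4 ^ #|fstate B|.
  by rewrite expnD !expnM.
by rewrite E2; split; lia.
Qed.
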